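(* Let $X$ be a finite non-empty set regarded as a trivial rack, let $A$ be a finite non-trivial abelian group, written multiplicatively, and let $\sigma:X\to A$ be a non-constant function. Put $\kappa_{ij}=\sigma_i\sigma_j^{-1}$ for $i,j\in X$. Let $Y=X\times A$ be the rack with $(i,a)\triangleright(j,b)=(j,\,b\,\kappa_{ij})$. Let $(q_{ij})_{i,j\in X}$ be a family in $\mathbb C^\times$, let $\omega\in\widehat A$ be a character of $A$, and let $\mathfrak q$ be the $2$-cocycle on $Y$ given by $\mathfrak q_{(i,a),(j,b)}=\omega(b)\,\omega(a)^{-1}\,q_{ij}$. Let $(V,c)$ be the braided vector space $(\mathbb CY,c^{\mathfrak q})$. (1) If $\mathrm{ord}\,q_{ii}>3$ for some $i$, then $\dim\mathfrak B(V)=\infty$. (2) If $\mathrm{ord}\,q_{ii}=3$ for some $i$, then either $A\simeq C_2$, the group of order $2$ (hence $27$ divides $\dim\mathfrak B(V)$ if this is finite), or else $\dim\mathfrak B(V)=\infty$. (3) Assume that $q_{ii}=-1$ for all $i\in X$, that $q_{ij}q_{ji}=(-1)^{A_{ij}}$ with $A_{ij}\in\{0,-1\}$ for all $i\ne j\in X$, and that $\mathrm{ord}\,\kappa_{ij}\le2$ for all $i,j$. Then, if $A\not\simeq C_2$, $\dim\mathfrak B(V)=\infty$. (4) Same hypotheses as in (3) on $(q_{ij})$ and $\kappa$; assume that $A\simeq\{\pm1\}\simeq C_2$, and let $X_\pm=\{i\in X:\sigma_i=\pm1\}$. Assume that Conjecture D (stated in the context) is true. Then: - if $\mathrm{card}\,X_+=1$,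 $\mathrm{card}\,X_-\le3$ and $q_{ij}q_{ji}=1$ for all $i\ne j\in X_-$, then $\dim\mathfrak B(V)$ is finite; - if $\mathrm{card}\,X_-=1$, $\mathrm{card}\,X_+\le3$ and $q_{ij}q_{ji}=1$ for all $i\ne j\in X_+$, then $\dim\mathfrak B(V)$ is finite; - in all other cases, $\dim\mathfrak B(V)=\infty$.
   Context: The trivial rack structure on $X$ is $i\triangleright j=j$. For a rack $(Y,\triangleright)$ and a function $\mathfrak q:Y\times Y\to\mathbb C^\times$ satisfying the $2$-cocycle condition $\mathfrak q_{x,y\triangleright z}\mathfrak q_{y,z}=\mathfrak q_{x\triangleright y,x\triangleright z}\mathfrak q_{x,z}$, $(\mathbb CY,c^{\mathfrak q})$ is the vector space with basis $Y$ and braiding $c^{\mathfrak q}(x\otimes y)=\mathfrak q_{x,y}\,(x\triangleright y)\otimes x$. $\mathrm{ord}$ denotes the (multiplicative) order of an element. Nichols algebra of a braided vector space $(V,c)$ ($c$ satisfying the braid equation $(c\otimes\mathrm{id})(\mathrm{id}\otimes c)(c\otimes\mathrm{id})=(\mathrm{id}\otimes c)(c\otimes\mathrm{id})(\mathrm{id}\otimes c)$): let the braid group $\mathbb B_n$ (generators $\sigma_i$) act on $V^{\otimes n}$, $\sigma_i$ by $c$ in positions $i,i+1$; for $x\in\mathbb S_n$ with shortest expression $x=\tau_{i_1}\cdots\tau_{i_l}$ in elementary transpositions put $M(x)=\sigma_{i_1}\cdots\sigma_{i_l}$; $Q_n=\sum_{x\in\mathbb S_n}M(x)$; then $\mathfrak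 B(V)=\mathbb C\oplus V\oplus\bigoplus_{n\ge2}V^{\otimes n}/\ker Q_n$. Conjecture D: let $(W,c)$ be a braided vector space with $W=\mathbb Cx_1\oplus\cdots\oplus\mathbb Cx_\theta$ and $c(x_i\otimes x_j)=q_{ij}x_j\otimes x_i$, where $q_{ii}=-1$ and $q_{ij}\in\{\pm1\}$ for all $i,j$; for $i\ne j$ let $A_{ij}\in\{0,-1\}$ be such that $q_{ij}q_{ji}=(-1)^{A_{ij}}$, and let $A_{ii}=2$. Then $\dim\mathfrak B(W)=2^{12}$ if the generalized Cartan matrix $(A_{ij})$ is of type $D_4$, and $\dim\mathfrak B(W)=\infty$ if $(A_{ij})$ is of type $D_4^{(1)}$ (the affine diagram with one central node joined to four other nodes). *)

(* Defs.v *)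
From HB Require Import structures.
From mathcomp Require Import all_boot all_order all_algebra all_fingroup.
From mathcomp Require Import zify ring.
From mathcomp Require Import classical_sets reals.
From mathcomp Require Import complex.

Set Implicit Arguments.
Unset Strict Implicit.
Unset Printing Implicit Defensive.

Import Order.TTheory GRing.Theory Num.Theory.
Local Open Scope ring_scope.

Section Words.
Variable n : nat.

(* lift ord0 i has value i.+1, so this exchanges i and i + 1. *)
Definition elem_transp (i : 'I_n) : 'S_n.+1 :=
  tperm (widen_ord (leqnSn n) i) (lift ord0 i).

(* The product of 'S_n.+1 composes from left to right.  Read with the opposite
   convention, the same word represents the inverse permutation, which leaves
   the sum over all permutations in quantum_symmetrizer unchanged. *)
Definition word_perm (w : seq 'I_n) : 'S_n.+1 :=
  (\prod_(i <- w) elem_transp i)%g.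

Definition shortest_expression (x : 'S_n.+1) (w : seq 'I_n) : Prop :=
  word_perm w = x /\ forall w', word_perm w' = x -> (size w <= size w')%N.

(* Some shortest expression of x: the default [::] is never used, see
   shortest_wordP. *)
Definition shortest_word (x : 'S_n.+1) : seq 'I_n :=
  xget [::] [set w | shortest_expression x w]%classic.

Lemma word_perm_cat w1 w2 :
  word_perm (w1 ++ w2) = (word_perm w1 * word_perm w2)%g.
Proof. exact: big_cat. Qed.

Lemma word_perm_tperm_add (d : nat) (a b : 'I_n.+1) :
  nat_of_ord b = (a + d)%N -> exists w, word_perm w = tperm a b.
Proof.
elim: d b => [|d IHd] b Db.
  exists [::]; have -> : b = a by apply: ord_inj; rewrite Db addn0.
  by rewrite tperm1 /word_perm big_nil.
have ltd : (a + d < n)%N by rewrite -ltnS -addnS -Db ltn_ord.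
pose i := Ordinal ltd; pose i' := widen_ord (leqnSn n) i.
have [w Dw] := IHd i' erefl.
have Eb : lift ord0 i = b by apply: ord_inj; rewrite lift0 Db addnS.
have Ew : word_perm [:: i] = tperm i' b by rewrite /word_perm big_seq1 -Eb.
have ab : a != b by rewrite -(inj_eq (@ord_inj _)) Db; lia.
case: (eqVneq a i') => [->|ai']; first by exists [:: i].
exists ([:: i] ++ (w ++ [:: i])); rewrite !word_perm_cat Dw Ew.
rewrite -{1}(tpermV i' b) -conjgE tpermJ tpermL.
by rewrite tpermD // eq_sym.
Qed.

Lemma word_perm_surj (x : 'S_n.+1) : exists w, word_perm w = x.
Proof.
have tp (a b : 'I_n.+1) : exists w, word_perm w = tperm a b.
  case: (leqP a b) => [le_ab|/ltnW le_ba].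
    by apply: (@word_perm_tperm_add (b - a)); rewrite subnKC.
  rewrite tpermC; apply: (@word_perm_tperm_add (a - b)); by rewrite subnKC.
have [ts -> _] := prod_tpermP x.
elim: ts => [|t ts [w Dw]]; first by exists [::]; rewrite /word_perm !big_nil.
have [w1 Dw1] := tp t.1 t.2.
by exists (w1 ++ w); rewrite big_cons word_perm_cat Dw Dw1.
Qed.

Lemma shortest_wordP (x : 'S_n.+1) : shortest_expression x (shortest_word x).
Proof.
suff [w Hw] : exists w, shortest_expression x w by exact: (xgetI [::] Hw).
have [w0 Dw0] := word_perm_surj x.
have ex : exists k, [exists t : k.-tuple 'I_n, word_perm t == x].
  by exists (size w0); apply/existsP; exists (in_tuple w0); apply/eqP.
case: (ex_minnP ex) => k /existsP[t /eqP Dt] min_k.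
exists t; split=> // w' Dw'; rewrite size_tuple; apply: min_k.
by apply/existsP; exists (in_tuple w'); apply/eqP.
Qed.

End Words.

Section Tensors.
Variables (K : fieldType) (I : finType).

(* For V with basis I: V (x) V has basis I * I, and V^{(x) n} has basis
   {ffun 'I_n -> I}; vectors are coordinate functions on these bases. *)
Definition basis_vec (B : finType) (b : B) : {ffun B -> K^o} :=
  [ffun s => (s == b)%:R].

(* s with the entries at positions i and i + 1 replaced by p. *)
Definition set_pair n (i : 'I_n) (s : {ffun 'I_n.+1 -> I}) (p : I * I) :
    {ffun 'I_n.+1 -> I} :=
  [ffun k => if k == widen_ord (leqnSn n) i then p.1
             else if k == lift ord0 i then p.2 else s k].

(* id (x) c (x) id: freeze the coordinates other than i and i + 1 and apply c
   to the resulting element of V (x) V. *)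
Definition act_at (c : 'End({ffun I * I -> K^o})) n (i : 'I_n)
    (f : {ffun {ffun 'I_n.+1 -> I} -> K^o}) :
    {ffun {ffun 'I_n.+1 -> I} -> K^o} :=
  [ffun s => c [ffun p => f (set_pair i s p)]
               (s (widen_ord (leqnSn n) i), s (lift ord0 i))].

Lemma act_at_linear c n (i : 'I_n) : linear (act_at c i).
Proof.
move=> a u v; apply/ffunP=> s; rewrite !ffunE.
set U := [ffun p => u _]; set W := [ffun p => v _].
have -> : [ffun p => (a *: u + v) (set_pair i s p)] = a *: U + W.
  by apply/ffunP=> p; rewrite !ffunE.
by rewrite linearP !ffunE.
Qed.

HB.instance Definition _ c n (i : 'I_n) :=
  GRing.isLinear.Build K _ _ _ (act_at c i) (act_at_linear c i).

Definition braid_gen (c : 'End({ffun I * I -> K^o})) n (i : 'I_n) :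
    'End({ffun {ffun 'I_n.+1 -> I} -> K^o}) :=
  linfun (act_at c i).

Lemma braid_genE c n (i : 'I_n) : braid_gen c i =1 act_at c i.
Proof. exact: lfunE. Qed.

(* (c (x) id)(id (x) c)(c (x) id) = (id (x) c)(c (x) id)(id (x) c) *)
Definition braid_equation (c : 'End({ffun I * I -> K^o})) : Prop :=
  let c12 := braid_gen c (0 : 'I_2) in
  let c23 := braid_gen c (1 : 'I_2) in
  (c12 \o c23 \o c12 = c23 \o c12 \o c23)%VF.

End Tensors.

(* A finite-dimensional braided vector space, with a chosen basis. *)
Record braidedSpace (K : fieldType) := BraidedSpace {
  bbasis : finType;
  braiding : 'End({ffun bbasis * bbasis -> K^o});
  braiding_inj : lker braiding = 0%VS;
  braiding_eq : braid_equation braiding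
}.

Section Nichols.
Variables (K : fieldType) (V : braidedSpace K).

Definition braid_word n (w : seq 'I_n) :
    'End({ffun {ffun 'I_n.+1 -> bbasis V} -> K^o}) :=
  foldr (fun i g => (braid_gen (braiding V) i \o g)%VF) \1%VF w.

(* Q_{n+1} *)
Definition quantum_symmetrizer n :
    'End({ffun {ffun 'I_n.+1 -> bbasis V} -> K^o}) :=
  \sum_(x : 'S_n.+1) braid_word (shortest_word x).

(* The dimension of the homogeneous component of degree n: K, V and, for
   n >= 2, V^{(x) n} / ker Q_n. *)
Definition nichols_degree_dim (n : nat) : nat :=
  match n with
  | 0 => 1
  | 1 => #|bbasis V|
  | m.+1 => \dim {: {ffun {ffun 'I_m.+1 -> bbasis V} -> K^o}}
            - \dim (lker (quantum_symmetrizer m))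
  end%N.

(* dim B(V) = d: a direct sum of finite-dimensional spaces has finite dimension
   iff almost all of them are zero. *)
Definition nichols_dim (d : nat) : Prop :=
  exists N, (forall n, (N <= n)%N -> nichols_degree_dim n = 0%N) /\
            d = (\sum_(n < N) nichols_degree_dim n)%N.

Definition nichols_finite : Prop := exists d, nichols_dim d.

Definition nichols_infinite : Prop := ~ nichols_finite.

End Nichols.

Record rack := Rack {
  rack_sort :> finType;
  rack_op : rack_sort -> rack_sort -> rack_sort;
  rack_bij : forall x, bijective (rack_op x);
  rack_dist : forall x y z,
    rack_op x (rack_op y z) = rack_op (rack_op x y) (rack_op x z)
}.

Record cocycle (K : fieldType) (Y : rack) := Cocycle {
  cocycle_fun :> Y -> Y -> K;
  cocycle_neq0 : forall x y, cocycle_fun x y != 0;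
  cocycleP : forall x y z,
    cocycle_fun x (rack_op y z) * cocycle_fun y z =
    cocycle_fun (rack_op x y) (rack_op x z) * cocycle_fun x z
}.

Section RackBraiding.
Variables (K : fieldType) (Y : rack) (q : cocycle K Y).

(* The linear extension of x (x) y |-> q_{x,y} (x |> y) (x) x. *)
Definition rack_braiding_fun (f : {ffun Y * Y -> K^o}) : {ffun Y * Y -> K^o} :=
  \sum_p (f p * q p.1 p.2) *: basis_vec K (rack_op p.1 p.2, p.1).

Lemma rack_braiding_linear : linear rack_braiding_fun.
Proof.
move=> a u v; rewrite /rack_braiding_fun scaler_sumr -big_split /=.
apply: eq_bigr => p _; rewrite !ffunE mulrDl scalerDl scalerA.
by rewrite /GRing.scale /= mulrA.
Qed.

HB.instance Definition _ :=
  GRing.isLinear.Build K _ _ _ rack_braiding_fun rack_braiding_linear.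

Definition rack_braiding : 'End({ffun Y * Y -> K^o}) :=
  linfun rack_braiding_fun.

Lemma rack_braiding_coord (f : {ffun Y * Y -> K^o}) (x y : Y) :
  rack_braiding f (rack_op x y, x) = f (x, y) * q x y.
Proof.
rewrite lfunE /= /rack_braiding_fun sum_ffunE (bigD1 (x, y)) //= !ffunE eqxx.
rewrite big1 ?addr0 => [|[u v] neq]; first by rewrite /GRing.scale /= mulr1.
rewrite !ffunE /= xpair_eqE; case: eqP => [E|_]; last by rewrite scaler0.
case: eqP => [E'|_]; last by rewrite scaler0.
subst u; case/eqP: neq; congr (_, _).
exact: esym (bij_inj (rack_bij x) E).
Qed.

Lemma rack_braiding_inj : lker rack_braiding = 0%VS.
Proof.
apply/eqP; rewrite -subv0; apply/subvP=> f; rewrite memv_ker => /eqP f0.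
rewrite memv0; apply/eqP/ffunP=> -[x y]; rewrite ffunE.
have /eqP := rack_braiding_coord f x y.
by rewrite f0 ffunE eq_sym mulf_eq0 (negPf (cocycle_neq0 q x y)) orbF => /eqP.
Qed.

Lemma rack_braid_gen n (i : 'I_n) (f : {ffun {ffun 'I_n.+1 -> Y} -> K^o})
    (s : {ffun 'I_n.+1 -> Y}) (x y : Y) :
  s (widen_ord (leqnSn n) i) = rack_op x y -> s (lift ord0 i) = x ->
  braid_gen rack_braiding i f s = f (set_pair i s (x, y)) * q x y.
Proof.
by move=> s1 s2; rewrite braid_genE !ffunE s1 s2 rack_braiding_coord ffunE.
Qed.

Lemma rack_op_surj (x z : Y) : exists y, z = rack_op x y.
Proof. by have [g _ gK] := rack_bij x; exists (g z); rewrite gK. Qed.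

Lemma ord3_cases (P : 'I_3 -> Prop) : P 0 -> P 1 -> P ord_max -> forall k, P k.
Proof.
move=> P0 P1 P2 [[|[|[|//]]] lt].
- by rewrite (_ : Ordinal lt = 0) //; apply: ord_inj.
- by rewrite (_ : Ordinal lt = 1) //; apply: ord_inj.
- by rewrite (_ : Ordinal lt = ord_max) //; apply: ord_inj.
Qed.

Lemma rack_braiding_eq : braid_equation rack_braiding.
Proof.
rewrite /braid_equation; apply/lfunP=> f; apply/ffunP=> s.
rewrite !comp_lfunE.
set x := s ord_max.
have [y Dy] := rack_op_surj x (s 1).
have [z0 Dz0] := rack_op_surj (s 1) (s 0).
have [z Dz] := rack_op_surj x z0.
have Es0 : s 0 = rack_op x (rack_op y z) by rewrite Dz0 Dz Dy -rack_dist.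
have w0 : widen_ord (leqnSn 2) (0 : 'I_2) = 0 by apply: ord_inj.
have w1 : widen_ord (leqnSn 2) (1 : 'I_2) = 1 by apply: ord_inj.
have l0 : lift ord0 (0 : 'I_2) = 1 by apply: ord_inj.
have l1 : lift ord0 (1 : 'I_2) = ord_max by apply: ord_inj.
pose a1 := set_pair (0 : 'I_2) s (s 1, z0).
pose a2 := set_pair (1 : 'I_2) a1 (x, z).
pose a3 := set_pair (0 : 'I_2) a2 (x, y).
pose b1 := set_pair (1 : 'I_2) s (x, y).
pose b2 := set_pair (0 : 'I_2) b1 (x, rack_op y z).
pose b3 := set_pair (1 : 'I_2) b2 (y, z).
have [a11 a12] : a1 1 = z0 /\ a1 ord_max = x by rewrite !ffunE w0 l0.
have [a20 a21 a22] : [/\ a2 0 = s 1, a2 1 = x & a2 ord_max = z].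
  by rewrite !ffunE w0 w1 l0 l1.
have [b10 b11 b12] : [/\ b1 0 = s 0, b1 1 = x & b1 ord_max = y].
  by rewrite !ffunE w1 l1.
have [b20 b21 b22] : [/\ b2 0 = x, b2 1 = rack_op y z & b2 ord_max = y].
  by rewrite !ffunE w0 w1 l0 l1.
have E3 : a3 = b3.
  by apply/ffunP; apply: ord3_cases; rewrite !ffunE w0 w1 l0 l1.
rewrite (@rack_braid_gen _ 0 _ s (s 1) z0) ?w0 ?l0 // -/a1.
rewrite (@rack_braid_gen _ 1 _ a1 x z) ?w1 ?l1 ?a11 // -/a2.
rewrite (@rack_braid_gen _ 0 _ a2 x y) ?w0 ?l0 ?a20 // -/a3.
rewrite (@rack_braid_gen _ 1 _ s x y) ?w1 ?l1 // -/b1.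
rewrite (@rack_braid_gen _ 0 _ b1 x (rack_op y z)) ?w0 ?l0 ?b10 // -/b2.
rewrite (@rack_braid_gen _ 1 _ b2 y z) ?w1 ?l1 // -/b3.
rewrite E3 Dy Dz -!mulrA; congr (_ * _).
by rewrite [RHS]mulrA [q y z * _]mulrC cocycleP; ring.
Qed.

Definition rack_space : braidedSpace K :=
  BraidedSpace rack_braiding_inj rack_braiding_eq.

End RackBraiding.

(* A trivial rack, x |> y = y; c^q is then x_i (x) x_j |-> q_ij x_j (x) x_i, and
   the cocycle condition is the commutativity of K. *)
Section TrivialRack.
Variables (K : fieldType) (X : finType).

Lemma id_bij (x : X) : bijective (fun y : X => y).
Proof. by exists id. Qed.

Definition trivial_rack : rack :=
  @Rack X (fun _ y => y) id_bij (fun _ _ _ => erefl).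

Definition trivial_cocycle (q : X -> X -> K) (hq : forall i j, q i j != 0) :
    cocycle K trivial_rack :=
  @Cocycle K trivial_rack q hq (fun x y z => mulrC (q x z) (q y z)).

Definition diagonal_space (q : X -> X -> K) (hq : forall i j, q i j != 0) :
    braidedSpace K :=
  rack_space (trivial_cocycle hq).

End TrivialRack.

Section ExtensionRack.
Variables (X : finType) (A : finGroupType) (sigma : X -> A).
Hypothesis abA : abelian [set: A].

Definition kappa (i j : X) : A := (sigma i * (sigma j)^-1)%g.

Definition ext_op (x y : X * A) : X * A := (y.1, (y.2 * kappa x.1 y.1)%g).

Lemma ab_mulgC (a b : A) : (a * b = b * a)%g.
Proof. by apply: (centsP abA); rewrite inE. Qed.

Lemma ext_op_bij x : bijective (ext_op x).
Proof.
exists (fun y => (y.1, (y.2 * (kappa x.1 y.1)^-1)%g)) => -[j b] /=.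
  by rewrite /ext_op /= mulgK.
by rewrite /ext_op /= mulgKV.
Qed.

Lemma ext_op_dist x y z :
  ext_op x (ext_op y z) = ext_op (ext_op x y) (ext_op x z).
Proof.
congr pair; rewrite /= -2!(mulgA z.2); congr (_ * _)%g; exact: ab_mulgC.
Qed.

Definition ext_rack : rack := Rack ext_op_bij ext_op_dist.

Variables (K : fieldType) (q : X -> X -> K).

(* Characters of the finite group A, with values in K^x. *)
Definition is_character (omega : A -> K) : Prop :=
  omega 1%g = 1 /\ {morph omega : a b / (a * b)%g >-> a * b}.

Definition ext_cocycle_fun (omega : A -> K) (x y : X * A) : K :=
  omega y.2 * (omega x.2)^-1 * q x.1 y.1.

Variable omega : A -> K.
Hypotheses (hq : forall i j, q i j != 0) (homega : is_character omega).

Lemma character_neq0 a : omega a != 0.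
Proof.
have [w1 wM] := homega; apply/eqP=> wa0; have := wM a a^-1%g.
by rewrite mulgV w1 wa0 mul0r => /eqP; rewrite oner_eq0.
Qed.

Lemma characterV a : omega a^-1%g = (omega a)^-1.
Proof.
have [w1 wM] := homega; apply: (mulfI (character_neq0 a)).
by rewrite -wM mulgV w1 mulfV ?character_neq0.
Qed.

Lemma ext_cocycle_neq0 x y : ext_cocycle_fun omega x y != 0.
Proof. by rewrite !mulf_neq0 ?invr_eq0 ?character_neq0 ?hq. Qed.

Lemma ext_cocycleP x y z :
  ext_cocycle_fun omega x (ext_op y z) * ext_cocycle_fun omega y z =
  ext_cocycle_fun omega (ext_op x y) (ext_op x z) * ext_cocycle_fun omega x z.
Proof.
have [_ wM] := homega.
rewrite /ext_cocycle_fun /= /kappa !wM !characterV.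
by field; rewrite !character_neq0.
Qed.

Definition ext_cocycle : cocycle K ext_rack :=
  @Cocycle K ext_rack (ext_cocycle_fun omega) ext_cocycle_neq0 ext_cocycleP.

(* (K Y, c^q) for Y = X * A. *)
Definition ext_space : braidedSpace K := rack_space ext_cocycle.

End ExtensionRack.

(* ord z > k, for the multiplicative order of z in {1, 2, ..., oo}. *)
Definition ord_gt (K : fieldType) (z : K) (k : nat) : Prop :=
  (exists2 m, (k < m)%N & m.-primitive_root z) \/
  (forall m, (0 < m)%N -> z ^+ m != 1).

(* q_ij q_ji = (-1)^{A_ij} with A_ij in {0, -1}, for i <> j. *)
Definition sign_exponents (K : fieldType) (X : finType) (q : X -> X -> K)
    (M : X -> X -> int) : Prop :=
  forall i j, i != j ->
    (M i j = 0 \/ M i j = -1) /\ q i j * q j i = (-1) ^ M i j.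

(* The Cartan matrix of the simply laced star whose central node 0 is joined to
   k other nodes: D_4 for k = 3 and D_4^(1) for k = 4. *)
Definition star_cartan (k : nat) : 'M[int]_k.+1 :=
  \matrix_(i, j) if i == j then 2
                 else if (i == 0) || (j == 0) then -1 else 0.

(* M has the given type, up to the numbering of the nodes. *)
Definition cartan_type (X : finType) (M : X -> X -> int) (n : nat)
    (B : 'M[int]_n) : Prop :=
  exists2 s : X -> 'I_n, bijective s & forall i j, M i j = B (s i) (s j).

Definition conjectureD (K : fieldType) : Prop :=
  forall (theta : nat) (q : 'I_theta -> 'I_theta -> K)
    (hq : forall i j, q i j != 0) (M : 'I_theta -> 'I_theta -> int),
    (forall i, q i i = -1) -> (forall i j, q i j = 1 \/ q i j = -1) ->
    sign_exponents q M -> (forall i, M i i = 2) ->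
    (cartan_type M (star_cartan 3) ->
       nichols_dim (diagonal_space hq) (2 ^ 12)) /\
    (cartan_type M (star_cartan 4) -> nichols_infinite (diagonal_space hq)).

Definition isC2 (A : finGroupType) : Prop := [set: A] \isog [set: 'Z_2].

(* An isomorphism of A with the multiplicative group {1, -1}. *)
Definition sign_isom (A : finGroupType) (e : A -> int) : Prop :=
  [/\ {morph e : a b / (a * b)%g >-> a * b}, injective e
    & forall z, (exists a, e a = z) <-> z = 1 \/ z = -1].

(* Main.v *)
Require Import Defs.
From mathcomp Require Import all_boot all_order all_algebra all_fingroup.
From mathcomp Require Import reals complex.
From HB Require Import structures.
From mathcomp Require Import cyclic boolp functions.
From mathcomp Require Import zify ring.
Import Order.TTheory GRing.Theory Num.Theory.
Local Open Scope ring_scope.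

Set Implicit Arguments.
Unset Strict Implicit.
Unset Printing Implicit Defensive.

(** Idea of the proof.

    The braiding of V is not diagonal, but a character twist together with
    Fourier transform along those translations of A by which the chosen points
    act makes it diagonal (fourier_braid, with the transfer lemmas
    fourier_infinite and fourier_degree_dim).  Its letters are then pairs of a
    point i of X and an eigenvector; for A of order 2 they are the (i, +) and
    (i, -), and all pairs with the same i braid by q_ii.

    For a diagonal braiding q_ij the coefficients of the quantum symmetrizer are
    sums over permutations of products over inversions, and the same numbers are
    the values of products of letters in the quantum shuffle algebra of functions
    on words (quantum_symmetrizerE).  Hence the Nichols algebra is the subalgebra
    generated by the letters, in which the removal of the first letter is a skew
    derivation.  All questions of finiteness become the question in which degrees
    some product of letters has a nonzero value.

    Infinite dimension always comes from an element f all of whose powers are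
    nonzero: if the removal of a word of f acts on the powers of f like a
    q-derivative with q = 1, then f ^+ m evaluates to a nonzero multiple of m!
    (skew_power_nonzero; a q that is not a root of unity will do as well).  Say
    that two points of X are on the same side if sigma takes the same value on
    them, and that two letters are linked if the product of their two mutual
    braidings is not 1.  Such an f exists
    - on a cycle of letters with trivial total self-braiding, as an iterated
      bracket (cycle_nonzero): this covers three letters with q of order 3, the
      squares that occur when A has more than two elements or when two points on
      the same side are linked, and the squares or octagons over two points on
      each side (square_infinite, octagon_infinite);
    - on two letters with constant braiding q of order N > 3, in degree N or N / 2
      (constant_nonzero).
    A center with at least four leaves contains the affine star of Conjecture D.

    If A has order 2 and there is one point on one side and at most three on the
    other, then the letters decompose into two copies of a star with at most three
    leaves, between which the braiding is trivial, so that long words evaluate to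
    zero by Conjecture D (star_finite).

    If A has order 2 and q_ii has order 3, then (i, +) and (i, -) generate a
    Nichols algebra of type A2, of dimension 27.  The three root vectors and
    matching skew derivations satisfy D X = 1 + x X D and D ^ 3 = 0, which
    reduces the dimension to that of the kernel of D by a factor of 3 each
    (weyl_dim, dvd27). *)

(** * The quantum shuffle algebra *)

(** Functions on words, to be read as formal sums of words.  The braiding
    matrix is part of the type so that the quantum shuffle product below can be
    its multiplication. *)
Definition qshuffle (K : fieldType) (J : eqType) (q : J -> J -> K) :=
  seq J -> K^o.

HB.instance Definition _ (K : fieldType) (J : eqType) (q : J -> J -> K) :=
  GRing.Lmodule.copy (qshuffle q) (seq J -> K^o).

Section QuantumShuffle.
Variables (K : fieldType) (J : eqType) (q : J -> J -> K).
Local Notation F := (qshuffle q).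
Implicit Types (f g h : F) (u v w : seq J) (i j : J).

(** The skew derivation that removes the first letter. *)
Definition qder j f : F := fun u => f (j :: u).

(** The braiding of the letter j with a word: the factor that appears when j
    moves to the left across the whole word. *)
Definition qtwist j f : F := fun u => (\prod_(k <- u) q k j) * f u.

(** The first letter of a shuffle of two words comes from one of them; if it is
    from the second, then it has crossed all of the first. *)
Fixpoint qsh f g u : K :=
  if u is j :: u' then qsh (qder j f) g u' + qsh (qtwist j f) (qder j g) u'
  else f [::] * g [::].

Definition qone : F := fun u => (u == [::])%:R.

Lemma qaddE f g u : (f + g) u = (f u : K) + (g u : K) :> K. Proof. by []. Qed.
Lemma qoppE f u : (- f) u = - (f u : K) :> K. Proof. by []. Qed.
Lemma qzeroE u : (0 : F) u = 0 :> K. Proof. by []. Qed.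
Lemma qscaleE a f u : (a *: f) u = a * (f u : K) :> K. Proof. by []. Qed.
Definition qfunE := (qaddE, qoppE, qzeroE, qscaleE).

Lemma qder_is_linear j : linear (qder j). Proof. by []. Qed.
HB.instance Definition _ j :=
  GRing.isLinear.Build K F F _ (qder j) (qder_is_linear j).

Lemma qtwist_is_linear j : linear (qtwist j).
Proof.
by move=> a f g; apply/funext => u; rewrite /qtwist !qfunE; ring.
Qed.
HB.instance Definition _ j :=
  GRing.isLinear.Build K F F _ (qtwist j) (qtwist_is_linear j).

Lemma qder_twist i j f : qder i (qtwist j f) = q i j *: qtwist j (qder i f).
Proof.
by apply/funext => u; rewrite /qder /qtwist qfunE big_cons mulrA.
Qed.

Lemma qtwistC i j f : qtwist i (qtwist j f) = qtwist j (qtwist i f).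
Proof. by apply/funext => u; rewrite /qtwist mulrCA. Qed.

Lemma qsh_linearl g : linear (fun f => (qsh f g : F)).
Proof.
move=> a f1 f2; apply/funext => u; rewrite !qfunE.
elim: u f1 f2 g => [|j u IHu] f1 f2 g /=.
  by rewrite !qfunE; ring.
by rewrite !linearP !IHu; ring.
Qed.

Lemma qsh_linearr f : linear (fun g => (qsh f g : F)).
Proof.
move=> a g1 g2; apply/funext => u; rewrite !qfunE.
elim: u f g1 g2 => [|j u IHu] f g1 g2 /=.
  by rewrite !qfunE; ring.
by rewrite !linearP !IHu; ring.
Qed.

Lemma qshDl f1 f2 g : qsh (f1 + f2) g = (qsh f1 g : F) + qsh f2 g.
Proof. by have := qsh_linearl g 1 f1 f2; rewrite !scale1r. Qed.

Lemma qshDr f g1 g2 : qsh f (g1 + g2) = (qsh f g1 : F) + qsh f g2.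
Proof. by have := qsh_linearr f 1 g1 g2; rewrite !scale1r. Qed.

Lemma qsh0l g : qsh 0 g = (0 : F).
Proof.
have /= := qsh_linearl g (-1) 0 0.
by rewrite scaler0 addr0 scaleN1r addNr.
Qed.

Lemma qsh0r f : qsh f 0 = (0 : F).
Proof.
have /= := qsh_linearr f (-1) 0 0.
by rewrite scaler0 addr0 scaleN1r addNr.
Qed.

Lemma qshZl a f g : qsh (a *: f) g = a *: (qsh f g : F).
Proof. by have := qsh_linearl g a f 0; rewrite !addr0 qsh0l addr0. Qed.

Lemma qshZr a f g : qsh f (a *: g) = a *: (qsh f g : F).
Proof. by have := qsh_linearr f a g 0; rewrite !addr0 qsh0r addr0. Qed.

Lemma qder_sh j f g :
  qder j (qsh f g) = (qsh (qder j f) g : F) + qsh (qtwist j f) (qder j g).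
Proof. by []. Qed.

Lemma qtwist_sh j f g : qtwist j (qsh f g) = qsh (qtwist j f) (qtwist j g).
Proof.
apply/funext => u; elim: u f g => [|i u IHu] f g.
  by rewrite /qtwist /= !big_nil !mul1r.
rewrite /= !qder_twist qshZl qshZr !qfunE -!IHu qtwistC -IHu.
rewrite {1 2 3}/qtwist big_cons -[qsh f g _]/(qsh _ g u + qsh _ (qder i g) u).
by ring.
Qed.

Lemma qshA f g h : qsh f (qsh g h) = qsh (qsh f g) h.
Proof.
apply/funext => u; elim: u f g h => [|j u IHu] f g h /=; first by rewrite mulrA.
by rewrite !qder_sh qshDl qshDr !qfunE !IHu -addrA qtwist_sh.
Qed.

Lemma qder_one j : qder j qone = 0. Proof. by []. Qed.

Lemma qtwist_one j : qtwist j qone = qone.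
Proof.
apply/funext => -[|k u]; rewrite /qtwist /qone ?big_nil ?mul1r //=.
by rewrite mulr0.
Qed.

Lemma qsh1l g : qsh qone g = g.
Proof.
apply/funext => u; elim: u g => [|j u IHu] g /=; first by rewrite mul1r.
by rewrite qder_one qsh0l qtwist_one IHu qfunE add0r.
Qed.

Lemma qsh1r f : qsh f qone = f.
Proof.
apply/funext => u; elim: u f => [|j u IHu] f /=; first by rewrite mulr1.
by rewrite qder_one qsh0r IHu qfunE addr0.
Qed.

Lemma qone_neq0 : qone != 0.
Proof.
apply/eqP => e; have /eqP := congr1 (fun f : F => f [::]) e.
by rewrite /qone qzeroE oner_eq0.
Qed.

HB.instance Definition _ := GRing.Zmodule_isNzRing.Build F
  qshA qsh1l qsh1r (fun f1 f2 g => qshDl f1 f2 g) (fun f g1 g2 => qshDr f g1 g2)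
  qone_neq0.

HB.instance Definition _ := GRing.Lmodule_isLalgebra.Build K F
  (fun a f g => esym (qshZl a f g)).
HB.instance Definition _ := GRing.Lalgebra_isAlgebra.Build K F
  (fun a f g => esym (qshZr a f g)).

Lemma qderM j f g : qder j (f * g) = qder j f * g + qtwist j f * qder j g.
Proof. by []. Qed.

Lemma qtwistM j f g : qtwist j (f * g) = qtwist j f * qtwist j g.
Proof. exact: qtwist_sh. Qed.

Lemma qderD j f g : qder j (f + g) = qder j f + qder j g. Proof. by []. Qed.
Lemma qderB j f g : qder j (f - g) = qder j f - qder j g. Proof. by []. Qed.
Lemma qderZ j a f : qder j (a *: f) = a *: qder j f. Proof. by []. Qed.
Lemma qder0 j : qder j (0 : F) = 0. Proof. by []. Qed.
Lemma qtwistB j f g : qtwist j (f - g) = qtwist j f - qtwist j g.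
Proof. exact: (linearB (qtwist j)). Qed.
Lemma qtwistZ j a f : qtwist j (a *: f) = a *: qtwist j f.
Proof. exact: (linearZ_LR (qtwist j)). Qed.
Lemma qtwist0 j : qtwist j (0 : F) = 0. Proof. exact: (linear0 (qtwist j)). Qed.

Lemma qder1 j : qder j (1 : F) = 0. Proof. by []. Qed.
Lemma qtwist1 j : qtwist j (1 : F) = 1. Proof. exact: qtwist_one. Qed.

Lemma qmul_nil f g : (f * g) [::] = f [::] * g [::]. Proof. by []. Qed.
Lemma qone_nil : (1 : F) [::] = 1. Proof. by []. Qed.

Definition letter i : F := fun u => (u == [:: i])%:R.

Lemma qder_letter i j : qder j (letter i) = (i == j)%:R *: 1.
Proof.
apply/funext => u; rewrite qscaleE /qder /letter eqseq_cons [j == i]eq_sym.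
by rewrite -mulnb natrM.
Qed.

Lemma qtwist_letter i j : qtwist j (letter i) = q i j *: letter i.
Proof.
apply/funext => u; rewrite qscaleE /qtwist /letter.
by case: eqP => [->|_]; rewrite ?mulr0 // big_seq1.
Qed.

Lemma qder_letterM i j f :
  qder j (letter i * f) = (i == j)%:R *: f + q i j *: (letter i * qder j f).
Proof.
by rewrite qderM qder_letter qtwist_letter -!scalerAl mul1r.
Qed.

(** The element of the subalgebra generated by the letters that belongs to a
    word; see quantum_symmetrizerE for its values. *)
Definition monomial w : F := \prod_(i <- w) letter i.

Lemma monomial_nil : monomial [::] = 1. Proof. exact: big_nil. Qed.
Lemma monomial_cons i w : monomial (i :: w) = letter i * monomial w.
Proof. exact: big_cons. Qed.


Lemma letterM_nil i f : (letter i * f) [::] = 0.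
Proof. by rewrite qmul_nil mul0r. Qed.

Lemma letterM_cons i f j u :
  (letter i * f) (j :: u) = (i == j)%:R * f u + q i j * (letter i * qder j f) u.
Proof. by rewrite -[LHS]/(qder j _ u) qder_letterM. Qed.

(** Multiplying by a letter inserts it at every position, across the letters
    that come before. *)
Lemma letterM_sum i f u :
  (letter i * f) u =
  \sum_(p < size u) ((nth i u p == i)%:R * \prod_(k <- take p u) q i k)
                    * f (take p u ++ drop p.+1 u).
Proof.
elim: u f => [|j u IHu] f; first by rewrite letterM_nil big_ord0.
rewrite letterM_cons IHu big_ord_recl /= ?take0 ?drop0 big_nil mulr1.
rewrite eq_sym mulr_sumr; congr (_ + _); apply: eq_bigr => p _.
by rewrite big_cons add0n /bump leq0n add1n /qder; ring.
Qed.

Lemma monomial_perm w u : monomial w u != 0 -> perm_eq w u.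
Proof.
elim: w u => [|i w IHw] u.
  by rewrite monomial_nil; case: u => [|j u] //; rewrite eqxx.
rewrite monomial_cons letterM_sum; case: (boolP (perm_eq (i :: w) u)) => //.
move=> npu; rewrite big1 ?eqxx // => p _.
case: eqP => [up|_]; last by rewrite !mul0r.
case: (eqVneq (monomial w (take p u ++ drop p.+1 u)) 0) => [->|/IHw pw].
  by rewrite mulr0.
case/negP: npu; rewrite -[u](cat_take_drop p) perm_sym perm_catC.
by rewrite (drop_nth i) // up /= perm_cons perm_catC perm_sym.
Qed.

Lemma monomial_size w u : size w != size u -> monomial w u = 0.
Proof.
by apply: contraNeq => /monomial_perm /perm_size ->.
Qed.

End QuantumShuffle.

(** * Elements all of whose powers are nonzero *)

Section Powers.
Variables (K : numFieldType) (J : eqType) (q : J -> J -> K).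
Local Notation F := (qshuffle q).
Implicit Types (f g h : F) (u v w l : seq J) (i j c d : J).

(** The homogeneous components of the subalgebra generated by the letters. *)
Inductive generated : nat -> F -> Prop :=
| generated0 n : generated n 0
| generated1 : generated 0 1
| generatedL n a f g : generated n f -> generated n g -> generated n (a *: f + g)
| generated_letterM n i f : generated n f -> generated n.+1 (letter q i * f).

Lemma generatedZ n a f : generated n f -> generated n (a *: f).
Proof.
by move=> gf; rewrite -[_ *: _]addr0; apply: generatedL => //; apply: generated0.
Qed.

Lemma generated_letter i : generated 1 (letter q i).
Proof. by rewrite -[letter q i]mulr1; do 2!constructor. Qed.

Lemma generatedM m n f g :
  generated m f -> generated n g -> generated (m + n) (f * g).
Proof.
move=> gf gg; elim: gf => {m f} [m||m a f f' _ IHf _ IHf'|m i f _ IHf].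
- by rewrite mul0r; apply: generated0.
- by rewrite mul1r.
- by rewrite mulrDl -scalerAl; apply: generatedL.
- by rewrite -mulrA addSn; constructor.
Qed.

Lemma generatedX m n f : generated m f -> generated (m * n) (f ^+ n).
Proof.
move=> gf; elim: n => [|n IHn]; first by rewrite muln0; constructor.
by rewrite exprS mulnS; apply: generatedM.
Qed.

(** Induction over all linear forms phi makes this immediate: for a product of
    a letter with f it suffices to compose phi with that multiplication. *)
Lemma generated_form n f (phi : F -> K^o) : linear phi -> generated n f ->
  (forall w, size w = n -> phi (monomial q w) = 0) -> phi f = 0.
Proof.
move=> lphi gf; elim: gf phi lphi => {n f} [n||n a f g _ IHf _ IHg|n i f _ IHf].
- by move=> phi lphi _; rewrite -[0](addNr 0) -scaleN1r lphi scaleN1r addNr.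
- by move=> phi _ /(_ [::] erefl); rewrite monomial_nil.
- by move=> phi lphi z; rewrite lphi IHf // IHg // scaler0 addr0.
- move=> phi lphi z; apply: (IHf (fun g => phi (letter q i * g))) => [a g h|w sw].
    by rewrite mulrDr -scalerAr lphi.
  by rewrite -monomial_cons z //= sw.
Qed.

Lemma generated_value n f u : generated n f -> f u != 0 ->
  exists2 w, size w = n & monomial q w u != 0.
Proof.
move=> gf fu; apply: contrapT => no; case/eqP: fu.
apply: (@generated_form n f (fun g => g u)) => // w sw.
by apply/eqP/negPn/negP => nz; apply: no; exists w.
Qed.

(** The degrees n in which some coefficient of the quantum symmetrizer is
    nonzero. *)
Definition nonzero_degree n : Prop :=
  exists2 w, size w = n & exists u, monomial q w u != 0.

Definition qders l f : F := fun u => f (l ++ u).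

Lemma qders_cons d l f : qders (d :: l) f = qders l (qder d f).
Proof. by []. Qed.

Lemma qders_cat l l' f : qders (l ++ l') f = qders l' (qders l f).
Proof. by apply/funext => u; rewrite /qders catA. Qed.

Lemma qdersD l f g : qders l (f + g) = qders l f + qders l g. Proof. by []. Qed.
Lemma qdersB l f g : qders l (f - g) = qders l f - qders l g. Proof. by []. Qed.
Lemma qdersZ l a f : qders l (a *: f) = a *: qders l f. Proof. by []. Qed.

(** If removing l is a skew derivation on the powers of f and sends f to a
    scalar, then it acts on the powers of f like a q-derivative on the powers of
    a variable, hence removing l from f ^+ m as many times as possible gives a
    q-factorial. *)
Lemma skew_power_nonzero n f l (a x : K) :
  generated n f -> qders l f = a *: 1 -> a != 0 ->
  (forall m, qders l (f * f ^+ m) =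
     qders l f * f ^+ m + x *: (f * qders l (f ^+ m))) ->
  (forall m, \sum_(k < m.+1) x ^+ k != 0) ->
  forall m, nonzero_degree (n * m).
Proof.
move=> gf lf a0 skew sum0.
have der m : qders l (f ^+ m.+1) = (a * \sum_(k < m.+1) x ^+ k) *: f ^+ m.
  elim: m => [|m IHm]; first by rewrite big_ord1 expr0 mulr1 expr1 lf.
  rewrite exprS skew IHm lf -scalerAl mul1r -scalerAr -exprS scalerA -scalerDl.
  congr (_ *: _); rewrite [in RHS]big_ord_recl expr0 mulrDr mulr1; congr (_ + _).
  rewrite mulrCA; congr (_ * _); rewrite mulr_sumr.
  by apply: eq_bigr => k _; rewrite -exprS.
have val m : (f ^+ m) (flatten (nseq m l)) != 0.
  elim: m => [|m IHm]; first exact: oner_neq0.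
  rewrite -[_ (flatten _)]/(qders l (f ^+ m.+1) (flatten (nseq m l))) der.
  by rewrite qscaleE !mulf_neq0.
move=> m; have [w sw wP] := generated_value (generatedX m gf) (val m).
by exists w => //; exists (flatten (nseq m l)).
Qed.

Lemma sum_expr1_neq0 m : \sum_(k < m.+1) 1 ^+ k != 0 :> K.
Proof.
under eq_bigr do rewrite expr1n.
by rewrite sumr_const card_ord pnatr_eq0.
Qed.

(** f is homogeneous, as far as the braiding can see. *)
Definition homog (b : J -> K) f := forall j, qtwist j f = b j *: f.

Lemma homog_letter i : homog (q i) (letter q i).
Proof. exact: qtwist_letter. Qed.

Lemma homogM b b' f g :
  homog b f -> homog b' g -> homog (fun j => b j * b' j) (f * g).
Proof.
by move=> hf hg j; rewrite qtwistM hf hg -scalerAl -scalerAr scalerA.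
Qed.

Lemma homogB b f g : homog b f -> homog b g -> homog b (f - g).
Proof. by move=> hf hg j; rewrite qtwistB hf hg scalerBr. Qed.

Lemma homogZ b a f : homog b f -> homog b (a *: f).
Proof. by move=> hf j; rewrite qtwistZ hf !scalerA mulrC. Qed.

Lemma qders_Ml l f g :
  (forall d, d \in l -> qder d g = 0) -> qders l (f * g) = qders l f * g.
Proof.
elim: l f => [|d l IHl] f g0 //; rewrite !qders_cons qderM g0 ?mem_head //.
by rewrite mulr0 addr0 IHl // => e le; rewrite g0 // inE le orbT.
Qed.

Lemma qders_Mr l b f g : homog b f -> (forall d, d \in l -> qder d f = 0) ->
  qders l (f * g) = (\prod_(d <- l) b d) *: (f * qders l g).
Proof.
move=> hf; elim: l g => [|d l IHl] g f0; first by rewrite big_nil scale1r.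
rewrite !qders_cons qderM f0 ?mem_head // mul0r add0r hf -scalerAl qdersZ.
by rewrite IHl ?big_cons ?scalerA // => e le; rewrite f0 // inE le orbT.
Qed.

(** The version of the preceding lemma for an inhomogeneous first factor. *)
Lemma qders_Mr0 l f g : (forall d, d \in l -> qder d f = 0) ->
  qders l g = 0 -> qders l (f * g) = 0.
Proof.
elim: l f g => [|d l IHl] f g f0 g0; first by rewrite [g]g0 mulr0.
rewrite qders_cons qderM f0 ?mem_head // mul0r add0r IHl // => e le.
by rewrite qder_twist f0 ?inE ?le ?orbT // qtwist0 scaler0.
Qed.

Definition starts_with c f := forall d, d != c -> qder d f = 0.


Lemma starts_withX c f m d :
  starts_with c f -> d != c -> qder d (f ^+ m) = 0.
Proof.
move=> cf dc; elim: m => [|m IHm]; first exact: qder1.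
by rewrite exprS qderM cf // mul0r IHm mulr0 addr0.
Qed.

(** When a word of f starts with c, no second copy of f can contribute to a word
    that contains c only once. *)
Lemma starts_with_nonzero n f b c l :
  generated n f -> homog b f -> starts_with c f -> c \notin l ->
  qders (c :: l) f = f (c :: l) *: 1 -> f (c :: l) != 0 ->
  (forall m, \sum_(k < m.+1) (\prod_(e <- c :: l) b e) ^+ k != 0) ->
  forall m, nonzero_degree (n * m).
Proof.
move=> gf hf cf cl lf f0 sum0; apply: (skew_power_nonzero gf lf f0) => // m.
have lc e : e \in l -> e != c by apply: contraTneq => ->.
rewrite !qders_cons qderM hf qdersD -scalerAl qdersZ.
rewrite qders_Ml => [|e /lc]; last exact: starts_withX.
rewrite (qders_Mr _ hf) => [|e /lc]; last exact: cf.
by rewrite scalerA big_cons.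
Qed.

Lemma generated_size n f u : generated n f -> size u != n -> f u = 0.
Proof.
move=> gf su; apply/eqP; apply: contraNT su => fu.
have [w <- /monomial_perm /perm_size ->] := generated_value gf fu.
exact: eqxx.
Qed.

Lemma qders_top n f l : generated n f -> size l = n -> qders l f = f l *: 1.
Proof.
move=> gf sl; apply/funext => -[|i u]; rewrite /qders qscaleE.
  by rewrite cats0 mulr1.
rewrite (generated_size gf) ?size_cat ?sl ?mulr0 //.
by rewrite -[X in _ != X]addn0 eqn_add2l.
Qed.

(** ** Brackets of distinct letters *)

(** The coefficient of the braided commutator of f with c cancels those shuffles
    where c comes first. *)
Definition qbracket (b : J -> K) f c : F :=
  f * letter q c - b c *: (letter q c * f).

Lemma generated_qbracket n b f c : generated n f -> generated n.+1 (qbracket b f c).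
Proof.
move=> gf; rewrite /qbracket addrC -scaleNr; apply: generatedL.
  by constructor.
by rewrite -addn1; apply: generatedM => //; apply: generated_letter.
Qed.

Lemma homog_qbracket b f c : homog b f ->
  homog (fun j => b j * q c j) (qbracket b f c).
Proof.
move=> hf; apply: homogB; first exact: homogM (homog_letter c).
apply: homogZ => j; rewrite [RHS]/= mulrC.
exact: (homogM (homog_letter c) hf).
Qed.

Lemma starts_with_qbracket b f c c0 : homog b f -> starts_with c0 f ->
  starts_with c0 (qbracket b f c).
Proof.
move=> hf cf d dc; rewrite /qbracket qderB qderZ qderM qder_letterM.
rewrite qder_letter cf // hf mul0r add0r mulr0 scaler0 addr0 -scalerAl -scalerAr.
rewrite mulr1 !scalerA; case: (eqVneq c d) => [->|_]; first by rewrite subrr.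
by rewrite !mulr0 !scale0r subrr.
Qed.

Lemma letterM_once c u v f : c \notin u ++ v ->
  (letter q c * f) (u ++ c :: v) = (\prod_(d <- u) q c d) * f (u ++ v).
Proof.
elim: u f => [|d u IHu] f /=.
  move=> cv; rewrite letterM_cons eqxx mul1r big_nil mul1r.
  suff -> : (letter q c * qder c f) v = 0 by rewrite mulr0 addr0.
  elim: v cv (qder c f) => [|e v IHv] cv g; first by rewrite letterM_nil.
  move: cv; rewrite inE => /norP[ce cv]; rewrite letterM_cons (negPf ce) mul0r.
  by rewrite IHv // mulr0 addr0.
rewrite inE => /norP[cd cu]; rewrite letterM_cons (negPf cd) mul0r add0r.
by rewrite IHu // big_cons mulrA.
Qed.

Lemma Mletter_once c u v f : c \notin u ++ v ->
  (f * letter q c) (u ++ c :: v) = (\prod_(d <- v) q d c) * f (u ++ v).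
Proof.
elim: u f => [|d u IHu] f /=.
  move=> cv; rewrite -[LHS]/(qder c (f * letter q c) v) qderM qaddE.
  rewrite qder_letter eqxx scale1r mulr1.
  suff -> : (qder c f * letter q c) v = 0 by rewrite add0r.
  elim: v cv (qder c f) => [|e v IHv] cv g; first by rewrite qmul_nil mulr0.
  move: cv; rewrite inE => /norP[ce cv].
  rewrite -[LHS]/(qder e (g * letter q c) v) qderM qaddE qder_letter (negPf ce).
  by rewrite scale0r mulr0 IHv // add0r.
rewrite inE => /norP[cd cu].
rewrite -[LHS]/(qder d (f * letter q c) (u ++ c :: v)) qderM qaddE qder_letter.
by rewrite (negPf cd) scale0r mulr0 IHu // addr0.
Qed.

Lemma qbracket_once b f c u v : c \notin u ++ v ->
  b c = \prod_(d <- u ++ v) q d c ->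
  qbracket b f c (u ++ c :: v) =
  (\prod_(d <- v) q d c) * (1 - \prod_(d <- u) (q d c * q c d)) * f (u ++ v).
Proof.
move=> cuv bE; rewrite /qbracket qaddE qoppE qscaleE letterM_once // Mletter_once //.
by rewrite bE big_cat big_split /=; ring.
Qed.

Fixpoint linked (s t : seq J) : Prop :=
  if t is c :: t' then
    \prod_(d <- s) (q d c * q c d) <> 1 /\ linked (rcons s c) t'
  else True.

Lemma linked_bracket c0 s t f :
  generated (size s) f -> homog (fun j => \prod_(d <- s) q d j) f ->
  starts_with c0 f -> f s != 0 -> linked s t -> uniq (s ++ t) ->
  exists g, [/\ generated (size (s ++ t)) g,
    homog (fun j => \prod_(d <- s ++ t) q d j) g,
    starts_with c0 g & g (s ++ t) != 0].
Proof.
elim: t s f => [|c t IHt] s f gf hf cf f0 /=.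
  by rewrite cats0; exists f.
move=> [pc lt]; rewrite -cat_rcons => ut.
have cs : c \notin s.
  by move: ut; rewrite cat_uniq rcons_uniq => /and3P[/andP[]].
apply: (IHt _ (qbracket (fun j => \prod_(d <- s) q d j) f c)) => //.
- by rewrite size_rcons; apply: generated_qbracket.
- have := homog_qbracket c hf; congr (homog _ _).
  by apply/funext => j; rewrite big_rcons /= mulrC.
- exact: starts_with_qbracket.
rewrite -cats1 qbracket_once ?cats0 // big_nil mul1r mulf_neq0 //.
by rewrite subr_eq0 eq_sym; apply/eqP.
Qed.

(** Imaginary roots of affine type A: the iterated bracket of all letters of a
    cycle c0, s, y, z has degree delta with trivial self-braiding, and all its
    words start with c0.  Along the path c0, s, y each new letter is linked to
    the preceding ones; z is linked to c0, s even though the braiding of z with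
    all of c0, s, y may be trivial, so that z has to be placed before y. *)
Lemma cycle_nonzero c0 s y z :
  uniq (c0 :: s ++ [:: y; z]) -> (forall i j, q i j != 0) ->
  linked [:: c0] (rcons s y) ->
  \prod_(d <- c0 :: s) (q d z * q z d) <> 1 ->
  \prod_(e <- c0 :: s ++ [:: y; z]) \prod_(d <- c0 :: s ++ [:: y; z]) q d e = 1 ->
  forall m, nonzero_degree (size (c0 :: s ++ [:: y; z]) * m).
Proof.
move=> u0 q0 lsy zs pr1.
have e0 : homog (fun j => \prod_(d <- [:: c0]) q d j) (letter q c0).
  have := homog_letter c0; congr (homog _ _).
  by apply/funext => j; rewrite big_seq1.
have st : starts_with c0 (letter q c0).
  by move=> d dc; rewrite qder_letter eq_sym (negPf dc) scale0r.
have l0 : letter q c0 [:: c0] != 0 by rewrite /letter eqxx oner_neq0.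
have u1 : uniq ([:: c0] ++ rcons s y).
  by move: u0; rewrite -cat_rcons -cats1 -cat_cons cat_uniq => /and3P[].
have [f [gf hf cf f0]] :=
  @linked_bracket c0 [:: c0] (rcons s y) _ (generated_letter c0) e0 st l0 lsy u1.
set b := fun j => _ in hf; set g := qbracket b f z.
have zn : z \notin (c0 :: s) ++ [:: y].
  have e : c0 :: s ++ [:: y; z] = rcons ((c0 :: s) ++ [:: y]) z.
    by rewrite -cats1 -catA.
  by move: u0; rewrite e rcons_uniq => /andP[].
have g0 : g (c0 :: s ++ [:: z; y]) != 0.
  rewrite /g -[_ :: _]/((c0 :: s) ++ z :: [:: y]) qbracket_once //; last first.
    by rewrite /b cat1s -cats1.
  rewrite -cats1 in f0; rewrite !mulf_neq0 // ?big_seq1 // subr_eq0 eq_sym.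
  exact/eqP.
have pyz : perm_eq (c0 :: s ++ [:: z; y]) (c0 :: s ++ [:: y; z]).
  by rewrite perm_cons perm_cat2l (perm_catC [:: z] [:: y]).
have gg : generated (size (c0 :: s ++ [:: y; z])) g.
  have := generated_qbracket b z gf; congr (generated _ _).
  by rewrite /= size_rcons size_cat /= !addnS addn0.
have hg := homog_qbracket z hf.
apply: (starts_with_nonzero gg hg (starts_with_qbracket z hf cf) _ _ g0).
- by move: u0; rewrite -(perm_uniq pyz) /= => /andP[].
- by apply: (qders_top gg); apply: perm_size.
- move=> m; set x := \prod_(e <- _) _; suff -> : x = 1 by apply: sum_expr1_neq0.
  rewrite -pr1 /x (perm_big _ pyz) /=; apply: eq_bigr => e _.
  rewrite /b (_ : c0 :: s ++ [:: y; z] = rcons ([:: c0] ++ rcons s y) z).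
    by rewrite big_rcons /= mulrC.
  by rewrite /= -!cats1 -catA.
Qed.

End Powers.

(** * Two letters with constant braiding *)

Section ConstantBraiding.
Variables (K : numFieldType) (x : K).
Let q (i j : bool) : K := x.
Local Notation F := (qshuffle q).
Implicit Types f g : F.

Lemma qfun_ext f g : f [::] = g [::] ->
  qder false f = qder false g -> qder true f = qder true g -> f = g.
Proof.
move=> e0 ef et; apply/funext => -[//|[] u].
  by rewrite -[LHS]/(qder true f u) et.
by rewrite -[LHS]/(qder false f u) ef.
Qed.

Definition qnat n : K := \sum_(i < n) x ^+ i.

Lemma qnatS n : qnat n.+1 = 1 + x * qnat n.
Proof.
rewrite /qnat big_ord_recl mulr_sumr expr0; congr (_ + _).
by apply: eq_bigr => i _; rewrite exprS.
Qed.

Lemma qnatSr n : qnat n.+1 = qnat n + x ^+ n.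
Proof. exact: big_ord_recr. Qed.

Lemma qnatE n : (1 - x) * qnat n = 1 - x ^+ n.
Proof.
elim: n => [|n IHn]; first by rewrite /qnat big_ord0 mulr0 subrr.
by rewrite qnatSr mulrDr IHn exprS; ring.
Qed.

Lemma qnat_neq0 n : x ^+ n != 1 -> qnat n != 0.
Proof.
by apply: contraNneq => n0; rewrite eq_sym -subr_eq0 -qnatE n0 mulr0.
Qed.

(** A power of the letter false, divided by a q-factorial. *)
Definition ones n : F := fun u => (u == nseq n false)%:R.

(** The iterated bracket of the letter true with n letters false, divided by its
    leading coefficient. *)
Definition root n : F := fun u => (u == true :: nseq n false)%:R.

Lemma ones0 : ones 0 = 1. Proof. by []. Qed.

Lemma ones1 : ones 1 = letter q false. Proof. by []. Qed.


Lemma qder_onesS n : qder false (ones n.+1) = ones n.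
Proof. by apply/funext => u; rewrite /qder /ones /= eqseq_cons. Qed.

Lemma qder_ones n : qder true (ones n) = 0.
Proof. by apply/funext => u; rewrite /qder /ones; case: n. Qed.

Lemma qder_root n : qder true (root n) = ones n.
Proof. by apply/funext => u; rewrite /qder /ones /root eqseq_cons. Qed.

Lemma qder_rootF n : qder false (root n) = 0.
Proof. by []. Qed.

Lemma homog_ones n : homog (fun=> x ^+ n) (ones n).
Proof.
move=> j; apply/funext => u; rewrite qscaleE /qtwist /ones.
case: eqP => [->|_]; rewrite ?mulr0 //.
by rewrite big_const_seq count_predT size_nseq iter_mulr_1.
Qed.

Lemma homog_root n : homog (fun=> x ^+ n.+1) (root n).
Proof.
move=> j; apply/funext => u; rewrite qscaleE /qtwist /root.
case: eqP => [->|_]; rewrite ?mulr0 //.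
by rewrite big_const_seq count_predT iter_mulr_1 /= size_nseq.
Qed.

Lemma letterM_ones n : letter q false * ones n = qnat n.+1 *: ones n.+1.
Proof.
elim: n => [|n IHn]; apply: qfun_ext.
- by rewrite letterM_nil qscaleE mulr0.
- by rewrite qder_letterM qderZ qder_onesS mulr0 scaler0 addr0 /qnat big_ord1.
- by rewrite qder_letterM qderZ !qder_ones scale0r mulr0 !scaler0 addr0.
- by rewrite letterM_nil qscaleE mulr0.
- rewrite qder_letterM qderZ !qder_onesS IHn scalerA -scalerDl.
  by congr (_ *: _); rewrite [in RHS]qnatS.
- by rewrite qder_letterM qderZ !qder_ones scale0r mulr0 !scaler0 addr0.
Qed.

Lemma onesM_letter n : ones n * letter q false = qnat n.+1 *: ones n.+1.
Proof.
elim: n => [|n IHn]; apply: qfun_ext.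
- by rewrite qmul_nil qscaleE !mulr0.
- rewrite qderM qderZ qder_letter ones0 qder1 qtwist1 mul0r add0r.
  by rewrite mul1r /qnat big_ord1 expr0 !scale1r.
- rewrite qderM qderZ qder_letter !qder_ones scale0r mulr0 mul0r addr0.
  by rewrite scaler0.
- by rewrite qmul_nil qscaleE !mulr0.
- rewrite qderM qderZ qder_letter !qder_onesS IHn homog_ones scale1r mulr1.
  by rewrite -scalerDl; congr (_ *: _); rewrite [in RHS]qnatSr.
- rewrite qderM qderZ qder_letter !qder_ones scale0r mulr0 mul0r addr0.
  by rewrite scaler0.
Qed.

Lemma root_bracket n :
  root n * letter q false - x ^+ n.+1 *: (letter q false * root n) =
  (qnat n.+1 * (1 - x ^+ n.+2)) *: root n.+1.
Proof.
apply: qfun_ext.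
- by rewrite qaddE qoppE !qscaleE !qmul_nil !mulr0 subr0.
- rewrite qderB !qderZ qderM qder_letterM !qder_rootF qder_letter homog_root.
  by rewrite mul0r mulr0 !scaler0 addr0 add0r scale1r mulr1 scale1r subrr.
- rewrite qderB !qderZ qderM qder_letterM !qder_root qder_letter.
  rewrite !scale0r mulr0 addr0 add0r onesM_letter letterM_ones !scalerA -scalerBl.
  by congr (_ *: _); rewrite /q [x ^+ n.+2]exprSr; ring.
Qed.

Lemma generated_root n :
  (forall i, (0 < i <= n.+1)%N -> x ^+ i != 1) -> generated n.+1 (root n).
Proof.
elim: n => [_|n IHn x1]; first exact: generated_letter.
have c0 : qnat n.+1 * (1 - x ^+ n.+2) != 0.
  rewrite mulf_neq0 ?qnat_neq0 ?x1 ?ltnS ?leqnSn //.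
  by rewrite subr_eq0 eq_sym x1 /=.
have gn : generated n.+1 (root n) by apply: IHn => i ?; apply: x1; lia.
rewrite -[root _]scale1r -(mulVf c0) -scalerA -root_bracket.
exact/generatedZ/(generated_qbracket (fun=> x ^+ n.+1) false gn).
Qed.

(** If a < b, then a word with the letters of l = true false^a true false^b
    cannot be shared by two words of f: both would start with true and have at
    most a letters false before the next true, which leaves at most 2 a of the
    a + b letters false. *)
Lemma two_block_nonzero n f a b :
  let l := true :: nseq a false ++ true :: nseq b false in
  generated n f -> size l = n -> (a < b)%N -> homog (fun=> 1) f ->
  qder false f = 0 -> qders (true :: nseq a.+1 false) f = 0 -> f l != 0 ->
  forall m, nonzero_degree q (n * m).
Proof.
move=> l gf sl ab hf ff fa fl.
apply: (skew_power_nonzero gf (qders_top gf sl) fl (x := 1)) => m; last first.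
  exact: sum_expr1_neq0.
have inF k e : e \in nseq k false -> e = false.
  by rewrite mem_nseq => /andP[_ /eqP].
have hf1 j : qtwist j f = f by rewrite hf scale1r.
pose small (g : F) := qder false g = 0 /\ qders (nseq a.+1 false) (qder true g) = 0.
have smallM (g : F) : small g -> small (f * g).
  move=> [gf0 ga]; split; first by rewrite qderM ff gf0 mul0r mulr0 addr0.
  rewrite qderM hf1 qdersD qders_Ml => [|e /inF->]; last by [].
  rewrite [qders _ _]fa mul0r add0r (qders_Mr _ hf) => [|e /inF->]; last by [].
  by rewrite ga mulr0 scaler0.
have [] : small (f ^+ m).
  by elim: m => [|m IHm] //; rewrite exprS; apply: smallM.
move: (f ^+ m : F) => g gf0 ga {smallM}.
have short (h : F) : qders (nseq a.+1 false) h = 0 -> qders (nseq b false) h = 0.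
  move=> h0; rewrite -(subnKC ab) nseqD qders_cat h0.
  by apply/funext => u.
have killed (h : F) : qders (nseq a.+1 false) (qder true h) = 0 ->
    qder false (qders (nseq a false) (qder true h)) = 0.
  by rewrite -addn1 nseqD qders_cat.
have first_block : qders (true :: nseq a false) (f * g) =
    qders (true :: nseq a false) f * g + f * qders (true :: nseq a false) g.
  rewrite !qders_cons qderM hf1 qdersD qders_Ml => [|e /inF->]; last by [].
  by rewrite (qders_Mr _ hf) => [|e /inF->]; rewrite ?big1_eq ?scale1r.
rewrite scale1r /l -cat_cons !qders_cat first_block.
move: (killed f fa) (killed g ga); rewrite -!qders_cons.
set A := qders (true :: nseq a false) f; set A' := qders _ g => fA gA.
rewrite [LHS]qdersD ![qders (true :: _) _]qders_cons !qderM hf1 !qdersD.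
rewrite [X in X + _ + _]qders_Ml => [|e /inF->]; last by [].
rewrite [X in _ + X + _]qders_Mr0; first last.
- exact: short.
- by move=> e /inF->; rewrite qder_twist fA qtwist0 scaler0.
rewrite [X in _ + (X + _)]qders_Ml => [|e /inF->]; last exact: gA.
rewrite (short _ fa) mul0r addr0 add0r.
by rewrite (qders_Mr _ hf) => [|e /inF->]; rewrite ?big1_eq ?scale1r.
Qed.

Lemma qders_ones a n :
  qders (nseq a false) (ones n) = if (a <= n)%N then ones (n - a) else 0.
Proof.
elim: a n => [|a IHa] [|n]; rewrite ?subn0 // [nseq _ _]/= qders_cons.
by rewrite qder_onesS IHa ltnS subSS.
Qed.

Lemma qders_rootM a j k :
  qders (true :: nseq a false) (root j * root k) =
  qders (nseq a false) (ones j) * root k +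
  x ^+ (j.+1 * a.+1) *: (root j * qders (nseq a false) (ones k)).
Proof.
have inF e : e \in nseq a false -> e = false by rewrite mem_nseq => /andP[_ /eqP].
rewrite qders_cons qderM !qder_root homog_root -scalerAl qdersD qdersZ.
rewrite qders_Ml => [|e /inF->]; last by [].
rewrite (qders_Mr _ (homog_root j)) => [|e /inF->]; last by [].
rewrite scalerA big_const_seq count_predT size_nseq iter_mulr_1 -exprM -exprD.
by rewrite mulnS.
Qed.

Lemma onesM_root_value a n b : (ones a * root n) (true :: nseq b false) =
  x ^+ a * (ones a * ones n) (nseq b false).
Proof.
rewrite -[LHS]/(qder true _ _) qderM qder_ones mul0r add0r qder_root homog_ones.
by rewrite -scalerAl qscaleE.
Qed.

Lemma rootM_ones_value a n b : (root n * ones a) (true :: nseq b false) =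
  (ones n * ones a) (nseq b false).
Proof.
by rewrite -[LHS]/(qder true _ _) qderM qder_ones mulr0 addr0 qder_root.
Qed.

Lemma ones_value n : ones n (nseq n false) = 1.
Proof. by rewrite /ones eqxx. Qed.

Lemma ones1M_value n : (ones 1 * ones n) (nseq n.+1 false) = qnat n.+1.
Proof. by rewrite ones1 letterM_ones qscaleE ones_value mulr1. Qed.

Lemma onesM1_value n : (ones n * ones 1) (nseq n.+1 false) = qnat n.+1.
Proof. by rewrite ones1 onesM_letter qscaleE ones_value mulr1. Qed.

(** Let p = x ^+ k.  If the coefficient of the commutator used below vanished,
    then p would be a primitive cube root of unity. *)
Lemma odd_order_value k : (1 < k)%N -> (k.*2.+1).-primitive_root x ->
  1 + x ^+ (k * k) * qnat k
    - x ^+ (k * k.+1) * (x * qnat k + x ^+ (k.+1 * k)) != 0.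
Proof.
move=> k1 xN; apply/eqP => v0.
pose p := x ^+ k; pose r := x ^+ (k * k).
have px : p ^+ 2 * x = 1.
  by rewrite /p -exprM muln2 -exprSr (prim_expr_order xN).
have rp : r ^+ 2 * p = 1.
  rewrite /r /p -!exprM -exprD (_ : _ + _ = k.*2.+1 * k)%N; last by lia.
  by rewrite exprM (prim_expr_order xN) expr1n.
have p1 : p != 1.
  by rewrite /p -(prim_order_dvd xN) gtnNdvd //; lia.
have e1 : x ^+ (k * k.+1) = r * p by rewrite mulnS addnC exprD.
have e2 : x ^+ (k.+1 * k) = r * p by rewrite mulnC.
have v1 : (p - 1) * (p - 1) * (p + 1 + r * p) = 0.
  have := qnatE k; rewrite -/p => qk; rewrite e1 e2 -/r in v0.
  transitivity (- (p ^+ 2) * ((1 - x) * (1 + r * qnat k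
    - r * p * (x * qnat k + r * p)))); last by rewrite v0 !mulr0.
  transitivity (- (p ^+ 2) * ((1 - x) * (1 - r ^+ 2 * p * p)
    + ((1 - x) * qnat k) * r * (1 - p * x))); last by ring.
  rewrite qk rp.
  transitivity (- (p ^+ 2 - p ^+ 2 * x) * (1 - p)
    - (1 - p) * r * (p ^+ 2 - p * (p ^+ 2 * x))); last by ring.
  by rewrite px; ring.
have v2 : p + 1 + r * p = 0.
  move/eqP: v1; rewrite !mulf_eq0 -orbA; have := p1; rewrite -subr_eq0.
  by move=> /negPf->; rewrite !orFb => /eqP.
have p3 : p ^+ 3 = 1.
  have sq : (p + 1) ^+ 2 = p.
    have -> : p + 1 = - (r * p) by apply/eqP; rewrite -addr_eq0 v2.
    by rewrite sqrrN exprMn expr2 mulrA rp mul1r.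
  have -> : p ^+ 3 = (p - 1) * ((p + 1) ^+ 2 - p) + 1 by ring.
  by rewrite sq subrr mulr0 add0r.
have x3 : x ^+ 3 == 1.
  apply/eqP; transitivity ((x ^+ k.*2.+1) ^+ 3).
    rewrite -exprM (_ : k.*2.+1 * 3 = k * 3 * 2 + 3)%N; last by lia.
    by rewrite exprD exprM [x ^+ (k * 3)]exprM -/p p3 expr1n mul1r.
  by rewrite (prim_expr_order xN) expr1n.
by move: x3; rewrite -(prim_order_dvd xN) => /dvdn_leq; lia.
Qed.

(** An element of degree N has trivial self-braiding.  For odd N a bracket of two
    iterated brackets is suitable, for N = 2 mod 4 the square of an iterated
    bracket, and when 4 divides N, already an iterated bracket of degree N / 2 has
    trivial self-braiding.  If x is not a root of unity, then a letter will do. *)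
Lemma constant_nonzero : ord_gt x 3 ->
  exists2 n, (0 < n)%N & forall m, nonzero_degree q (n * m).
Proof.
case=> [[N N3 xN]|xinf]; last first.
  exists 1%N => //.
  apply: (@starts_with_nonzero _ _ q 1 (letter q true) (fun=> x) true [::]).
  - exact: generated_letter.
  - exact: (@homog_letter K _ q true).
  - by move=> [] // _; rewrite qder_letter scale0r.
  - by [].
  - exact: (qders_top (generated_letter q true)).
  - by rewrite /letter eqxx oner_neq0.
  - by move=> m; rewrite big_seq1 -/(qnat _) qnat_neq0 // xinf.
have gr n : (n.+1 < N)%N -> generated n.+1 (root n).
  move=> nN; apply: generated_root => i /andP[i0 iN].
  by rewrite -(prim_order_dvd xN) gtnNdvd //; lia.
exists N; first by lia.
have := odd_double_half N; case: (boolP (odd N)) => [oN|eN] /= DN.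
  (* N = 2k + 1, and f is a bracket of elements of degrees k and k + 1 *)
  pose k := N./2; have k1 : (1 < k)%N by rewrite /k; lia.
  have DNk : N = k.*2.+1 by rewrite /k; lia.
  have [j Dj] : exists j, k = j.+1 by exists k.-1; lia.
  pose lam := x ^+ (k * k.+1).
  pose f := root j * root k - lam *: (root k * root j).
  have gj : generated k (root j) by rewrite Dj; apply: gr; lia.
  have gk : generated k.+1 (root k) by apply: gr; lia.
  apply: (@two_block_nonzero N f j k); first last.
  - rewrite -[X in X != 0]/(qders (true :: nseq j false) f
      (true :: nseq k false)).
    rewrite /f qdersB qdersZ !qders_rootM !qders_ones leqnn !Dj leqnSn subnn.
    rewrite subSnn -Dj qaddE qoppE !qscaleE !qaddE !qscaleE.
    rewrite !onesM_root_value !rootM_ones_value ones0 mul1r mulr1 expr0 mul1r.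
    have -> : (ones 1 * ones j) (nseq k false) = qnat k.
      by rewrite Dj ones1M_value.
    have -> : (ones j * ones 1) (nseq k false) = qnat k.
      by rewrite Dj onesM1_value.
    by rewrite ones_value mulr1 expr1 /lam odd_order_value // -DNk.
  - rewrite /f qdersB qdersZ !qders_rootM !qders_ones -Dj leqnn subnn ones0.
    by rewrite Dj ltnn mul0r !mulr0 scaler0 addr0 add0r mul1r mulr1 /lam Dj subrr.
  - rewrite /f qderB qderZ !qderM !qder_rootF !homog_root.
    by rewrite !(mul0r, mulr0, addr0, scaler0, subr0).
  - have xN1 : x ^+ k * x ^+ k.+1 = 1.
      by rewrite -exprD addnS addnn -DNk (prim_expr_order xN).
    apply: homogB; last apply: homogZ.
      by have := homogM (homog_root j) (homog_root k); rewrite -Dj xN1.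
    by have := homogM (homog_root k) (homog_root j); rewrite -Dj mulrC xN1.
  - by rewrite Dj.
  - by rewrite /= size_cat /= !size_nseq; lia.
  - rewrite /f addrC -scaleNr DNk -addnn; apply: generatedL.
      by rewrite -addSn; apply: generatedM.
    by rewrite -addnS; apply: generatedM.
(* N = 2M; the two cases are those of a square and of an iterated bracket *)
pose M := N./2; have DNM : N = M.*2 by rewrite /M; lia.
have xM : x ^+ M = -1.
  have /eqP : (x ^+ M) ^+ 2 = 1 by rewrite -exprM muln2 -DNM (prim_expr_order xN).
  rewrite sqrf_eq1 => /orP[|/eqP //].
  by rewrite -(prim_order_dvd xN) gtnNdvd //; lia.
have [j Dj] : exists j, M = j.+1 by exists M.-1; lia.
have gj : generated M (root j) by rewrite Dj; apply: gr; lia.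
case: (boolP (odd M)) => [oM|eM].
  pose f := root j * root j.
  have [a Da] : exists a, j = a.+1 by exists j.-1; lia.
  apply: (@two_block_nonzero N f a M); first last.
  - rewrite -[X in X != 0]/(qders (true :: nseq a false) f
      (true :: nseq M false)).
    rewrite /f !qders_rootM !qders_ones !Da leqnSn subSnn -Da.
    rewrite qaddE !qscaleE onesM_root_value rootM_ones_value.
    have -> : (ones 1 * ones j) (nseq M false) = qnat M.
      by rewrite Dj ones1M_value.
    have -> : (ones j * ones 1) (nseq M false) = qnat M.
      by rewrite Dj onesM1_value.
    rewrite -Dj expr1.
    rewrite exprM xM -signr_odd (_ : odd j = false); last by lia.
    rewrite -mulrDl mulf_neq0 //; last first.
      by rewrite qnat_neq0 // -(prim_order_dvd xN) gtnNdvd //; lia.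
    rewrite addr_eq0; apply/eqP => xE; have := prim_order_dvd xN 2.
    by rewrite xE sqrrN expr1n eqxx gtnNdvd //; lia.
  - rewrite /f !qders_rootM !qders_ones -Da leqnn subnn ones0 -Dj mul1r mulr1.
    rewrite exprM xM -signr_odd oM expr1 scaleN1r subrr //.
  - by rewrite /f qderM !qder_rootF homog_root !(mul0r, mulr0, addr0).
  - have := homogM (homog_root j) (homog_root j); rewrite -Dj xM.
    by rewrite mulrNN mulr1.
  - by lia.
  - by rewrite /= size_cat /= !size_nseq; lia.
  - by rewrite DNM -addnn; apply: generatedM.
rewrite DNM -muln2; move=> m; rewrite -mulnA.
move: (2 * m)%N => {}m; move: m.
apply: (starts_with_nonzero gj (homog_root j) (c := true) (l := nseq j false)).
- by case.
- by rewrite mem_nseq andbF.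
- by apply: (qders_top gj); rewrite /= size_nseq Dj.
- by rewrite /root eqxx oner_neq0.
- move=> m; rewrite big_const_seq count_predT iter_mulr_1 /= size_nseq -Dj xM.
  by rewrite -signr_odd (negPf eM) expr0 sum_expr1_neq0.
Qed.

End ConstantBraiding.

(** * Shortest expressions and inversions *)

Section Inversions.
Variable n : nat.
Implicit Types (x y z : 'S_n.+1) (i : 'I_n) (v : seq 'I_n).

Local Notation lo i := (widen_ord (leqnSn n) i).
Local Notation hi i := (lift ord0 i).

Definition invs m (y : 'S_m) : {set 'I_m * 'I_m} :=
  [set p : 'I_m * 'I_m | (p.1 < p.2)%N && (y p.2 < y p.1)%N].

Lemma lo_hi i : (hi i : nat) = i.+1. Proof. exact: lift0. Qed.

Lemma elem_transpL i : elem_transp i (lo i) = hi i. Proof. exact: tpermL. Qed.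
Lemma elem_transpR i : elem_transp i (hi i) = lo i. Proof. exact: tpermR. Qed.
Lemma elem_transpV i : ((elem_transp i)^-1)%g = elem_transp i.
Proof. exact: tpermV. Qed.
Lemma elem_transpK i y : (y * elem_transp i * elem_transp i)%g = y.
Proof. by rewrite -{2}(elem_transpV i) mulgK. Qed.

Lemma elem_transp_val i (k : 'I_n.+1) : (elem_transp i k : nat) =
  if (k : nat) == i then i.+1 else if (k : nat) == i.+1 then i : nat else k.
Proof.
rewrite /elem_transp permE /= -!(inj_eq (@ord_inj _)) lo_hi /=.
by case: ifP => // _; case: ifP.
Qed.

(** Exchanging the values i and i + 1, which y takes in this order, creates
    exactly one inversion. *)
Lemma invs_transp i y : (y^-1%g (lo i) < y^-1%g (hi i))%N ->
  invs (y * elem_transp i)%g = (y^-1%g (lo i), y^-1%g (hi i)) |: invs y /\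
  (y^-1%g (lo i), y^-1%g (hi i)) \notin invs y.
Proof.
move=> lt_i; split; last by rewrite inE /= !permKV /= /bump /=; lia.
apply/setP => -[a b]; rewrite !inE /= xpair_eqE !permM.
rewrite -!(canF_eq (permK y)) -!(inj_eq (@ord_inj _)) !elem_transp_val lo_hi.
have pos (c d : 'I_n.+1) : (y c : nat) = i -> (y d : nat) = i.+1 -> (c < d)%N.
  move=> yc yd; have := lt_i; suff [<- <-] : y c = lo i /\ y d = hi i.
    by rewrite !permK.
  by split; apply: ord_inj; rewrite ?lo_hi.
have [ab|] /= := ltnP a b.
  have : (y a != y b :> nat).
    by rewrite (inj_eq (@ord_inj _)) (inj_eq perm_inj) -(inj_eq (@ord_inj _)); lia.
  have : (y b : nat) = i -> (y a : nat) = i.+1 -> False.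
    by move=> yb /(pos _ _ yb); lia.
  move: (y a : nat) (y b : nat) => ya yb.
  by case: (eqVneq yb i); case: (eqVneq yb i.+1); case: (eqVneq ya i);
    case: (eqVneq ya i.+1); lia.
rewrite orbF => ba; apply/esym/negbTE/negP => /andP[/eqP ya /eqP yb].
by have := pos _ _ ya yb; lia.
Qed.

Lemma perm_increasing z : (forall i, (z (lo i) < z (hi i))%N) -> z = 1%g.
Proof.
move=> inc.
have mono (a b : 'I_n.+1) : (a < b)%N -> (z a < z b)%N.
  move=> ab; have [d Db] : exists d, (b : nat) = (a + d).+1.
    by exists (b - a).-1; lia.
  elim: d b ab Db => [|d IHd] b ab Db.
    have an : (a < n)%N by have := ltn_ord b; lia.
    have := inc (Ordinal an); congr (z _ < z _)%N; apply: ord_inj => //.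
    by rewrite lo_hi /=; lia.
  have dn : (a + d.+1 < n)%N by have := ltn_ord b; lia.
  apply: ltn_trans (IHd (lo (Ordinal dn)) _ _) _ => /=; try lia.
  have := inc (Ordinal dn); congr (_ < z _)%N; apply: ord_inj.
  by rewrite lo_hi /=; lia.
have ge (t : 'S_n.+1) : (forall a b : 'I_n.+1, (a < b)%N -> (t a < t b)%N) ->
    forall a : 'I_n.+1, (a <= t a)%N.
  move=> tmono [a]; elim: a => [|a IHa] // lt_a.
  exact: leq_ltn_trans (IHa (ltnW lt_a)) (tmono (Ordinal (ltnW lt_a)) _ _).
have monoV (a b : 'I_n.+1) : (a < b)%N -> (z^-1%g a < z^-1%g b)%N.
  move=> ab; rewrite ltnNge leq_eqVlt; apply/negP => /orP[/eqP/ord_inj|].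
    by move/perm_inj => ba; rewrite ba ltnn in ab.
  by move/mono; rewrite !permKV; lia.
apply/permP => a; rewrite perm1; apply/ord_inj/eqP; rewrite eqn_leq (ge z) //.
by have := ge _ monoV (z a); rewrite permK => ->.
Qed.

Lemma invs1 : invs (1 : 'S_n.+1) = set0.
Proof. by apply/setP => p; rewrite !inE !perm1; lia. Qed.

Lemma card_invs_word v : (#|invs (word_perm v)^-1%g| <= size v)%N.
Proof.
elim: v => [|i v IHv]; first by rewrite /word_perm big_nil invg1 invs1 cards0.
rewrite /word_perm big_cons -/(word_perm v) invMg elem_transpV.
set y := ((word_perm v)^-1)%g in IHv *.
have [lt_i|] := ltnP (y^-1%g (lo i)) (y^-1%g (hi i)).
  by have [-> new] := invs_transp lt_i; rewrite cardsU1 new.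
rewrite leq_eqVlt => /orP[/eqP/ord_inj/perm_inj/(congr1 val)|].
  by rewrite /= /bump /=; lia.
move=> gt_i; have := @invs_transp i (y * elem_transp i)%g.
rewrite invMg elem_transpV !permM elem_transpL elem_transpR elem_transpK.
move=> /(_ gt_i)[Ey new]; move: IHv; rewrite Ey cardsU1 new add1n => lt_v.
by rewrite (leq_trans (ltnW lt_v)) /=.
Qed.

(** As long as there are inversions, some adjacent transposition removes one. *)
Lemma exists_short_word y :
  exists v, word_perm v = (y^-1)%g /\ size v = #|invs y|.
Proof.
move Dm: #|invs y| => m; elim: m y Dm => [|m IHm] y Dm.
  exists [::]; split=> //; rewrite /word_perm big_nil.
  apply/esym/perm_increasing => i; rewrite ltnNge; apply/negP.
  rewrite leq_eqVlt => /orP[/eqP/ord_inj/perm_inj/(congr1 val)|gt_i].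
    by rewrite /= /bump /=; lia.
  have : (y^-1%g (hi i), y^-1%g (lo i)) \in invs y.
    by rewrite inE /= !permKV gt_i lo_hi /=.
  by rewrite (cards0_eq Dm) inE.
have [i gt_i] : exists i, (y^-1%g (hi i) < y^-1%g (lo i))%N.
  case: (pickP (fun i => y^-1%g (hi i) < y^-1%g (lo i))%N) => [i|inc].
    by exists i.
  have : (y^-1)%g = 1%g.
    apply: perm_increasing => i; have /negbT := inc i.
    rewrite -leqNgt leq_eqVlt.
    case/orP => // /eqP/ord_inj/perm_inj/(congr1 val).
    by rewrite /= /bump /=; lia.
  by move/(canRL invgK); rewrite invg1 => y1; rewrite y1 invs1 cards0 in Dm.
have := @invs_transp i (y * elem_transp i)%g.
rewrite invMg elem_transpV !permM elem_transpL elem_transpR elem_transpK.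
move=> /(_ gt_i)[Ey new]; have := IHm (y * elem_transp i)%g.
case; first by move: Dm; rewrite Ey cardsU1 new; lia.
move=> v [Dv sv]; exists (i :: v); split; last by rewrite /= sv.
rewrite /word_perm big_cons -/(word_perm v) Dv invMg elem_transpV mulgA.
by rewrite -{1}(elem_transpV i) mulVg mul1g.
Qed.

Lemma size_shortest_word x : size (shortest_word x) = #|invs (x^-1)%g|.
Proof.
have [Dx min_x] := shortest_wordP x; apply/eqP; rewrite eqn_leq.
rewrite -{3}Dx card_invs_word andbT.
have [v [Dv <-]] := exists_short_word (x^-1)%g.
by apply: min_x; rewrite Dv invgK.
Qed.

End Inversions.

(** * The quantum symmetrizer of a diagonal braiding *)

Section DiagonalSymmetrizer.
Variables (K : fieldType) (J : finType) (q : J -> J -> K).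
Hypothesis hq : forall i j, q i j != 0.
Local Notation V := (diagonal_space hq).
Local Notation lo i := (widen_ord (leqnSn _) i).
Local Notation hi i := (lift ord0 i).

Definition act n (y : 'S_n) (s : {ffun 'I_n -> J}) : {ffun 'I_n -> J} :=
  [ffun k => s (y k)].

Lemma diagonal_braid_gen n (i : 'I_n) (f : {ffun {ffun 'I_n.+1 -> J} -> K^o}) s :
  braid_gen (braiding V) i f s = q (s (hi i)) (s (lo i)) * f (act (elem_transp i) s).
Proof.
rewrite (@rack_braid_gen K (trivial_rack J) (trivial_cocycle hq) n i f s
  (s (hi i)) (s (lo i))) // mulrC.
congr (_ * f _); apply/ffunP => k; rewrite !ffunE /= /elem_transp.
case: tpermP => [->|->|/eqP/negPf-> /eqP/negPf->] //; rewrite eqxx //.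
by case: eqP => // /(congr1 val); rewrite /= /bump /=; lia.
Qed.

Definition inv_weight n (y : 'S_n) (s : {ffun 'I_n -> J}) : K :=
  \prod_(p in invs y) q (s (y p.1)) (s (y p.2)).

(** Along a shortest word each crossing creates a new inversion, to which it
    contributes the factor. *)
Lemma braid_wordE n (v : seq 'I_n) (f : {ffun {ffun 'I_n.+1 -> J} -> K^o}) s :
  size v = #|invs (word_perm v)^-1%g| ->
  braid_word V v f s =
  inv_weight (word_perm v)^-1%g s * f (act (word_perm v)^-1%g s).
Proof.
elim: v s => [|i v IHv] s sv.
  rewrite /word_perm big_nil invg1 /inv_weight invs1 big_set0 mul1r lfunE /=.
  by congr (f _); apply/ffunP => k; rewrite ffunE perm1.
move: sv; rewrite /word_perm big_cons -/(word_perm v) invMg elem_transpV.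
move: (card_invs_word v) IHv; set y := ((word_perm v)^-1)%g => y_v IHv sv.
have lt_i : (y^-1%g (lo i) < y^-1%g (hi i))%N.
  rewrite ltnNge leq_eqVlt; apply/negP => /orP[/eqP/ord_inj/perm_inj|gt_i].
    by move/(congr1 val); rewrite /= /bump /=; lia.
  have := @invs_transp _ i (y * elem_transp i)%g.
  rewrite invMg elem_transpV !permM elem_transpL elem_transpR elem_transpK.
  move=> /(_ gt_i)[Ey new]; move: y_v; rewrite Ey cardsU1 new add1n -sv /=.
  by move/ltnW; rewrite ltnn.
have [Ey new] := invs_transp lt_i.
rewrite comp_lfunE diagonal_braid_gen IHv; last first.
  by move: sv; rewrite Ey cardsU1 new add1n => -[].
rewrite mulrA /inv_weight Ey big_setU1 //= !permM !permKV.
rewrite elem_transpL elem_transpR; congr (_ * _ * f _).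
  by apply: eq_bigr => p _; rewrite !ffunE !permM.
by apply/ffunP => k; rewrite !ffunE permM.
Qed.

Lemma quantum_symmetrizer_perm n (f : {ffun {ffun 'I_n.+1 -> J} -> K^o}) s :
  quantum_symmetrizer V n f s = \sum_(y : 'S_n.+1) inv_weight y s * f (act y s).
Proof.
rewrite sum_lfunE sum_ffunE (reindex_inj invg_inj) /=; apply: eq_bigr => y _.
have [Dx _] := shortest_wordP (y^-1)%g.
by rewrite braid_wordE Dx ?invgK // size_shortest_word invgK.
Qed.

Lemma inv_weight_lift n (p : 'I_n.+1) (t : 'S_n) (u : {ffun 'I_n.+1 -> J}) :
  inv_weight (lift_perm ord0 p t) u =
  (\prod_(b : 'I_n.+1 | (b < p)%N) q (u p) (u b))
    * inv_weight t [ffun k => u (lift p k)].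
Proof.
have E m (y : 'S_m) (s : {ffun 'I_m -> J}) : inv_weight y s =
    \prod_(k < m) \prod_(l < m | (k < l)%N && (y l < y k)%N) q (s (y k)) (s (y l)).
  by rewrite pair_big_dep /=; apply: eq_bigl => -[a b]; rewrite inE.
have lift_lt (a b : 'I_n) : (lift p a < lift p b)%N = (a < b)%N.
  by rewrite /= /bump; lia.
rewrite !E big_ord_recl; congr (_ * _).
  rewrite big_mkcond big_ord_recl /= lift_perm_id mul1r.
  rewrite [RHS]big_mkcond (bigD1_ord p) //= ltnn mul1r.
  rewrite [RHS](reindex_inj (@perm_inj _ t)) /=; apply: eq_bigr => l _.
  by rewrite lift_perm_lift.
apply: eq_bigr => k _; rewrite big_mkcond big_ord_recl /= mul1r -big_mkcond /=.
by apply: eq_big => [l|l _]; rewrite ?ffunE !lift_perm_lift // lift_lt.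
Qed.

Lemma codom_take n (u : {ffun 'I_n -> J}) (p : nat) i :
  \prod_(k <- take p (codom u)) q i k = \prod_(b < n | (b < p)%N) q i (u b).
Proof.
rewrite codomE -map_take big_map -[RHS]big_filter.
apply: perm_big; apply: uniq_perm.
- by rewrite take_uniq ?enum_uniq.
- by rewrite filter_uniq ?index_enum_uniq.
move=> b; rewrite mem_filter mem_index_enum andbT.
by rewrite in_take ?mem_enum // index_enum_ord.
Qed.

Lemma nth_codom_ord n (u : {ffun 'I_n -> J}) j0 (p : 'I_n) : nth j0 (codom u) p = u p.
Proof. by rewrite codomE (nth_map p) ?nth_ord_enum // size_enum_ord. Qed.

Lemma codom_lift n (u : {ffun 'I_n.+1 -> J}) (p : 'I_n.+1) :
  codom [ffun k => u (lift p k)] = take p (codom u) ++ drop p.+1 (codom u).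
Proof.
have sz m (v : {ffun 'I_m -> J}) : size (codom v) = m.
  by rewrite size_codom card_ord.
have j0 := u ord0; apply: (@eq_from_nth _ j0) => [|j].
  rewrite size_cat size_takel ?size_drop ?sz //; last by rewrite ltnW.
  by have := ltn_ord p; lia.
rewrite sz => jn; rewrite (nth_codom_ord _ _ (Ordinal jn)) ffunE nth_cat.
rewrite size_takel ?sz; last by rewrite ltnW.
have [jp|pj] := ltnP j p.
  rewrite nth_take // -(nth_codom_ord _ j0); congr (nth _ _ _).
  by rewrite /= /bump; lia.
rewrite nth_drop -(nth_codom_ord _ j0); congr (nth _ _ _).
by rewrite /= /bump; lia.
Qed.

Lemma codom_cons n (w : {ffun 'I_n.+1 -> J}) :
  codom w = w ord0 :: codom [ffun k => w (lift ord0 k)].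
Proof.
by rewrite codom_lift take0 drop1 [in LHS]codomE enum_ordSl /= codomE enum_ordSl.
Qed.

(** Both sides split according to the position p of the letter of u that becomes
    the first letter of w. *)
Lemma sum_inv_weight n (w u : {ffun 'I_n -> J}) :
  \sum_(y : 'S_n | act y u == w) inv_weight y u =
  monomial q (codom w) (codom u).
Proof.
elim: n w u => [|n IHn] w u.
  have c0 (v : {ffun 'I_0 -> J}) : codom v = [::].
    by apply/nilP; rewrite /nilp size_codom card_ord.
  rewrite !c0 (big_pred1 1%g) => [|y]; last first.
    rewrite /= (_ : y = 1%g) ?eqxx; last by apply/permP => -[].
    by apply/eqP/ffunP => -[].
  by rewrite monomial_nil /inv_weight big1 // => -[[]].
rewrite codom_cons monomial_cons letterM_sum.
rewrite -(big_mkord xpredT (fun p => (nth (w ord0) (codom u) p == w ord0)%:R *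
  \prod_(k <- take p (codom u)) q (w ord0) k *
  monomial q (codom [ffun k => w (lift ord0 k)])
    (take p (codom u) ++ drop p.+1 (codom u)))).
rewrite size_codom card_ord big_mkord.
pose h (pt : 'I_n.+1 * 'S_n) := lift_perm ord0 pt.1 pt.2.
have hbij : bijective h.
  apply: inj_card_bij; last first.
    by rewrite card_prod card_ord (card_Sn n.+1) (card_Sn n) factS.
  move=> [p t] [p' t'] E; have pp : p = p'.
    by have := congr1 (fun y : 'S_n.+1 => y ord0) E; rewrite /h !lift_perm_id.
  congr pair => //; apply/permP => k; apply: (@lift_inj _ p).
  have := congr1 (fun y : 'S_n.+1 => y (lift ord0 k)) E.
  by rewrite /h !lift_perm_lift /= -pp.
rewrite (reindex h) /=; last by case: hbij => g gK hK; exists g.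
rewrite (eq_bigl (fun pt => (u pt.1 == w ord0) && (act pt.2
    [ffun k => u (lift pt.1 k)] == [ffun k => w (lift ord0 k)]))); last first.
  move=> [p t] /=; apply/eqP/andP => [E|[/eqP Ep /eqP Et]].
    split; apply/eqP.
      by rewrite -E ffunE lift_perm_id.
    by apply/ffunP => k; rewrite !ffunE -E ffunE lift_perm_lift.
  apply/ffunP => k; rewrite ffunE; case: (unliftP ord0 k) => [k'|] ->.
    have := congr1 (fun f : {ffun _ -> _} => f k') Et.
    by rewrite !ffunE lift_perm_lift.
  by rewrite lift_perm_id.
rewrite -(pair_big_dep (fun p => u p == w ord0) (fun p t => act t
    [ffun k => u (lift p k)] == [ffun k => w (lift ord0 k)])
  (fun p t => inv_weight (h (p, t)) u)) /= big_mkcond; apply: eq_bigr => p _.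
rewrite nth_codom_ord -codom_lift -IHn; case: eqP => [up|_].
  rewrite mul1r codom_take mulr_sumr; apply: eq_bigr => t _.
  by rewrite /h inv_weight_lift up.
by rewrite !mul0r.
Qed.

(** The permutations are grouped by the word from which they lead to u. *)
Lemma quantum_symmetrizerE n (f : {ffun {ffun 'I_n.+1 -> J} -> K^o}) u :
  quantum_symmetrizer V n f u =
  \sum_(w : {ffun 'I_n.+1 -> J}) f w * monomial q (codom w) (codom u).
Proof.
rewrite quantum_symmetrizer_perm (partition_big (fun y => act y u) xpredT) //=.
apply: eq_bigr => w _; rewrite -sum_inv_weight mulr_sumr.
by apply: eq_bigr => y /eqP <-; rewrite mulrC.
Qed.

End DiagonalSymmetrizer.

(** * Ranks of quantum symmetrizers *)

Section Ranks.
Variables (K : fieldType).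
Implicit Types V W : braidedSpace K.
Local Notation words V n := {ffun {ffun 'I_n -> bbasis V} -> K^o}.

Lemma dim_ffun (T : finType) : \dim {: {ffun T -> K^o}} = #|T|.
Proof. by rewrite dimvf; apply: muln1. Qed.

Lemma nichols_degree_dimE V n :
  nichols_degree_dim V n.+1 = \dim (limg (quantum_symmetrizer V n)).
Proof.
case: n => [|n]; last first.
  have := limg_ker_dim (quantum_symmetrizer V n.+1) fullv.
  by rewrite capfv /= => <-; rewrite addKn.
rewrite /= /quantum_symmetrizer (big_pred1 1%g) => [|x]; last first.
  by apply/esym/eqP/permP => k; rewrite !(ord1 _).
rewrite (_ : shortest_word _ = [::]); last by case: (shortest_word _) => // -[].
by rewrite /braid_word /= lim1g dim_ffun card_ffun card_ord expn1.
Qed.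

Lemma nichols_degree_dim_eq0 V n :
  (nichols_degree_dim V n.+1 == 0%N) = (quantum_symmetrizer V n == 0).
Proof.
rewrite nichols_degree_dimE dimv_eq0 -subv0.
apply/idP/eqP => [/subvP Q0|->]; last by rewrite lim0g subvv.
apply/lfunP => f; rewrite lfunE /=; apply/eqP; rewrite -memv0.
by apply: Q0; apply: memv_img (memvf f).
Qed.

Lemma nichols_infiniteP V :
  (forall N, exists2 n, (N <= n)%N & quantum_symmetrizer V n != 0) ->
  nichols_infinite V.
Proof.
move=> nz [d [N [z _]]]; have [n Nn /negP] := nz N; apply.
by rewrite -nichols_degree_dim_eq0 z // leqW.
Qed.

Lemma nichols_infinite_symmetrizer V N :
  nichols_infinite V -> exists2 n, (N <= n)%N & quantum_symmetrizer V n != 0.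
Proof.
move=> infV; apply: contrapT => no; apply: infV.
exists (\sum_(n < N.+1) nichols_degree_dim V n)%N; exists N.+1; split=> //.
case=> // n Nn; apply/eqP; rewrite nichols_degree_dim_eq0.
by apply/negPn/negP => Q0; apply: no; exists n.
Qed.

Section Intertwiner.
Variables (V W : braidedSpace K) (n : nat).
Variable Psi : 'Hom(words W n.+1, words V n.+1).
Hypothesis Psi_braid : forall i f,
  braid_gen (braiding V) i (Psi f) = Psi (braid_gen (braiding W) i f).

Lemma intertwine_symmetrizer f :
  quantum_symmetrizer V n (Psi f) = Psi (quantum_symmetrizer W n f).
Proof.
rewrite !sum_lfunE linear_sum; apply: eq_bigr => x _ /=.
elim: (shortest_word x) => [|i v IHv]; first by rewrite /= !id_lfunE.
by rewrite /= !comp_lfunE IHv Psi_braid.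
Qed.

Lemma intertwine_neq0 : lker Psi = 0%VS ->
  quantum_symmetrizer W n != 0 -> quantum_symmetrizer V n != 0.
Proof.
move=> /eqP/lker0P inj; apply: contraNneq => V0; apply/eqP/lfunP => f.
by apply: inj; rewrite -intertwine_symmetrizer V0 !lfunE /= linear0.
Qed.

Lemma intertwine_dim : lker Psi = 0%VS -> #|bbasis W| = #|bbasis V| ->
  nichols_degree_dim V n.+1 = nichols_degree_dim W n.+1.
Proof.
move=> ker0 cardWV; rewrite !nichols_degree_dimE.
have full : limg Psi = fullv.
  apply/eqP; rewrite eqEdim subvf limg_dim_eq ?ker0 ?capv0 // !dim_ffun.
  by rewrite !card_ffun cardWV leqnn.
rewrite -full -limg_comp.
have -> : (quantum_symmetrizer V n \o Psi)%VF = (Psi \o quantum_symmetrizer W n)%VF.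
  by apply/lfunP => f; rewrite !comp_lfunE intertwine_symmetrizer.
by rewrite limg_comp limg_dim_eq // ker0 capv0.
Qed.

End Intertwiner.
End Ranks.

Section DiagonalRanks.
Variables (K : numFieldType) (J : finType) (q : J -> J -> K).
Hypothesis hq : forall i j, q i j != 0.

Lemma word_codom n (w : seq J) : size w = n ->
  exists s : {ffun 'I_n -> J}, codom s = w.
Proof.
move=> <-; case: w => [|j w].
  exists [ffun k : 'I_0 => False_rect J (notF (ltn_ord k))].
  by apply/nilP; rewrite /nilp size_codom card_ord.
exists [ffun k : 'I_(size (j :: w)) => nth j (j :: w) k].
apply: (@eq_from_nth _ j) => [|k]; first by rewrite size_codom card_ord.
rewrite size_codom card_ord => lt_k.
by rewrite (nth_codom_ord _ _ (Ordinal lt_k)) ffunE.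
Qed.

Lemma diagonal_symmetrizer_neq0 n :
  quantum_symmetrizer (diagonal_space hq) n != 0 <-> nonzero_degree q n.+1.
Proof.
split=> [Qn|[w sw [u wu]]].
  apply: contrapT => no; case/negP: Qn; apply/eqP/lfunP => f; apply/ffunP => u.
  rewrite quantum_symmetrizerE lfunE ffunE big1 // => w _.
  have [->|nz] := eqVneq (monomial q (codom w) (codom u)) 0; first by rewrite mulr0.
  case: no; exists (codom w); last by exists (codom u).
  by rewrite size_codom card_ord.
have su : size u = n.+1 by rewrite -(perm_size (monomial_perm wu)).
have [s Ds] := word_codom sw; have [t Dt] := word_codom su.
apply: contraNneq wu => Q0.
have := @quantum_symmetrizerE _ _ _ hq n (basis_vec K s) t.
rewrite Q0 lfunE ffunE (bigD1 s) //= ffunE eqxx mul1r big1 => [|s' ns].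
  by rewrite addr0 Ds Dt => <-.
by rewrite ffunE (negPf ns) mul0r.
Qed.

End DiagonalRanks.

(** * Diagonalization of the rack braiding *)

Section Fourier.
Variables (K : fieldType) (X : finType) (A : finGroupType) (sigma : X -> A).
Hypothesis abA : abelian [set: A].
Variables (q : X -> X -> K) (omega : A -> K).
Hypotheses (hq : forall i j, q i j != 0) (homega : is_character omega).
Local Notation V := (ext_space sigma abA hq homega).

(** Each letter j is a vector of the form \sum_b eig j b (iota j, b) that is an
    eigenvector of those translations by which the other letters act on it. *)
Variables (J : finType) (iota : J -> X) (eig dual : J -> A -> K).
Variable lam : J -> J -> K.
Hypothesis eigP : forall j l b,
  eig l (b * (kappa sigma (iota j) (iota l))^-1)%g = lam j l * eig l b.
Hypothesis dualP : forall j l, iota j = iota l ->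
  \sum_b dual j b * eig l b = (j == l)%:R.
Hypothesis lam_neq0 : forall j l, lam j l != 0.

Definition eig_braiding j l : K := q (iota j) (iota l) * lam j l.

Lemma eig_braiding_neq0 j l : eig_braiding j l != 0.
Proof. by rewrite mulf_neq0. Qed.

Local Notation W := (diagonal_space eig_braiding_neq0).

Definition eig_coord (l : J) (y : X * A) : K := (y.1 == iota l)%:R * eig l y.2.
Definition dual_coord (l : J) (y : X * A) : K := (y.1 == iota l)%:R * dual l y.2.

Lemma dual_eig j l : \sum_y dual_coord j y * eig_coord l y = (j == l)%:R.
Proof.
rewrite -(pair_big xpredT xpredT
  (fun i a => dual_coord j (i, a) * eig_coord l (i, a))) /=.
rewrite (bigD1 (iota j)) //= [X in _ + X]big1 ?addr0 => [|i ni]; last first.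
  by rewrite big1 // => a _; rewrite /dual_coord (negPf ni) !mul0r.
rewrite /dual_coord /eig_coord /=; have [E|ne] := eqVneq (iota j) (iota l).
  by rewrite -(dualP E); apply: eq_bigr => a _; rewrite eqxx !mul1r.
rewrite big1 => [|a _]; last by rewrite mul0r mulr0.
by rewrite (_ : (j == l) = false) //; apply: contra_neqF ne => /eqP->.
Qed.

(** The character omega contributes to the braiding in positions k, k + 1 the
    factor omega b / omega a, which these powers absorb.  The second one corrects
    the first for the translation of b by kappa. *)
Definition omega_twist n (s : {ffun 'I_n -> X * A}) : K :=
  \prod_k ((omega (s k).2)^-1 ^+ k * omega (sigma (s k).1) ^+ 'C(k, 2)).

Definition fourier_fun n (f : {ffun {ffun 'I_n -> J} -> K^o}) :
    {ffun {ffun 'I_n -> X * A} -> K^o} :=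
  [ffun s => omega_twist s * \sum_t f t * \prod_k eig_coord (t k) (s k)].

Lemma fourier_is_linear n : linear (@fourier_fun n).
Proof.
move=> a f g; apply/ffunP => s; rewrite !ffunE /GRing.scale /=.
rewrite [X in _ = X + _]mulrCA -mulrDr; congr (_ * _).
rewrite mulr_sumr -big_split /=.
by apply: eq_bigr => t _; rewrite !ffunE /GRing.scale /= mulrDl mulrA.
Qed.
HB.instance Definition _ n :=
  GRing.isLinear.Build K _ _ _ (@fourier_fun n) (@fourier_is_linear n).

Definition fourier n := linfun (@fourier_fun n).

Lemma omega_twist_neq0 n (s : {ffun 'I_n -> X * A}) : omega_twist s != 0.
Proof.
apply/prodf_neq0 => k _; rewrite mulf_neq0 ?expf_neq0 ?invr_eq0 //;
  exact: (character_neq0 homega).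
Qed.

Lemma fourier_inj n : lker (fourier n) = 0%VS.
Proof.
apply/eqP; rewrite -subv0; apply/subvP => f; rewrite memv_ker => /eqP f0.
rewrite memv0; apply/eqP/ffunP => t; rewrite ffunE.
have f0' (s : {ffun 'I_n -> X * A}) : \sum_t f t * \prod_k eig_coord (t k) (s k) = 0.
  have := congr1 (fun h : {ffun _ -> _} => h s) f0; rewrite lfunE /= !ffunE.
  by move/eqP; rewrite mulf_eq0 (negPf (omega_twist_neq0 s)) => /eqP.
transitivity (\sum_(s : {ffun 'I_n -> X * A}) (\prod_k dual_coord (t k) (s k)) *
  \sum_t' f t' * \prod_k eig_coord (t' k) (s k)); last first.
  by rewrite big1 // => s _; rewrite f0' mulr0.
under eq_bigr do rewrite mulr_sumr.
rewrite exchange_big /= (bigD1 t) //= [X in _ + X]big1 ?addr0.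
  transitivity (f t * \prod_k \sum_y dual_coord (t k) y * eig_coord (t k) y).
    rewrite big1 ?mulr1 // => k _; by rewrite dual_eig eqxx.
  rewrite bigA_distr_bigA mulr_sumr; apply: eq_bigr => s _.
  by rewrite mulrCA -big_split.
move=> t' tt'; transitivity
  (f t' * \prod_k \sum_y dual_coord (t k) y * eig_coord (t' k) y).
  rewrite bigA_distr_bigA mulr_sumr; apply: eq_bigr => s _.
  by rewrite mulrCA -big_split.
have [k tk] : exists k, t k != t' k.
  apply/existsP; rewrite -negb_forall; apply: contraNN tt' => /forallP E.
  by apply/eqP/ffunP => k; apply/esym/eqP.
by rewrite (bigD1 k) //= dual_eig (negPf tk) mul0r mulr0.
Qed.

Lemma prod_lo_hi n (i : 'I_n) (F : 'I_n.+1 -> K) :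
  \prod_k F k = F (widen_ord (leqnSn n) i) * F (lift ord0 i) *
    \prod_(k | (k != widen_ord (leqnSn n) i) && (k != lift ord0 i)) F k.
Proof.
rewrite (bigD1 (widen_ord (leqnSn n) i)) //= (bigD1 (lift ord0 i)) /= ?mulrA //.
by apply/eqP => /(congr1 val); rewrite /= /bump; lia.
Qed.

(** The braiding moves an eigenvector across a point x after translating it, which
    gives the factor lam; the factors that contain omega are the quotient of two
    values of omega_twist. *)
Lemma fourier_braid n (i : 'I_n) f :
  braid_gen (braiding V) i (fourier n.+1 f) =
  fourier n.+1 (braid_gen (braiding W) i f).
Proof.
apply/ffunP => s; set lo := widen_ord (leqnSn n) i; set hi := lift ord0 i.
have lohi : (hi == lo) = false.
  by apply/eqP => /(congr1 val); rewrite /= /bump; lia.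
pose x := s hi.
pose y : X * A := ((s lo).1, ((s lo).2 * (kappa sigma x.1 (s lo).1)^-1)%g).
have Dlo : s lo = ext_op sigma x y by rewrite /ext_op /= mulgKV -surjective_pairing.
rewrite (@rack_braid_gen K (ext_rack sigma abA) (ext_cocycle sigma abA hq homega)
  n i _ s x y Dlo erefl) !lfunE /= !ffunE.
set s' := set_pair i s (x, y).
have s'lo : s' lo = x by rewrite ffunE eqxx.
have s'hi : s' hi = y by rewrite ffunE lohi eqxx.
have s'k k : (k != lo) && (k != hi) -> s' k = s k.
  by case/andP => /negPf k1 /negPf k2; rewrite ffunE -/lo -/hi k1 k2.
have -> : omega_twist s = omega_twist s' * ((omega y.2) * (omega x.2)^-1).
  rewrite /omega_twist !(prod_lo_hi i) -/lo -/hi s'lo s'hi.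
  rewrite [X in _ = _ * X * _](eq_bigr (fun k => (omega (s k).2)^-1 ^+ k *
    omega (sigma (s k).1) ^+ 'C(k, 2))) => [|k /s'k -> //].
  rewrite [RHS]mulrAC; congr (_ * _); rewrite -/x lift0 /=.
  rewrite binS bin1 !exprD !exprS.
  have -> : (omega y.2)^-1 ^+ i = (omega (s lo).2)^-1 ^+ i *
      (omega (sigma x.1) / omega (sigma (s lo).1)) ^+ i.
    have [_ wM] := homega; rewrite /y /= wM (characterV homega) /kappa wM.
    by rewrite (characterV homega) invfM invrK exprMn.
  have nz a : omega a != 0 := character_neq0 homega a.
  rewrite expr_div_n; set P := _ ^+ 'C(i, 2); set Q := _ ^+ 'C(i, 2).
  set B := omega (sigma (s lo).1) ^+ i; set C := omega (sigma x.1) ^+ i.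
  have B0 : B != 0 by rewrite expf_neq0.
  by field; rewrite B0 !nz.
rewrite -!mulrA; congr (_ * _); rewrite [RHS]mulrA [LHS]mulrCA.
rewrite /ext_cocycle_fun; congr (_ * _).
pose swap := @act J n.+1 (elem_transp i).
have swapK : involutive swap.
  by move=> t; apply/ffunP => k; rewrite !ffunE -permM -{2}(elem_transpV i) mulgV perm1.
rewrite (reindex_inj (inv_inj swapK)) /= mulr_suml; apply: eq_bigr => t _.
have := @diagonal_braid_gen K J _ eig_braiding_neq0 n i f t.
rewrite -/lo -/hi -/(swap t) braid_genE => ->.
rewrite !(prod_lo_hi i) -/lo -/hi s'lo s'hi.
have -> : swap t lo = t hi by rewrite ffunE elem_transpL.
have -> : swap t hi = t lo by rewrite ffunE elem_transpR.
rewrite (eq_bigr (fun k => eig_coord (t k) (s k))) => [|k klh]; last first.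
  rewrite (s'k _ klh) ffunE /elem_transp tpermD //.
    by case/andP: klh => /negPf; rewrite eq_sym => ->.
  by case/andP: klh => _ /negPf; rewrite eq_sym => ->.
rewrite -[X in _ = _ * (_ * X * _)]/(eig_coord (t hi) x) /eig_coord /eig_braiding.
case: (eqVneq x.1 (iota (t hi))) => [xh|_]; last by rewrite !(mul0r, mulr0).
rewrite -[y.1]/((s lo).1) -[y.2]/((s lo).2 * _)%g.
case: (eqVneq (s lo).1 (iota (t lo))) => [yl|_]; last by rewrite !(mul0r, mulr0).
by rewrite xh yl eigP; ring.
Qed.

End Fourier.

Section FourierTransfer.
Variables (K : numFieldType) (X : finType) (A : finGroupType) (sigma : X -> A).
Hypothesis abA : abelian [set: A].
Variables (q : X -> X -> K) (omega : A -> K).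
Hypotheses (hq : forall i j, q i j != 0) (homega : is_character omega).
Local Notation V := (ext_space sigma abA hq homega).
Variables (J : finType) (iota : J -> X) (eig dual : J -> A -> K).
Variable lam : J -> J -> K.
Hypothesis eigP : forall j l b,
  eig l (b * (kappa sigma (iota j) (iota l))^-1)%g = lam j l * eig l b.
Hypothesis dualP : forall j l, iota j = iota l ->
  \sum_b dual j b * eig l b = (j == l)%:R.
Hypothesis lam_neq0 : forall j l, lam j l != 0.
Local Notation Q := (eig_braiding q iota lam).
Local Notation W := (diagonal_space (eig_braiding_neq0 hq iota lam_neq0)).

Lemma fourier_infinite :
  (forall N, exists2 n, (N <= n)%N & nonzero_degree Q n) -> nichols_infinite V.
Proof.
move=> inf; apply: nichols_infiniteP => N; have [[|n] // Nn Qn] := inf N.+1.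
exists n => //.
apply: (@intertwine_neq0 K V W n (fourier sigma omega iota eig n.+1)) => //.
- by move=> i f; apply: fourier_braid.
- exact: (fourier_inj sigma homega dualP).
exact/diagonal_symmetrizer_neq0.
Qed.

Lemma fourier_degree_dim n : #|J| = #|{: X * A}| ->
  nichols_degree_dim V n =
  nichols_degree_dim W n.
Proof.
move=> cardJ; case: n => [|n] //.
apply: (@intertwine_dim K V W n (fourier sigma omega iota eig n.+1)) => //.
- by move=> i f; apply: fourier_braid.
- exact: (fourier_inj sigma homega dualP).
Qed.

End FourierTransfer.

(** * Infinite-dimensional cases *)

Section Cycles.
Variables (K : numFieldType) (J : eqType) (q : J -> J -> K) (adj : rel J).
Hypothesis q_diag : forall i, q i i = -1.
Hypothesis q_sign : forall i j, i != j -> q i j * q j i = (-1) ^+ adj i j.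

Definition arbitrarily_large_degrees : Prop :=
  forall N, exists2 n, (N <= n)%N & nonzero_degree q n.

(** For braidings with signs, the conditions of cycle_nonzero are parities of
    numbers of edges. *)
Fixpoint odd_linked (s t : seq J) : bool :=
  if t is c :: t' then
    odd (count (adj^~ c) s) && odd_linked (rcons s c) t'
  else true.

Fixpoint edge_parity (s : seq J) : bool :=
  if s is c :: s' then odd (count (adj^~ c) s') (+) edge_parity s' else false.

Lemma prod_sign s c : c \notin s ->
  \prod_(d <- s) (q d c * q c d) = (-1) ^+ odd (count (adj^~ c) s).
Proof.
elim: s => [|d s IHs]; first by rewrite big_nil.
rewrite inE => /norP[cd cs]; rewrite big_cons /= IHs // q_sign 1?eq_sym //.
by rewrite oddD oddb signr_addb.
Qed.

Lemma linked_sign s t : uniq (s ++ t) -> odd_linked s t -> linked q s t.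
Proof.
elim: t s => [|c t IHt] //= s; rewrite -cat_rcons => u /andP[oc lt].
split; last exact: IHt.
rewrite prod_sign ?oc; last first.
  by move: u; rewrite cat_uniq rcons_uniq => /and3P[/andP[]].
by apply/eqP; rewrite expr1 eq_sym -subr_eq0 opprK -mulr2n pnatr_eq0.
Qed.

Lemma prod_self s : uniq s ->
  \prod_(e <- s) \prod_(d <- s) q d e = (-1) ^+ (odd (size s) (+) edge_parity s).
Proof.
elim: s => [|c s IHs] /=; first by rewrite big_nil.
case/andP => cs us; rewrite big_cons.
under [X in _ * X]eq_bigr do rewrite big_cons.
rewrite big_split /= IHs // big_cons q_diag.
transitivity (- ((\prod_(d <- s) (q d c * q c d))
  * (-1) ^+ (odd (size s) (+) edge_parity s))); first by rewrite big_split /=; ring.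
rewrite prod_sign // -signr_addb -signrN; congr (_ ^+ _).
by case: (odd (count _ _)); case: (odd _); case: (edge_parity s).
Qed.

Lemma sign_cycle_infinite c0 s y z :
  let c := c0 :: s ++ [:: y; z] in
  uniq c -> odd_linked [:: c0] (rcons s y) ->
  odd (count (adj^~ z) (c0 :: s)) -> ~~ (odd (size c) (+) edge_parity c) ->
  arbitrarily_large_degrees.
Proof.
move=> c uc lc oz pc N; exists (size c * N)%N; first by rewrite leq_pmull.
have z_notin : z \notin c0 :: s.
  move: uc; rewrite /c -cat_cons cat_uniq => /and3P[_ /hasPn/(_ z) + _].
  by rewrite !inE eqxx orbT; apply.
apply: cycle_nonzero => //.
- move=> i j; have [->|/q_sign pij] := eqVneq i j.
    by rewrite q_diag oppr_eq0 oner_eq0.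
  by apply/eqP => q0; move/eqP: pij; rewrite q0 mul0r eq_sym signr_eq0.
- apply: linked_sign => //; move: uc; rewrite /c -cat_rcons -cat_cons cat_uniq.
  by case/and3P.
- rewrite prod_sign // oz.
  by apply/eqP; rewrite expr1 eq_sym -subr_eq0 opprK -mulr2n pnatr_eq0.
- by rewrite prod_self // (negPf pc).
Qed.

End Cycles.

Definition square_adj (x y : bool * bool) : bool := x.1 (+) y.1.

Lemma square_infinite (K : numFieldType) (q : bool * bool -> bool * bool -> K) :
  (forall x, q x x = -1) ->
  (forall x y, x != y -> q x y * q y x = (-1) ^+ square_adj x y) ->
  arbitrarily_large_degrees q.
Proof.
move=> qd qs; apply: (@sign_cycle_infinite _ _ _ square_adj qd qs
  (false, false) [:: (true, false)] (false, true) (true, true)) => //.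
Qed.

(** The connected double cover of a square: the two lifts of one of its edges
    are exchanged. *)
Definition octagon_adj (x y : bool * bool * bool) : bool :=
  (x.1.1 (+) y.1.1) && ~~ ((x.2 (+) y.2) (+)
    (((x.1 == (false, false)) && (y.1 == (true, true))) ||
     ((x.1 == (true, true)) && (y.1 == (false, false))))).

Lemma octagon_infinite (K : numFieldType)
    (q : bool * bool * bool -> bool * bool * bool -> K) :
  (forall x, q x x = -1) ->
  (forall x y, x != y -> q x y * q y x = (-1) ^+ octagon_adj x y) ->
  arbitrarily_large_degrees q.
Proof.
move=> qd qs; apply: (@sign_cycle_infinite _ _ _ octagon_adj qd qs
  (false, false, false)
  [:: (true, false, false); (false, true, false); (true, true, false);
      (false, false, true); (true, false, true)]
  (false, true, true) (true, true, true)) => //.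
Qed.

Section OnePoint.
Variables (K : numFieldType) (X : finType) (A : finGroupType) (sigma : X -> A).
Hypothesis abA : abelian [set: A].
Variables (q : X -> X -> K) (omega : A -> K).
Hypotheses (hq : forall i j, q i j != 0) (homega : is_character omega).
Local Notation V := (ext_space sigma abA hq homega).

(** The points (i, a) with i fixed span a braided subspace on which the braiding
    is q_ii times the flip. *)
Lemma one_point_infinite (J : finType) (pt : J -> A) i : injective pt ->
  arbitrarily_large_degrees (fun _ _ : J => q i i) -> nichols_infinite V.
Proof.
move=> pt_inj inf.
have kE (j l : J) (b : A) : (b * (kappa sigma i i)^-1)%g = b.
  by rewrite /kappa mulgV invg1 mulg1.
apply: (@fourier_infinite _ _ _ sigma abA q omega hq homega J (fun=> i)
  (fun j b => (b == pt j)%:R) (fun j b => (b == pt j)%:R) (fun _ _ => 1)).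
- by move=> j l b; rewrite kE // mul1r.
- move=> j l _; rewrite (bigD1 (pt j)) //= eqxx mul1r big1 ?addr0 => [|b /negPf->].
    by rewrite (inj_eq pt_inj).
  by rewrite mul0r.
- by move=> *; apply: oner_neq0.
rewrite (_ : eig_braiding _ _ _ = fun _ _ => q i i) //.
by do 2![apply/funext => ?]; rewrite /eig_braiding mulr1.
Qed.

Lemma exists_injection n : (n <= #|A|)%N -> exists pt : 'I_n -> A, injective pt.
Proof.
move=> nA; exists (fun k => enum_val (widen_ord nA k)) => // k l /enum_val_inj.
by move/(congr1 val) => /= /ord_inj.
Qed.

Lemma ord_gt3_infinite i : (1 < #|A|)%N -> ord_gt (q i i) 3 -> nichols_infinite V.
Proof.
move=> /exists_injection[pt pt_inj] /constant_nonzero[n n0 nz].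
apply: (@one_point_infinite bool (fun b => pt (inord b)) i) => [b c /pt_inj|N].
  by move/(congr1 val); rewrite /= !inordK; case: b; case: c.
by exists (n * N)%N; rewrite ?leq_pmull.
Qed.

Lemma ord3_infinite i :
  (2 < #|A|)%N -> 3.-primitive_root (q i i) -> nichols_infinite V.
Proof.
move=> /exists_injection[pt pt_inj] q3.
apply: (@one_point_infinite 'I_3 pt i) => // N.
exists (3 * N)%N; first by rewrite leq_pmull.
have q0 : q i i != 0 by apply: hq.
have qq1 : q i i * q i i <> 1.
  by move/eqP; rewrite -expr2 -(prim_order_dvd q3).
apply: (@cycle_nonzero _ _ (fun _ _ : 'I_3 => q i i) 0 [::] 1 ord_max) => //.
- by rewrite /= big_seq1.
- by rewrite big_seq1.
rewrite /= !(big_cons, big_nil) !mulr1 -!expr2.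
transitivity ((q i i ^+ 3) ^+ 3); first by ring.
by rewrite (prim_expr_order q3) expr1n.
Qed.

End OnePoint.

(** In a pair i, j of points with kappa_ij of order 2, diagonalizing the
    translation by kappa_ij on two of its orbits in A leads to a square. *)
Lemma order2_infinite (K : numFieldType) (X : finType) (A : finGroupType)
    (sigma : X -> A) (abA : abelian [set: A]) (q : X -> X -> K) (omega : A -> K)
    (hq : forall i j, q i j != 0) (homega : is_character omega) (i j : X) :
  (2 < #|A|)%N -> sigma i != sigma j -> (kappa sigma i j * kappa sigma i j = 1)%g ->
  q i i = -1 -> q j j = -1 -> (q i j * q j i) ^+ 2 = 1 ->
  nichols_infinite (ext_space sigma abA hq homega).
Proof.
move=> A3 sij kk qi qj p2; set k := kappa sigma i j in kk *.
have k1 : k != 1%g.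
  by apply: contra_neq sij => /(canRL (mulgKV _)); rewrite mul1g.
have [a ak1 ak] : exists2 a : A, a != 1%g & a != k.
  have := cardsC [set 1%g; k]; rewrite cards2 eq_sym k1 => cA.
  have : (0 < #|~: [set 1%g; k]|)%N by move: A3; rewrite -cA.
  by case/card_gt0P => a; rewrite !inE negb_or => /andP[? ?]; exists a.
pose pt (c : bool) : A := if c then a else 1%g.
pose p := q i j * q j i.
pose sgn (s : bool) : K := if s then - p else 1.
have sgn2 s : sgn s * sgn s = 1 by case: s; rewrite /sgn ?mulr1 // mulrNN -expr2.
pose iota (x : bool * bool) : X := if x.1 then j else i.
pose eig (x : bool * bool) (b : A) : K :=
  (b == pt x.2)%:R + sgn x.1 * (b == pt x.2 * k)%g%:R.
pose lam (x y : bool * bool) : K := if x.1 == y.1 then 1 else sgn y.1.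
have lam0 x y : lam x y != 0.
  rewrite /lam; case: ifP => _; rewrite ?oner_eq0 //.
  apply/eqP => s0; have := sgn2 y.1; rewrite s0 mul0r => /eqP.
  by rewrite eq_sym oner_eq0.
have eig_k y b : eig y (b * k)%g = sgn y.1 * eig y b.
  rewrite /eig (can_eq (mulgK k)) mulrDr mulrA sgn2 mul1r addrC; congr (_ + _%:R).
  by congr (nat_of_bool _); rewrite -(can_eq (mulgK k)) -mulgA kk mulg1.
have kV : (k^-1)%g = k by apply/eqP; rewrite eq_invg_mul kk.
have kap x y : x.1 != y.1 -> (kappa sigma (iota x) (iota y))^-1%g = k.
  have kji : kappa sigma j i = k by rewrite -kV /k /kappa invMg invgK.
  by rewrite /iota; case: x.1; case: y.1 => // _; rewrite ?kji kV.
apply: (@fourier_infinite _ _ _ sigma abA q omega hq homega _ iota eig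
  (fun x b => eig x b / 2%:R) lam) => //.
- move=> x y b; rewrite /lam; case: eqVneq => [E|ne]; last by rewrite kap // eig_k.
  by rewrite /iota E /kappa mulgV invg1 mulg1 mul1r.
- move=> [s c] [t d] E.
  have {E} Est : s = t.
    by move: E sij; rewrite /iota /=; case: s; case: t => // ->; rewrite eqxx.
  have sumD (F : A -> K) (x : A) : \sum_b (b == x)%:R * F b = F x.
    rewrite (bigD1 x) //= eqxx mul1r big1 ?addr0 // => b /negPf->.
    by rewrite mul0r.
  transitivity (eig (t, d) (pt c)).
    transitivity ((eig (t, d) (pt c) + sgn t * eig (t, d) (pt c * k)%g) / 2%:R).
      rewrite -(sumD _ (pt c)) -(sumD _ (pt c * k)%g) mulr_sumr -big_split mulr_suml /=.
      by apply: eq_bigr => b _; rewrite Est [eig (t, c) b]/eig /=; ring.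
    by rewrite eig_k mulrA sgn2; field.
  rewrite /eig Est xpair_eqE eqxx /=; case: (eqVneq c d) => [->|cd].
    rewrite eqxx -[X in X == _]mulg1 (can_eq (mulKg _)) eq_sym (negPf k1).
    by rewrite mulr0 addr0.
  have -> : (pt c == pt d) = false.
    by move: ak1 cd; rewrite /pt; case: c; case: d => // /negPf; rewrite // eq_sym.
  have -> : (pt c == pt d * k)%g = false; last by rewrite mulr0 addr0.
  move: cd; rewrite /pt; case: c; case: d => // _; first by rewrite mul1g (negPf ak).
  apply/negP => /eqP e; case/eqP: ak.
  by rewrite -[a]mulg1 -kk mulgA -e mul1g.
apply: square_infinite => [[s c]|[s c] [t d] ne].
  by rewrite /eig_braiding /lam eqxx mulr1 /iota; case: s.
rewrite /eig_braiding /lam /iota /square_adj /=; move: ne.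
have pp : q i j * q j i * (q i j * q j i) = 1 by rewrite -expr2.
case: s; case: t => _ //=; rewrite ?mulr1 ?qi ?qj ?mulrNN ?mulr1 //.
- by rewrite /sgn /p mulrN mulrCA mulrN; congr (- _); rewrite -pp; ring.
- by rewrite /sgn /p mulrN mulNr; congr (- _); rewrite -pp; ring.
Qed.

(** * Comparing braiding matrices *)

Section Relabel.
Variables (K : fieldType) (I J : eqType) (phi : I -> J) (q : J -> J -> K).
Hypothesis phi_inj : injective phi.

Lemma monomial_map w u :
  monomial q (map phi w) (map phi u) = monomial (fun i j => q (phi i) (phi j)) w u.
Proof.
elim: w u => [|i w IHw] u; first by rewrite !monomial_nil; case: u.
rewrite /= !monomial_cons !letterM_sum size_map; apply: eq_bigr => p _.
rewrite (nth_map i) // (inj_eq phi_inj) -map_take -map_drop -map_cat IHw.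
by rewrite big_map.
Qed.

End Relabel.

Section TwistEquivalence.
Variables (K : fieldType) (J : finType) (q q' : J -> J -> K).
Hypothesis q_neq0 : forall i j, q i j != 0.
Hypothesis q_diag : forall i, q' i i = q i i.
Hypothesis q_sym : forall i j, i != j -> q' i j * q' j i = q i j * q j i.

Let s i j := q' i j / q i j.

Let s_inv i j : s i j * s j i = 1.
Proof.
rewrite /s mulrACA -invfM; have [->|ij] := eqVneq i j.
  by rewrite q_diag divff ?mulf_neq0.
by rewrite q_sym // divff ?mulf_neq0.
Qed.

Let r i j := if (enum_rank i < enum_rank j)%N then s i j else 1.

Let r_swap i j : r j i = s j i * r i j.
Proof.
rewrite /r; have [ij|ji|/ord_inj/enum_rank_inj<-] := ltngtP (enum_rank i) (enum_rank j).
- by rewrite s_inv.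
- by rewrite mulr1.
by rewrite mulr1 /s q_diag divff.
Qed.

Let r_neq0 i j : r i j != 0.
Proof.
rewrite /r; case: ifP => _; rewrite ?oner_eq0 //.
apply/eqP => s0; have := s_inv i j; rewrite s0 mul0r => /eqP.
by rewrite eq_sym oner_eq0.
Qed.

(** Rescaling the words by the product of r over all pairs of their letters, in
    the order in which they occur, replaces the braiding matrix q by q'. *)
Fixpoint rescaling u : K :=
  if u is j :: u' then \prod_(k <- u') r j k * rescaling u' else 1.

Lemma rescaling_neq0 u : rescaling u != 0.
Proof.
elim: u => [|j u IHu] /=; first exact: oner_neq0.
by rewrite mulf_neq0 // prodf_seq_neq0; apply/allP => k _; rewrite r_neq0 implybT.
Qed.

Lemma rescaling_front i u v : rescaling (u ++ i :: v) =
  (\prod_(k <- u) s k i) * (\prod_(k <- u ++ v) r i k) * rescaling (u ++ v).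
Proof.
elim: u => [|j u IHu] /=; first by rewrite big_nil mul1r.
rewrite IHu !big_cat !big_cons /= big_cat /= (r_swap i j); ring.
Qed.

Lemma rescaling_monomial w u : perm_eq w u ->
  monomial q' w u * rescaling u = rescaling w * monomial q w u.
Proof.
elim: w u => [|i w IHw] u.
  by rewrite perm_sym => /perm_nilP->; rewrite !monomial_nil !qone_nil mulrC.
move=> pu; rewrite !monomial_cons !letterM_sum mulr_suml mulr_sumr.
apply: eq_bigr => p _; case: eqP => [up|_]; last by rewrite !mul0r mulr0.
rewrite !mul1r; set v := take p u ++ drop p.+1 u.
have Du : u = take p u ++ i :: drop p.+1 u.
  by rewrite -{1}(cat_take_drop p u) (drop_nth i) // up.
have pv : perm_eq w v.
  by move: pu; rewrite {1}Du perm_sym perm_catC /= perm_cons perm_catC perm_sym.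
rewrite [X in rescaling X]Du rescaling_front -/v [rescaling (i :: w)]/=.
rewrite [X in X * rescaling w](perm_big _ pv) /=.
transitivity (\prod_(k <- take p u) (q' i k * s k i) * \prod_(k <- v) r i k *
    (monomial q' w v * rescaling v)); first by rewrite [in RHS]big_split /=; ring.
have -> : \prod_(k <- take p u) (q' i k * s k i) = \prod_(k <- take p u) q i k.
  apply: eq_bigr => k _; rewrite /s mulrA.
  have [->|ki] := eqVneq k i; first by rewrite q_diag mulfK.
  by rewrite mulrC q_sym 1?eq_sym // mulrC mulfK.
by rewrite IHw //; ring.
Qed.

Lemma twist_monomial w u : monomial q w u != 0 -> monomial q' w u != 0.
Proof.
move=> wu; apply/eqP => z; have := rescaling_monomial (monomial_perm wu).
rewrite z mul0r => /esym/eqP; rewrite mulf_eq0 (negPf wu) orbF.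
exact/negP/rescaling_neq0.
Qed.

End TwistEquivalence.

(** Twist equivalent braidings have the same nonzero coefficients. *)
Lemma twist_nonzero_degree (K : numFieldType) (J : finType) (q q' : J -> J -> K) n :
  (forall i j, q i j != 0) -> (forall i, q' i i = q i i) ->
  (forall i j, i != j -> q' i j * q' j i = q i j * q j i) ->
  nonzero_degree q n -> nonzero_degree q' n.
Proof.
move=> q0 qd qs [w sw [u wu]]; exists w => //; exists u.
exact: twist_monomial wu.
Qed.

(** A function of the letters in c and of the remaining letters separately. *)
Definition filter_mul (K : fieldType) (J : eqType) (q : J -> J -> K) (c : pred J)
    (f g : qshuffle q) : qshuffle q :=
  fun u => f (filter c u) * g (filter (predC c) u).

Section TwoComponents.
Variables (K : fieldType) (J : eqType) (q : J -> J -> K).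

Lemma letterM_filter (c : pred J) i (f g : qshuffle q) :
  (forall i j, c i != c j -> q i j = 1) -> c i ->
  letter q i * filter_mul c f g = filter_mul c (letter q i * f) g.
Proof.
move=> q1 ci; apply/funext => u; elim: u f g => [|j u IHu] f g.
  by rewrite /filter_mul !letterM_nil mul0r.
rewrite letterM_cons [RHS]/filter_mul; case: (boolP (c j)) => cj.
  have -> : qder j (filter_mul c f g) = filter_mul c (qder j f) g.
    by apply/funext => v; rewrite /qder /filter_mul /= cj.
  have -> : filter c (j :: u) = j :: filter c u by rewrite /= cj.
  have -> : filter (predC c) (j :: u) = filter (predC c) u by rewrite /= cj.
  by rewrite IHu letterM_cons /filter_mul; ring.
have -> : qder j (filter_mul c f g) = filter_mul c f (qder j g).
  by apply/funext => v; rewrite /qder /filter_mul /= (negPf cj).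
have -> : filter c (j :: u) = filter c u by rewrite /= (negPf cj).
have -> : filter (predC c) (j :: u) = j :: filter (predC c) u.
  by rewrite /= (negPf cj).
rewrite IHu q1 ?ci ?(negPf cj) //; have -> : (i == j) = false.
  by apply: contraNF cj => /eqP <-.
by rewrite mul0r mul1r add0r.
Qed.

Lemma filter_mulC c (f g : qshuffle q) :
  filter_mul (predC c) g f = filter_mul c f g.
Proof.
apply/funext => u; rewrite /filter_mul mulrC; congr (f _ * _).
by apply: eq_filter => j /=; rewrite negbK.
Qed.

(** Between letters with trivial braiding nothing is lost by sorting: the letters
    inside c and those outside are shuffled independently. *)
Lemma monomial_filter c w : (forall i j, c i != c j -> q i j = 1) ->
  monomial q w =
  filter_mul c (monomial q (filter c w)) (monomial q (filter (predC c) w)).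
Proof.
move=> q1; elim: w => [|i w IHw].
  apply/funext => u; rewrite !monomial_nil /filter_mul; elim: u => [|j u IHu] /=.
    by rewrite mulr1.
  by case: (c j); rewrite /= ?qone_nil ?mul0r ?mulr0.
rewrite monomial_cons IHw /=; case: (boolP (c i)) => ci /=.
  by rewrite letterM_filter // monomial_cons.
rewrite -filter_mulC letterM_filter //.
  by rewrite filter_mulC monomial_cons.
move=> k l kl; apply: q1; apply: contra_neq kl => /= ->; by [].
Qed.

End TwoComponents.

(** * Groups of order 2 *)


(** The simply laced star with center 0 and k leaves, all vertices with q = -1. *)
Definition star_braiding (K : fieldType) k (a b : 'I_k.+1) : K :=
  if (a == b) || (a == ord0) then -1 else 1.

Section Star.
Variable K : numFieldType.

Lemma star_braiding_neq0 k (a b : 'I_k.+1) : star_braiding K a b != 0.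
Proof. by rewrite /star_braiding; case: ifP; rewrite ?oppr_eq0 oner_eq0. Qed.

Lemma star_braiding_diag k (a : 'I_k.+1) : star_braiding K a a = -1.
Proof. by rewrite /star_braiding eqxx. Qed.

Lemma star_braiding_pair k (a b : 'I_k.+1) : a != b ->
  star_braiding K a b * star_braiding K b a = (-1) ^+ ((a == ord0) || (b == ord0)).
Proof.
move=> ab; rewrite /star_braiding [b == a]eq_sym (negPf ab) /=.
case: (eqVneq a ord0) (eqVneq b ord0) => [Ea|na] [Eb|nb] /=.
- by rewrite Ea Eb eqxx in ab.
- by rewrite mulr1.
- by rewrite mul1r.
by rewrite mulr1.
Qed.

Lemma star_sign_exponents k :
  sign_exponents (@star_braiding K k) (fun a b => star_cartan k a b).
Proof.
move=> a b ab; rewrite star_braiding_pair // mxE (negPf ab).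
by case: ifP => _; split; rewrite ?expr0z ?exprN1 ?invrN1; auto.
Qed.

Lemma star_conjectureD k : conjectureD K ->
  (k = 3 -> nichols_finite (diagonal_space (@star_braiding_neq0 k))) /\
  (k = 4 -> nichols_infinite (diagonal_space (@star_braiding_neq0 k))).
Proof.
move=> D; pose M a b := star_cartan k a b.
have sgn (a b : 'I_k.+1) : star_braiding K a b = 1 \/ star_braiding K a b = -1.
  by rewrite /star_braiding; case: ifP; auto.
have M2 a : M a a = 2 by rewrite /M mxE eqxx.
have [D4 D5] := D _ _ (@star_braiding_neq0 k) M (@star_braiding_diag k) sgn
  (@star_sign_exponents k) M2.
split=> Ek; subst k.
  by exists (2 ^ 12)%N; apply: D4; exists id => //; exists id.
by apply: D5; exists id => //; exists id.
Qed.

End Star.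

Section CardTwo.
Variables (K : numFieldType) (X : finType) (A : finGroupType) (sigma : X -> A).
Hypotheses (abA : abelian [set: A]) (A2 : #|A| = 2%N).
Variables (q : X -> X -> K) (omega : A -> K).
Hypotheses (hq : forall i j, q i j != 0) (homega : is_character omega).
Local Notation V := (ext_space sigma abA hq homega).

Definition sign_char (b : A) : K := if b == 1%g then 1 else -1.

Lemma card2_nontrivial : exists2 c : A, c != 1%g & forall b, b != 1%g -> b = c.
Proof.
have : #|[set~ (1 : A)%g]| = 1%N by have := cardsC1 (1 : A)%g; rewrite A2.
move/eqP/cards1P => [c Ec]; have inC b : (b != 1%g) = (b == c).
  by have := in_set1 b c; rewrite -Ec !inE.
by exists c => [|b]; rewrite inC // => /eqP.
Qed.

Lemma sign_charM a b : sign_char (a * b)%g = sign_char a * sign_char b.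
Proof.
have [c c1 cP] := card2_nontrivial.
have cc : (c * c = 1)%g.
  apply/eqP/negPn/negP => /cP; rewrite -[X in _ = X]mulg1 => /mulgI c1'.
  by rewrite c1' eqxx in c1.
rewrite /sign_char; have [->|/cP->] := eqVneq a 1%g.
  by rewrite mul1g mul1r.
have [->|/cP->] := eqVneq b 1%g; first by rewrite mulg1 (negPf c1) mulr1.
by rewrite cc eqxx mulrNN mulr1.
Qed.

Lemma kappaV_eq1 i j : ((kappa sigma i j)^-1 == 1)%g = (sigma i == sigma j).
Proof. by rewrite invg_eq1 /kappa -eq_mulgV1. Qed.

Section Letters.
Variables (J : finType) (iota : J -> X) (eps : J -> bool).

Definition c2_eig (j : J) (b : A) : K := if eps j then sign_char b else 1.
Definition c2_lam (j l : J) : K :=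
  if eps l && (sigma (iota j) != sigma (iota l)) then -1 else 1.
Definition c2_braiding : J -> J -> K := eig_braiding q iota c2_lam.

Lemma c2_lam_neq0 j l : c2_lam j l != 0.
Proof. by rewrite /c2_lam; case: ifP; rewrite ?oppr_eq0 oner_eq0. Qed.

Lemma c2_eigP j l b :
  c2_eig l (b * (kappa sigma (iota j) (iota l))^-1)%g = c2_lam j l * c2_eig l b.
Proof.
rewrite /c2_eig /c2_lam; case: (eps l) => /=; last by rewrite mulr1.
by rewrite sign_charM {2}/sign_char kappaV_eq1 mulrC; case: eqP.
Qed.

Hypothesis letter_inj : injective (fun j => (iota j, eps j)).

Lemma c2_dualP j l : iota j = iota l ->
  \sum_b (c2_eig j b / 2%:R) * c2_eig l b = (j == l)%:R.
Proof.
have [c c1 cP] := card2_nontrivial => E.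
rewrite (bigD1 1%g) //= (bigD1 c) //= big1 ?addr0; last first.
  by move=> b /andP[/cP->]; rewrite eqxx.
have jl : (j == l) = (eps j == eps l).
  by rewrite -(inj_eq letter_inj) xpair_eqE E eqxx.
rewrite jl /c2_eig /sign_char eqxx (negPf c1).
by case: (eps j); case: (eps l) => /=; field.
Qed.

Lemma c2_infinite : arbitrarily_large_degrees c2_braiding -> nichols_infinite V.
Proof.
move=> inf; apply: (@fourier_infinite _ _ _ sigma abA q omega hq homega J iota
  c2_eig (fun j b => c2_eig j b / 2%:R) c2_lam) => //.
- exact: c2_eigP.
- exact: c2_dualP.
exact: c2_lam_neq0.
Qed.

Lemma c2_degree_dim n : #|J| = #|{: X * A}| -> nichols_degree_dim V n =
  nichols_degree_dim (diagonal_space (eig_braiding_neq0 hq iota c2_lam_neq0)) n.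
Proof.
apply: (@fourier_degree_dim _ _ _ sigma abA q omega hq homega J iota
  c2_eig (fun j b => c2_eig j b / 2%:R) c2_lam).
- exact: c2_eigP.
exact: c2_dualP.
Qed.

End Letters.

Definition edge i j : bool := q i j * q j i == -1.

Hypothesis q_diag : forall i, q i i = -1.
Hypothesis q_sign : forall i j, i != j -> q i j * q j i = 1 \/ q i j * q j i = -1.

Lemma q_edge i j : i != j -> q i j * q j i = (-1) ^+ edge i j.
Proof.
move=> /q_sign[] E; rewrite /edge E ?eqxx //.
by rewrite -subr_eq0 opprK -mulr2n pnatr_eq0.
Qed.

Lemma edgeC i j : edge i j = edge j i.
Proof. by rewrite /edge mulrC. Qed.

Definition c2_edge (J : finType) (iota : J -> X) (eps : J -> bool) j l : bool :=
  (iota j != iota l) && (edge (iota j) (iota l) (+)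
    ((sigma (iota j) != sigma (iota l)) && (eps j (+) eps l))).

Lemma c2_braiding_diag (J : finType) (iota : J -> X) (eps : J -> bool) j :
  c2_braiding iota eps j j = -1.
Proof.
by rewrite /c2_braiding /eig_braiding /c2_lam eqxx andbF mulr1 q_diag.
Qed.

Lemma c2_braiding_pair (J : finType) (iota : J -> X) (eps : J -> bool) j l :
  c2_braiding iota eps j l * c2_braiding iota eps l j = (-1) ^+ c2_edge iota eps j l.
Proof.
rewrite /c2_braiding /eig_braiding /c2_edge /c2_lam mulrACA.
have [E|ne] /= := eqVneq (iota j) (iota l).
  by rewrite E q_diag eqxx !andbF !mulrNN !mulr1.
rewrite q_edge // signr_addb; congr (_ * _); rewrite [sigma (iota l) == _]eq_sym.
by case: (_ == _); case: (eps j); case: (eps l);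
  rewrite /= ?mulrNN ?mulr1 ?mul1r.
Qed.

(** Points on the same side do not act on each other, so that all lifts of i are
    linked to all lifts of j. *)
Lemma same_side_infinite i j : i != j -> sigma i = sigma j -> edge i j ->
  nichols_infinite V.
Proof.
move=> ij sij eij; pose iota (x : bool * bool) := if x.1 then j else i.
apply: (@c2_infinite _ iota snd) => [[s e] [t f]|].
  rewrite /iota; case: s; case: t => /= -[] // E; rewrite ?E ?eqxx // in ij *;
  by move=> ->.
apply: square_infinite => [x|x y _]; first exact: c2_braiding_diag.
rewrite c2_braiding_pair; congr (_ ^+ nat_of_bool _).
rewrite /c2_edge /square_adj /iota; case: x.1; case: y.1 => /=;
  rewrite ?eqxx ?sij ?eqxx ?addbF ?(negPf ij) // ?ij ?eij //.
by rewrite eq_sym ij edgeC.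
Qed.

(** The letters over a square i, j, i', j' form a double cover of this square;
    base chooses lifts that are linked along the path i, j, i', j'. *)
Lemma two_sides_infinite (pt : bool * bool -> X) : injective pt ->
  (forall x y, (sigma (pt x) == sigma (pt y)) = (x.1 == y.1)) ->
  (forall x y, x.1 = y.1 -> edge (pt x) (pt y) = false) ->
  nichols_infinite V.
Proof.
move=> pt_inj pts pt0.
pose i := pt (false, false); pose j := pt (true, false).
pose i' := pt (false, true); pose j' := pt (true, true).
pose bj := ~~ edge i j; pose bi' := ~~ (edge i' j (+) bj).
pose bj' := ~~ (edge i' j' (+) bi').
pose base (x : bool * bool) :=
  if x.1 then (if x.2 then bj' else bj) else (if x.2 then bi' else false).
have [closed|open] := boolP (edge i j' (+) bj').
  apply: (@c2_infinite _ pt base) => [x y [E _]|]; first exact: pt_inj.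
  apply: square_infinite => [x|x y xy]; first exact: c2_braiding_diag.
  rewrite c2_braiding_pair; congr (_ ^+ nat_of_bool _).
  rewrite /c2_edge (inj_eq pt_inj) xy pts /square_adj /=.
  have [E|ne] := eqVneq x.1 y.1; first by rewrite pt0 //= E; case: y.1.
  move: xy ne; case: x => [[] []]; case: y => [[] []] //= _ _;
    rewrite /base /= -/i -/j -/i' -/j' ?[edge j _]edgeC ?[edge j' _]edgeC;
    move: closed; rewrite /bj' /bi' /bj; case: (edge i j); case: (edge i' j);
    by case: (edge i' j'); case: (edge i j').
apply: (@c2_infinite _ (fun x : bool * bool * bool => pt x.1)
  (fun x => x.2 (+) base x.1)).
  move=> [x e] [y f] /= [/pt_inj <- /addIb ->]; by [].
apply: octagon_infinite => [x|x y xy]; first exact: c2_braiding_diag.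
rewrite c2_braiding_pair; congr (_ ^+ nat_of_bool _).
rewrite /c2_edge (inj_eq pt_inj) pts /octagon_adj.
case: x y {xy} => [x e] [y f]; rewrite [(x, e).1]/= [(y, f).1]/=.
have [E|ne] := eqVneq x.1 y.1; first by rewrite pt0 // E andbF addbb.
have -> : x != y by apply: contraNneq ne => ->.
have {ne} : x.1 != y.1 by [].
case: x => [[] []]; case: y => [[] []] //= _;
  rewrite /base /= -/i -/j -/i' -/j' ?[edge j _]edgeC ?[edge j' _]edgeC;
  move: open; rewrite /bj' /bi' /bj; case: (edge i j); case: (edge i' j);
  by case: (edge i' j'); case: (edge i j'); case: e; case: f.
Qed.

(** A center i linked to at least four leaves, each through exactly one of its
    two lifts. *)
Lemma star_infinite i (L : {set X}) : conjectureD K -> (3 < #|L|)%N ->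
  (forall j, j \in L -> sigma i != sigma j) ->
  (forall j k, j \in L -> k \in L -> edge j k = false) ->
  (forall j k, j \in L -> k \in L -> sigma j = sigma k) ->
  nichols_infinite V.
Proof.
move=> D L4 iL LL sL.
pose f (k : 'I_4) : X := enum_val (widen_ord L4 k).
have fL k : f k \in L by apply: enum_valP.
have f_inj : injective f.
  by move=> k l /enum_val_inj /(congr1 val) /= /ord_inj.
have fi k : f k != i.
  by apply: contraTneq (fL k) => ->; apply/negP => /iL; rewrite eqxx.
pose iota (a : 'I_5) := if unlift ord0 a is Some k then f k else i.
pose eps (a : 'I_5) := if unlift ord0 a is Some k then ~~ edge i (f k) else false.
have iota_inj : injective iota.
  move=> a b; rewrite /iota; case: unliftP => [k|] ->; case: unliftP => [l|] -> //.
  - by move/f_inj->.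
  - by move/eqP; rewrite (negPf (fi k)).
  by move/eqP; rewrite eq_sym (negPf (fi l)).
apply: (@c2_infinite _ iota eps) => [a b [/iota_inj]|N] //.
have [_ inf] := star_conjectureD 4 D.
have [n Nn] := nichols_infinite_symmetrizer N (inf erefl).
move/diagonal_symmetrizer_neq0 => star_n; exists n.+1; first exact: leqW.
apply: twist_nonzero_degree star_n => [a b|a|a b ab].
- exact: star_braiding_neq0.
- by rewrite c2_braiding_diag star_braiding_diag.
rewrite c2_braiding_pair star_braiding_pair //; congr (_ ^+ nat_of_bool _).
rewrite /c2_edge (inj_eq iota_inj) ab /iota /eps.
move: ab; case: unliftP => [k|] ->; case: unliftP => [l|] -> ab.
- by rewrite LL // (sL _ _ (fL k) (fL l)) eqxx.
- by rewrite edgeC [sigma _ == _]eq_sym iL //=; case: (edge _ _).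
- by rewrite iL //=; case: (edge _ _).
by rewrite eqxx in ab.
Qed.

(** For a center i with at most three leaves, the letters decompose into two
    copies of a star between which the braiding is trivial: copy b consists of
    the letters (j, lift b j).  Hence a word with a nonzero coefficient has few
    letters in each copy. *)
Lemma star_finite i : conjectureD K -> (#|X| <= 4)%N ->
  (forall j, j != i -> sigma i != sigma j) ->
  (forall j k, j != i -> k != i -> edge j k = false) ->
  (forall j k, j != i -> k != i -> sigma j = sigma k) ->
  nichols_finite V.
Proof.
move=> D X4 iL LL sL.
pose Q := @c2_braiding _ (fun x : X * bool => x.1) snd.
pose lift b j := b (+) ((j != i) && ~~ edge i j).
pose copy (x : X * bool) := lift x.2 x.1.
have liftK b j : lift (lift b j) j = b by rewrite /lift -addbA addbb addbF.
pose Q0 x y := if copy x != copy y then 1 else Q x y.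
have Q_neq0 x y : Q x y != 0 by apply/mulf_neq0/c2_lam_neq0.
have Q_pair x y : Q x y * Q y x = (-1) ^+ c2_edge (fun x : X * bool => x.1) snd x y.
  exact: c2_braiding_pair.
have cross x y : copy x != copy y -> Q x y * Q y x = 1.
  rewrite Q_pair /c2_edge /copy /lift; case: x y => [j e] [k f] /=.
  have [->|jk] //= := eqVneq j k; have [ji|ji] /= := eqVneq j i.
    subst j; rewrite iL 1?eq_sym // [k == i]eq_sym (negPf jk) /=.
    by case: (edge i k); case: e; case: f.
  have [ki|ki] /= := eqVneq k i.
    subst k; rewrite [sigma j == _]eq_sym iL // edgeC.
    by case: (edge j i); case: e; case: f.
  by rewrite (LL j k) // (sL j k) // eqxx.
have [phi phi_inj phi_i] : exists2 phi : X -> 'I_4, injective phi & phi i = ord0.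
  pose g x := widen_ord X4 (enum_rank x).
  have g_inj : injective g.
    by move=> x y /(congr1 val) /= /ord_inj /enum_rank_inj.
  exists (fun x => tperm (g i) ord0 (g x)); last by rewrite tpermL.
  by move=> x y /perm_inj /g_inj.
pose psi b (x : X) : X * bool := (x, lift b x).
have psi_inj b : injective (psi b) by move=> x y [].
have star_edge b x y : x != y ->
    c2_edge (fun x : X * bool => x.1) snd (psi b x) (psi b y) = (x == i) || (y == i).
  move=> xy; rewrite /c2_edge /psi /lift /= xy /=.
  have [xi|xi] /= := eqVneq x i.
    subst x; rewrite [y == i]eq_sym (negPf xy) iL 1?eq_sym //=.
    by case: (edge i y); case: b.
  have [yi|yi] /= := eqVneq y i.
    subst y; rewrite [sigma x == _]eq_sym iL // edgeC.
    by case: (edge i x); case: b.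
  by rewrite (LL x y) // (sL x y) // eqxx.
have [N N0] : exists N, forall b (w u : seq X),
    monomial (fun x y => Q (psi b x) (psi b y)) w u != 0 -> (size w <= N)%N.
  have [d [N [z _]]] := (star_conjectureD 3 D).1 erefl.
  exists N => b w u wu; rewrite leqNgt; apply/negP => Nw.
  have star_w : monomial (fun x y => star_braiding K (phi x) (phi y)) w u != 0.
    apply: twist_monomial wu => [x y|x|x y xy]; first exact: Q_neq0.
      by rewrite star_braiding_diag [RHS]c2_braiding_diag.
    rewrite star_braiding_pair ?(inj_eq phi_inj) // Q_pair star_edge //.
    by rewrite -phi_i !(inj_eq phi_inj).
  have [m Dm] : exists m, size w = m.+1 by exists (size w).-1; lia.
  have : nonzero_degree (@star_braiding K 3) m.+1.
    exists (map phi w); first by rewrite size_map.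
    by exists (map phi u); rewrite monomial_map.
  move/(diagonal_symmetrizer_neq0 (@star_braiding_neq0 K 3)).
  by rewrite -nichols_degree_dim_eq0 z // -Dm ltnW.
have copyE b (s : seq (X * bool)) : all (fun x => copy x == b) s ->
    s = map (psi b) (map fst s).
  elim: s => [|[x e] s IHs] //= /andP[/eqP cx /IHs e1].
  by rewrite -e1 -cx /psi /copy liftK.
have copy_size b w u : all (fun x => copy x == b) w -> monomial Q0 w u != 0 ->
    (size w <= N)%N.
  move=> bw wu; have bu : all (fun x => copy x == b) u.
    by rewrite -(perm_all _ (monomial_perm wu)).
  move: wu; rewrite (copyE b w) // (copyE b u) // monomial_map //.
  have -> : (fun x y => Q0 (psi b x) (psi b y)) = fun x y => Q (psi b x) (psi b y).
    do 2![apply/funext => ?]; rewrite /Q0 /copy /= !liftK.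
    by rewrite eqxx.
  by move/N0; rewrite !size_map.
exists (\sum_(n < (N + N).+1) nichols_degree_dim V n)%N, (N + N).+1; split=> //.
case=> // m Nm; rewrite (@c2_degree_dim _ (fun x : X * bool => x.1) snd); first last.
- by rewrite !card_prod card_bool A2.
- by move=> [x e] [y f] [-> ->].
apply/eqP; rewrite nichols_degree_dim_eq0; apply/negPn/negP.
move/diagonal_symmetrizer_neq0 => [w sw [u wu]].
have {wu} : monomial Q0 w u != 0.
  apply: twist_monomial wu => [//|x|x y _]; first by rewrite /Q0 eqxx.
  rewrite /Q0 [copy y == _]eq_sym; case: eqVneq => // /cross ->.
  by rewrite mulr1.
rewrite (@monomial_filter _ _ _ copy w) => [|x y cxy]; last first.
  by rewrite /Q0 cxy.
rewrite /filter_mul mulf_eq0 => /norP[wt wf].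
have : (size (filter copy w) <= N)%N.
  by apply: (copy_size true) wt; apply/allP => x; rewrite mem_filter => /andP[->].
have : (size (filter (predC copy) w) <= N)%N.
  apply: (copy_size false) wf; apply/allP => x; rewrite mem_filter /= => /andP[].
  by rewrite -eqbF_neg.
have := count_predC copy w; rewrite -!size_filter sw.
by lia.
Qed.

End CardTwo.

(** * Freeness over a subalgebra of type A2 *)

(** D maps U onto the kernel of D ^ 2, and the latter onto the kernel of D:
    v = D (X v - (x / (1 + x)) X (X (D v))) if D ^ 2 kills v, and v = D (X v) if
    D kills v. *)
Lemma weyl_dim (K : fieldType) (vT : vectType K) (U : {vspace vT})
    (X D : 'End(vT)) (x : K) : 1 + x != 0 ->
  (forall u, u \in U -> D u \in U) -> (forall u, u \in U -> X u \in U) ->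
  (forall u, u \in U -> D (X u) = u + x *: X (D u)) ->
  (forall u, u \in U -> D (D (D u)) = 0) ->
  \dim U = (3 * \dim (U :&: lker D))%N.
Proof.
move=> x1 DU XU DX D3; set kD := (U :&: lker D)%VS.
pose U2 := (U :&: lker (D \o D))%VS.
have inU2 v : (v \in U2) = (v \in U) && (D (D v) == 0).
  by rewrite memv_cap memv_ker lfunE.
have inkD v : (v \in kD) = (v \in U) && (D v == 0).
  by rewrite memv_cap memv_ker.
have imU : (D @: U = U2)%VS.
  apply/eqP; rewrite eqEsubv; apply/andP; split; apply/subvP => v.
    by case/memv_imgP => u uU ->; rewrite inU2 DU //= D3.
  rewrite inU2 => /andP[vU /eqP D2].
  have -> : v = D (X v - (x / (1 + x)) *: X (X (D v))).
    have -> : D (X v - (x / (1 + x)) *: X (X (D v))) =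
        D (X v) - (x / (1 + x)) *: D (X (X (D v))) by rewrite linearB linearZ.
    have -> : D (X (X (D v))) = (1 + x) *: X (D v).
      rewrite DX ?XU ?DU // DX ?DU // D2 linear0 scaler0 addr0.
      by rewrite scalerDl scale1r.
    by rewrite DX // scalerA divfK // addrK.
  by rewrite memv_img // rpredB ?rpredZ ?XU ?DU.
have imU2 : (D @: U2 = kD)%VS.
  apply/eqP; rewrite eqEsubv; apply/andP; split; apply/subvP => v.
    by case/memv_imgP => u; rewrite inU2 => /andP[uU D2] ->; rewrite inkD DU.
  rewrite inkD => /andP[vU /eqP D1].
  have DXv : D (X v) = v by rewrite DX // D1 linear0 scaler0 addr0.
  by rewrite -DXv memv_img // inU2 XU //= DXv D1.
have kerU2 : (U2 :&: lker D = kD)%VS.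
  apply/eqP; rewrite eqEsubv; apply/andP; split; apply/subvP => v.
    by rewrite memv_cap memv_ker inU2 inkD => /andP[/andP[->]].
  rewrite memv_cap memv_ker inU2 inkD => /andP[-> /eqP->].
  by rewrite linear0 eqxx.
rewrite -(limg_ker_dim D U) -/kD imU -(limg_ker_dim D U2) imU2 kerU2.
by lia.
Qed.

Section SubalgebraSpan.
Variables (K : fieldType) (J : finType) (q : J -> J -> K).
Local Notation F := (qshuffle q).
Implicit Types (f g : F) (u w : seq J).

Inductive subalgebra : F -> Prop :=
| subalgebra1 : subalgebra 1
| subalgebraL a f g : subalgebra f -> subalgebra g -> subalgebra (a *: f + g)
| subalgebra_letterM i f : subalgebra f -> subalgebra (letter q i * f).

Lemma subalgebra0 : subalgebra 0.
Proof.
have := subalgebraL (-1) subalgebra1 subalgebra1.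
by rewrite scaleN1r addNr.
Qed.

Lemma subalgebraZ a f : subalgebra f -> subalgebra (a *: f).
Proof.
by move=> fs; rewrite -[_ *: _]addr0; apply: subalgebraL => //; apply: subalgebra0.
Qed.


Lemma subalgebraM f g : subalgebra f -> subalgebra g -> subalgebra (f * g).
Proof.
move=> fs gs; elim: fs => [|a f1 f2 _ IH1 _ IH2|i f1 _ IH1].
- by rewrite mul1r.
- by rewrite mulrDl -scalerAl; apply: subalgebraL.
by rewrite -mulrA; apply: subalgebra_letterM.
Qed.

Lemma subalgebra_letter i : subalgebra (letter q i).
Proof. by rewrite -[letter q i]mulr1; do 2!constructor. Qed.

Lemma subalgebra_qder j f : subalgebra f -> subalgebra (qder j f).
Proof.
elim=> [|a f1 f2 _ IH1 _ IH2|i f1 s1 IH1].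
- by rewrite qder1; apply: subalgebra0.
- by rewrite qderD qderZ; apply: subalgebraL.
rewrite qder_letterM; apply: subalgebraL => //.
by apply/subalgebraZ/subalgebra_letterM.
Qed.

Lemma subalgebra_monomial w : subalgebra (monomial q w).
Proof.
elim: w => [|i w IHw]; first by rewrite monomial_nil; constructor.
by rewrite monomial_cons; constructor.
Qed.

Lemma subalgebraP f : subalgebra f ->
  exists l : seq (K * seq J), f = \sum_(p <- l) p.1 *: monomial q p.2.
Proof.
elim=> [|a f1 f2 _ [l1 ->] _ [l2 ->]|i f1 _ [l ->]].
- by exists [:: (1, [::])]; rewrite big_seq1 scale1r monomial_nil.
- exists ([seq (a * p.1, p.2) | p <- l1] ++ l2).
  rewrite big_cat big_map scaler_sumr; congr (_ + _).
  by apply: eq_bigr => p _; rewrite scalerA.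
exists [seq (p.1, i :: p.2) | p <- l].
rewrite big_map mulr_sumr; apply: eq_bigr => p _.
by rewrite -scalerAr monomial_cons.
Qed.

(** The commutation rules of a degree 2 operator E, the Serre relations between
    D a and D b, and their consequence E ^ 3 = 0: all are proved by letting
    the operators pass the letters of a monomial one at a time. *)
Variables (a b : J) (x : K).
Hypotheses (ab : a != b) (qaa : q a a = x) (qab : q a b = x) (qba : q b a = x)
  (qbb : q b b = x) (x3 : 1 + x + x ^+ 2 = 0).

Section Operators.

(** D stands for qder; keeping it abstract prevents the rewriting below from
    unfolding derivatives of products. *)
Variable D : J -> F -> F.
Hypotheses (derD : forall j f g, D j (f + g) = D j f + D j g)
  (derZ : forall j c f, D j (c *: f) = c *: D j f)
  (der1 : forall j, D j 1 = 0)
  (derL : forall i j f, D j (letter q i * f) =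
     (i == j)%:R *: f + q i j *: (letter q i * D j f))
  (derS : forall j f, subalgebra f -> subalgebra (D j f)).

Let der0 j : D j 0 = 0.
Proof. by have := derZ j 0 0; rewrite !scale0r. Qed.

Lemma qfunP f g : (forall u, f u = g u :> K) -> f = g.
Proof. by move=> fg; apply/funext. Qed.

(* Replace the values at the word u by variables of the field. *)
Local Ltac abstract_values u :=
  repeat match goal with |- context [?f u] =>
    lazymatch type of (f u) with
    | bool => fail
    | _ => let y := fresh "y" in move: (f u : K) => y
    end
  end.

Variable der2 : F -> F.
Hypothesis der2E : forall f, der2 f = D a (D b f) - x *: D b (D a f).

Lemma der2D f g : der2 (f + g) = der2 f + der2 g.
Proof. by apply/funext => u; rewrite !der2E !(derD, derZ) !qfunE; ring. Qed.

Lemma der2Z c f : der2 (c *: f) = c *: der2 f.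
Proof. by apply/funext => u; rewrite !der2E !(derD, derZ) !qfunE; ring. Qed.

Lemma der2L i f : der2 (letter q i * f) =
  (q i a * q i b) *: (letter q i * der2 f)
  + ((i == b)%:R * (1 - x ^+ 2)) *: D a f.
Proof.
rewrite !der2E !(derL, derD, derZ) mulrBr -scalerAr.
apply: qfunP => u; rewrite !qfunE; abstract_values u.
have [->|ia] := eqVneq i a; first by rewrite (negPf ab) qaa qab /=; ring.
by have [->|ib] := eqVneq i b; rewrite ?qba ?qbb /=; ring.
Qed.

Let xx : x ^+ 2 = - 1 - x.
Proof. by apply/eqP; rewrite -subr_eq0 -x3; apply/eqP; ring. Qed.

Lemma der_cubed c f : q c c = x -> subalgebra f -> D c (D c (D c f)) = 0.
Proof.
move=> qcc; elim=> [|k f1 f2 _ IH1 _ IH2|i f1 _ IH]; first by rewrite der1 !der0.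
  by rewrite !(derD, derZ) IH1 IH2 scaler0 addr0.
rewrite !(derL, derD, derZ) IH mulr0 !scaler0 addr0.
apply: qfunP => u; rewrite !qfunE; abstract_values u.
have [->|ic] := eqVneq i c; rewrite ?qcc /=.
  by ring: xx.
by ring.
Qed.

(** The quantum Serre relations. *)
Lemma der2_a f : subalgebra f -> der2 (D a f) = x *: D a (der2 f).
Proof.
elim=> [|k f1 f2 _ IH1 _ IH2|i f1 _ IH].
- by rewrite !der2E !(der1, der0) !scaler0 subr0 der0 scaler0.
- by rewrite !(derD, derZ, der2D, der2Z, IH1, IH2) scalerDr !scalerA mulrC.
rewrite !(derL, derD, derZ, der2D, der2Z, der2L) IH -scalerAr.
apply: qfunP => u; rewrite !qfunE; abstract_values u.
have [->|ia] := eqVneq i a; first by rewrite (negPf ab) qaa qab /=; ring: xx.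
by have [->|ib] := eqVneq i b; rewrite ?qba ?qbb /=; ring: xx.
Qed.

Lemma der2_b f : subalgebra f ->
  der2 (D b f) = x ^+ 2 *: D b (der2 f).
Proof.
elim=> [|k f1 f2 _ IH1 _ IH2|i f1 _ IH].
- by rewrite !der2E !(der1, der0) !scaler0 subr0 der0 scaler0.
- by rewrite !(derD, derZ, der2D, der2Z, IH1, IH2) scalerDr !scalerA mulrC.
rewrite !(derL, derD, derZ, der2D, der2Z, der2L) IH -scalerAr (der2E f1).
apply: qfunP => u; rewrite !qfunE; abstract_values u.
have [->|ia] := eqVneq i a; first by rewrite (negPf ab) qaa qab /=; ring: xx.
by have [->|ib] := eqVneq i b; rewrite ?qba ?qbb /=; ring: xx.
Qed.

Lemma der2_cubed f : subalgebra f -> der2 (der2 (der2 f)) = 0.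
Proof.
elim=> [|k f1 f2 _ IH1 _ IH2|i f1 sf1 IH].
- have E0 : der2 0 = 0 by have := der2Z 0 0; rewrite !scale0r.
  have e1 : der2 1 = 0 by rewrite der2E !(der1, der0) scaler0 subr0.
  by rewrite e1 !E0.
- by rewrite !(der2D, der2Z) IH1 IH2 scaler0 addr0.
rewrite !(der2L, der2D, der2Z) IH mulr0 !scaler0 add0r.
have sE : subalgebra (der2 f1).
  rewrite der2E -scaleNr addrC.
  by apply: subalgebraL; do 2!apply: derS.
rewrite (der2_a sf1) der2Z (der2_a sE).
apply: qfunP => u; rewrite !qfunE; abstract_values u.
by have [->|ib] := eqVneq i b; rewrite ?qba ?qbb /=; ring: xx.
Qed.

End Operators.

Lemma qder_cubed c f :
  q c c = x -> subalgebra f -> qder c (qder c (qder c f)) = 0.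
Proof. by apply: der_cubed => // *; rewrite qder_letterM. Qed.

Definition qder2 f : F := qder a (qder b f) - x *: qder b (qder a f).

Lemma qder2_a f : subalgebra f -> qder2 (qder a f) = x *: qder a (qder2 f).
Proof.
exact: (@der2_a (@qder K J q) (fun _ _ _ => erefl) (fun _ _ _ => erefl)
  (fun _ => erefl) (fun i j g => qder_letterM i j g) qder2 (fun _ => erefl)).
Qed.

Lemma qder2_b f : subalgebra f -> qder2 (qder b f) = x ^+ 2 *: qder b (qder2 f).
Proof.
exact: (@der2_b (@qder K J q) (fun _ _ _ => erefl) (fun _ _ _ => erefl)
  (fun _ => erefl) (fun i j g => qder_letterM i j g) qder2 (fun _ => erefl)).
Qed.

Lemma qder2_cubed f : subalgebra f -> qder2 (qder2 (qder2 f)) = 0.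
Proof.
exact: (@der2_cubed (@qder K J q) (fun _ _ _ => erefl) (fun _ _ _ => erefl)
  (fun _ => erefl) (fun i j g => qder_letterM i j g) subalgebra_qder
  qder2 (fun _ => erefl)).
Qed.

End SubalgebraSpan.

Lemma span_induction (K : fieldType) (vT : vectType K) (s : seq vT)
    (P : vT -> Prop) : P 0 -> (forall c u v, P u -> P v -> P (c *: u + v)) ->
  (forall v, v \in s -> P v) -> forall v, v \in <<s>>%VS -> P v.
Proof.
move=> P0 Plin Ps v; rewrite -[s]/(val (in_tuple s)) => /coord_span->.
apply: big_ind => // [u w Pu Pw|k _]; first by rewrite -[u]scale1r; apply: Plin.
rewrite -[_ *: _]addr0; apply: Plin => //; apply: Ps.
exact: mem_nth.
Qed.

(** If the Nichols algebra vanishes from degree N on, then words of at most N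
    letters determine its elements, and linear algebra in the finite-dimensional
    space of functions on these words applies. *)
Section Truncation.
Variables (K : numFieldType) (J : finType) (q : J -> J -> K).
Hypothesis hq : forall i j, q i j != 0.
Variable N : nat.
Hypothesis dim0 : forall n, (N <= n)%N ->
  nichols_degree_dim (diagonal_space hq) n = 0%N.
Local Notation F := (qshuffle q).
Local Notation T := (N.-bseq J).
Local Notation W := {ffun T -> K^o}.
Implicit Types (f g : F) (u w : seq J) (h : W).

Definition trunc (f : F) : W := [ffun t : T => f t].
Definition untrunc (h : W) : F := fun u => if insub u is Some t then h t else 0.

Lemma trunc_is_linear : linear trunc.
Proof. by move=> c f g; apply/ffunP => t; rewrite !ffunE. Qed.
HB.instance Definition _ := GRing.isLinear.Build K F W _ trunc trunc_is_linear.

Lemma untrunc_is_linear : linear untrunc.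
Proof.
move=> c f g; apply/funext => u; rewrite !fctE /untrunc.
by case: insub => [t|]; rewrite ?ffunE // scaler0 addr0.
Qed.
HB.instance Definition _ := GRing.isLinear.Build K W F _ untrunc untrunc_is_linear.

Lemma untruncK : cancel untrunc trunc.
Proof. by move=> h; apply/ffunP => t; rewrite ffunE /untrunc valK. Qed.

Lemma monomial_large w u : (N <= size w)%N -> monomial q w u = 0.
Proof.
move=> Nw; apply/eqP/negPn/negP => wu.
have [N0|N0] := posnP N; first by have := dim0 (n := 0%N); rewrite N0 => /(_ isT).
have [m Dm] : exists m, size w = m.+1 by exists (size w).-1; lia.
have : nonzero_degree q m.+1 by exists w => //; exists u.
move/(diagonal_symmetrizer_neq0 hq); rewrite -nichols_degree_dim_eq0 dim0 //.
by rewrite -Dm.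
Qed.

Lemma subalgebra_large f u : subalgebra f -> (N <= size u)%N -> f u = 0.
Proof.
move=> /subalgebraP[l ->] Nu; rewrite fct_sumE big1 // => p _.
have [sz|sz] := eqVneq (size p.2) (size u).
  by rewrite qscaleE monomial_large ?sz ?mulr0.
by rewrite qscaleE monomial_size ?mulr0.
Qed.

Lemma truncK f : subalgebra f -> untrunc (trunc f) = f.
Proof.
move=> sf; apply/funext => u; rewrite /untrunc.
case: insubP => [t _ <-|]; first by rewrite ffunE.
by rewrite -ltnNge => Nu; rewrite (subalgebra_large sf) // ltnW.
Qed.

Definition trunc_algebra : {vspace W} :=
  <<[seq trunc (monomial q w) | w : T]>>%VS.

Lemma mem_trunc_monomial w : trunc (monomial q w) \in trunc_algebra.
Proof.
have [sw|sw] := leqP (size w) N.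
  by rewrite memv_span //; apply/imageP; exists (Bseq sw).
have -> : monomial q w = 0 by apply/funext => u; rewrite monomial_large // ltnW.
by rewrite linear0 mem0v.
Qed.

Lemma mem_trunc f : subalgebra f -> trunc f \in trunc_algebra.
Proof.
move=> /subalgebraP[l ->]; rewrite linear_sum rpred_sum // => p _.
by rewrite linearZ rpredZ // mem_trunc_monomial.
Qed.

Lemma subalgebra_untrunc h : h \in trunc_algebra -> subalgebra (untrunc h).
Proof.
move: h; apply: (@span_induction _ _ _ (fun h => subalgebra (untrunc h)))
  => [|c g k sg sk|_ /imageP[w _ ->]].
- by rewrite linear0; apply: subalgebra0.
- by rewrite linearP; apply: subalgebraL.
by rewrite truncK; apply: subalgebra_monomial.
Qed.

(** ** The dimension of the truncation *)

Definition trunc_degree n : {vspace W} :=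
  <<[seq trunc (monomial q (codom s)) | s : {ffun 'I_n -> J}]>>%VS.

Lemma trunc_degree_support n h (t : T) :
  h \in trunc_degree n -> size t != n -> h t = 0.
Proof.
move=> hn tn; move: h hn.
apply: (@span_induction _ _ _ (fun h => h t = 0))
  => [|c g k g0 k0|_ /imageP[s _ ->]].
- by rewrite ffunE.
- by rewrite !ffunE g0 k0 scaler0 addr0.
by rewrite ffunE monomial_size // size_codom card_ord eq_sym.
Qed.

Lemma mem_trunc_degree n w :
  size w = n -> trunc (monomial q w) \in trunc_degree n.
Proof.
move=> /word_codom[s <-].
by apply: memv_span; apply/imageP; exists s.
Qed.

Definition at_degree n (h : W) : {ffun {ffun 'I_n -> J} -> K^o} :=
  [ffun s : {ffun 'I_n -> J} => h (insub_bseq N (codom s))].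

Lemma at_degree_is_linear n : linear (at_degree n).
Proof. by move=> c g h; apply/ffunP => s; rewrite !ffunE. Qed.
HB.instance Definition _ n :=
  GRing.isLinear.Build K W _ _ (at_degree n) (@at_degree_is_linear n).

Lemma val_insub_codom n (s : {ffun 'I_n -> J}) : (n <= N)%N ->
  insub_bseq N (codom s) = codom s :> seq J.
Proof.
by move=> nN; apply: insubdK; rewrite unfold_in /= size_codom card_ord.
Qed.

Lemma span_basis_vec (B : finType) :
  <<[seq basis_vec K b | b : B]>>%VS = fullv.
Proof.
apply/vspaceP => f; rewrite [RHS]memvf.
have -> : f = \sum_b f b *: basis_vec K b.
  apply/ffunP => b; rewrite sum_ffunE (bigD1 b) //= big1 ?addr0 => [|b' bb'].
    by rewrite !ffunE eqxx [RHS]mulr1.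
  by rewrite !ffunE eq_sym (negPf bb') scaler0.
rewrite rpred_sum // => b _; rewrite rpredZ // memv_span //.
by apply/imageP; exists b.
Qed.

Lemma dim_trunc_degree n : (n <= N)%N ->
  \dim (trunc_degree n) = nichols_degree_dim (diagonal_space hq) n.
Proof.
case: n => [|n] nN.
  transitivity (\dim <[trunc (monomial q [::])]>%VS).
    congr (\dim _).
    apply/eqP; rewrite eqEsubv -memvE mem_trunc_degree // andbT.
    apply/subvP; apply: (@span_induction _ _ _ (fun h => h \in <[_]>%VS))
      => [|c g k gs ks|_ /imageP[s _ ->]].
    - exact: mem0v.
    - by rewrite rpredD ?rpredZ.
    have -> : codom s = [::] by apply/nilP; rewrite /nilp size_codom card_ord.
    exact: memv_line.
  rewrite dim_vline; case: eqP => // /ffunP/(_ [bseq]).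
  by rewrite !ffunE monomial_nil => /eqP; rewrite oner_eq0.
rewrite nichols_degree_dimE.
transitivity (\dim (linfun (at_degree n.+1) @: trunc_degree n.+1)%VS).
  rewrite limg_dim_eq //; apply/eqP; rewrite -subv0; apply/subvP => h.
  rewrite memv_cap memv_ker memv0 lfunE /= => /andP[hn /eqP h0].
  apply/eqP/ffunP => t; rewrite [RHS]ffunE.
  have [st|st] := eqVneq (size t) n.+1; last exact: trunc_degree_support st.
  have [s Ds] := word_codom st.
  have := congr1 (fun g : {ffun _ -> _} => g s) h0; rewrite !ffunE.
  congr (h _ = _); apply: val_inj.
  by rewrite /= val_insub_codom.
congr (\dim _); rewrite -(span_basis_vec _) !limg_span -!map_comp.
congr (span _); apply: eq_map => s /=; rewrite lfunE /=.
apply/ffunP => u; rewrite quantum_symmetrizerE !ffunE val_insub_codom //.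
rewrite (bigD1 s) //= ffunE eqxx mul1r big1 ?addr0 // => w ws.
by rewrite ffunE (negPf ws) mul0r.
Qed.

Lemma dim_trunc_algebra :
  \dim trunc_algebra = (\sum_(n < N) nichols_degree_dim (diagonal_space hq) n)%N.
Proof.
have -> : trunc_algebra = (\sum_(n < N) trunc_degree n)%VS.
  apply/eqP; rewrite eqEsubv; apply/andP; split; apply/subvP.
    apply: (@span_induction _ _ _ (fun h => h \in (\sum_(n < N) trunc_degree n)%VS))
      => [|c g k gs ks|_ /imageP[w _ ->]].
    - exact: mem0v.
    - by rewrite rpredD ?rpredZ.
    have [wN|Nw] := ltnP (size w) N.
      apply: (subvP (sumv_sup (Ordinal wN) isT (subvv _))).
      exact: mem_trunc_degree.
    have -> : monomial q w = 0 by apply/funext => u; rewrite monomial_large.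
    by rewrite linear0 mem0v.
  move=> h /memv_sumP[hs hsn ->]; rewrite rpred_sum // => n _.
  move: (hs n) (hsn n isT).
  apply: (@span_induction _ _ _ (fun h => h \in trunc_algebra))
    => [|c g k gs ks|_ /imageP[s _ ->]].
  - exact: mem0v.
  - by rewrite rpredD ?rpredZ.
  exact: mem_trunc_monomial.
have /directvP-> : directv (\sum_(n < N) trunc_degree n)%VS.
  apply/directv_sum_independent => hs hsn sum0 n _; apply/ffunP => t.
  rewrite [RHS]ffunE; have [st|st] := eqVneq (size t) n; last first.
    by apply: (trunc_degree_support (hsn n isT)); rewrite st.
  have := congr1 (fun g : W => g t) sum0.
  rewrite sum_ffunE ffunE (bigD1 n) //= big1 ?addr0 // => m mn.
  apply: (trunc_degree_support (hsn m isT)).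
  by rewrite st (inj_eq (@ord_inj _)) eq_sym.
by apply: eq_bigr => n _; apply: dim_trunc_degree (ltnW (ltn_ord n)).
Qed.

Definition trunc_op (phi : F -> F) : 'End(W) :=
  linfun (fun h : W => trunc (phi (untrunc h))).

Lemma trunc_opE phi h : linear phi -> trunc_op phi h = trunc (phi (untrunc h)).
Proof.
move=> lphi; pose g (h : W) := trunc (phi (untrunc h)).
have lg : linear g by move=> c k l; rewrite /g linearP lphi linearP.
pose gl : {linear W -> W} := HB.pack g (GRing.isLinear.Build K W W _ g lg).
exact: (lfunE gl h).
Qed.

Section Operator.
Variable phi : F -> F.
Hypotheses (lphi : linear phi)
  (sphi : forall f, subalgebra f -> subalgebra (phi f)).

Lemma untrunc_op h : h \in trunc_algebra ->
  untrunc (trunc_op phi h) = phi (untrunc h).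
Proof.
by move=> hB; rewrite trunc_opE // truncK //; apply/sphi/subalgebra_untrunc.
Qed.

Lemma trunc_op_mem h : h \in trunc_algebra -> trunc_op phi h \in trunc_algebra.
Proof.
by move=> hB; rewrite trunc_opE // mem_trunc //; apply/sphi/subalgebra_untrunc.
Qed.

Lemma mem_trunc_ker h : h \in trunc_algebra ->
  (h \in lker (trunc_op phi)) = (phi (untrunc h) == 0).
Proof.
move=> hB; rewrite memv_ker -(can_eq untruncK) untrunc_op //.
by rewrite linear0.
Qed.

End Operator.

Definition trunc_spec (U : {vspace W}) (P : F -> Prop) : Prop :=
  forall h, h \in U <-> h \in trunc_algebra /\ P (untrunc h).

Lemma trunc_weyl (U : {vspace W}) (P : F -> Prop) (X D : F -> F) (x : K) :
  1 + x != 0 -> trunc_spec U P -> linear X -> linear D ->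
  (forall f, subalgebra f -> P f -> subalgebra (X f) /\ P (X f)) ->
  (forall f, subalgebra f -> subalgebra (D f)) ->
  (forall f, subalgebra f -> P f -> P (D f)) ->
  (forall f, subalgebra f -> P f -> D (X f) = f + x *: X (D f)) ->
  (forall f, subalgebra f -> P f -> D (D (D f)) = 0) ->
  exists2 U' : {vspace W}, trunc_spec U' (fun f => P f /\ D f = 0) &
    \dim U = (3 * \dim U')%N.
Proof.
move=> x1 UP lX lD sX sD PD DX D3; exists (U :&: lker (trunc_op D))%VS.
  move=> h; rewrite memv_cap; split=> [/andP[/UP[hB Ph]]|[hB [Ph Dh]]].
    by rewrite mem_trunc_ker // => /eqP.
  apply/andP; split; first exact/UP.
  by rewrite mem_trunc_ker // Dh.
have inB h : h \in U -> h \in trunc_algebra by move/UP=> [].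
have DE h : h \in U -> untrunc (trunc_op D h) = D (untrunc h).
  by move/inB; apply: untrunc_op.
have XE h : h \in U -> untrunc (trunc_op X h) = X (untrunc h).
  move=> /UP[hB Ph]; rewrite trunc_opE // truncK //.
  by have [] := sX _ (subalgebra_untrunc hB) Ph.
have DU h : h \in U -> trunc_op D h \in U.
  move=> hU; have [hB Ph] := (UP h).1 hU; apply/UP; rewrite DE //.
  by split; [apply: trunc_op_mem | apply: PD => //; apply: subalgebra_untrunc].
have XU h : h \in U -> trunc_op X h \in U.
  move=> hU; have [hB Ph] := (UP h).1 hU; apply/UP; rewrite XE //.
  have [sXh PXh] := sX _ (subalgebra_untrunc hB) Ph.
  by split=> //; rewrite trunc_opE // mem_trunc.
apply: (weyl_dim (X := trunc_op X) (D := trunc_op D) x1) => // h hU.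
  apply: (can_inj untruncK); rewrite DE ?XU // XE // linearD linearZ /= XE ?DU //.
  rewrite DE //; have [hB Ph] := (UP h).1 hU.
  by apply: DX => //; apply: subalgebra_untrunc.
apply: (can_inj untruncK); rewrite DE ?DU // DE ?DU // DE // linear0.
have [hB Ph] := (UP h).1 hU.
by apply: D3 => //; apply: subalgebra_untrunc.
Qed.


Lemma qmul_is_lin f : linear (fun g => f * g).
Proof. by move=> c g1 g2; rewrite mulrDr -scalerAr. Qed.

(** Removing a, then b a, then b: the successive kernels have a third of the
    dimension each.  The Serre relations ensure that each operator preserves the
    common kernel of the preceding ones. *)
Lemma dvd27 (a b : J) (x : K) : a != b -> q a a = x -> q a b = x ->
  q b a = x -> q b b = x -> 3.-primitive_root x ->
  (27 %| \sum_(n < N) nichols_degree_dim (diagonal_space hq) n)%N.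
Proof.
move=> ab qaa qab qba qbb xprim.
have x1 : x != 1 by rewrite -[x]expr1 -(prim_order_dvd xprim).
have x3 : 1 + x + x ^+ 2 = 0.
  apply/eqP; have : (x - 1) * (1 + x + x ^+ 2) == 0.
    have -> : (x - 1) * (1 + x + x ^+ 2) = x ^+ 3 - 1 by ring.
    by rewrite (prim_expr_order xprim) subrr.
  by rewrite mulf_eq0 subr_eq0 (negPf x1).
have xp1 : 1 + x != 0.
  apply: contraTneq (oner_neq0 K) => e; have := x3; rewrite e add0r => /eqP.
  by rewrite expf_eq0 /= => /eqP x0; move/eqP: e; rewrite x0 addr0 => ->.
pose Da := @qder K J q a; pose Db := @qder K J q b; pose E := Da \o Db.
have lDa : linear Da by []. have lDb : linear Db by []. have lE : linear E by [].
have lDa' c f g : Da (f + c *: g) = Da f + c *: Da g by [].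
have sDa f : subalgebra f -> subalgebra (Da f) by apply: subalgebra_qder.
have sDb f : subalgebra f -> subalgebra (Db f) by apply: subalgebra_qder.
have sE f : subalgebra f -> subalgebra (E f) by move=> sf; apply/sDa/sDb.
pose za := letter q a; pose zb := letter q b.
pose z : F := (1 - x ^+ 2)^-1 *: (zb * za - x *: (za * zb)).
have sza : subalgebra za := subalgebra_letter q a.
have szb : subalgebra zb := subalgebra_letter q b.
have sz : subalgebra z.
  apply/subalgebraZ; rewrite addrC -scaleNr.
  by apply: subalgebraL; apply: subalgebraM.
have x2 : 1 - x ^+ 2 != 0.
  by rewrite subr_eq0 eq_sym -(prim_order_dvd xprim).
have Da_za : Da za = 1 by rewrite /Da qder_letter eqxx scale1r.
have Da_zb : Da zb = 0 by rewrite /Da qder_letter eq_sym (negPf ab) scale0r.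
have Db_za : Db za = 0 by rewrite /Db qder_letter (negPf ab) scale0r.
have Db_zb : Db zb = 1 by rewrite /Db qder_letter eqxx scale1r.
have DaM f g : Da (f * g) = Da f * g + qtwist a f * Da g by apply: qderM.
have DbM f g : Db (f * g) = Db f * g + qtwist b f * Db g by apply: qderM.
have Ta_za : qtwist a za = x *: za by rewrite qtwist_letter qaa.
have Ta_zb : qtwist a zb = x *: zb by rewrite qtwist_letter qba.
have Tb_za : qtwist b za = x *: za by rewrite qtwist_letter qab.
have Tb_zb : qtwist b zb = x *: zb by rewrite qtwist_letter qbb.
have Da_z : Da z = 0.
  rewrite /z /Da qderZ qderB qderZ -/Da !DaM Da_za Da_zb Ta_za Ta_zb.
  by rewrite mul0r mulr0 mulr1 mul1r addr0 add0r subrr scaler0.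
have Db_z : Db z = za.
  rewrite /z /Db qderZ qderB qderZ -/Db !DbM Db_za Db_zb Tb_za Tb_zb.
  rewrite mul0r mulr0 mulr1 mul1r addr0 add0r scalerA -expr2.
  have -> : za - x ^+ 2 *: za = (1 - x ^+ 2) *: za by rewrite scalerBl scale1r.
  by rewrite scalerA mulVf // scale1r.
have hz : homog (fun j => q b j * q a j) z.
  apply: homogZ; apply: homogB.
    exact: homogM (homog_letter q b) (homog_letter q a).
  apply: homogZ; have := homogM (homog_letter q a) (homog_letter q b).
  by congr (homog _ _); apply/funext => j; rewrite mulrC.
have Da_zM g : Da (z * g) = x ^+ 2 *: (z * Da g).
  by rewrite DaM Da_z mul0r add0r hz qba qaa -scalerAl -expr2.
have Db_zM g : Db (z * g) = za * g + x ^+ 2 *: (z * Db g).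
  by rewrite DbM Db_z hz qbb qab -scalerAl -expr2.
have x4 : x ^+ 2 * x ^+ 2 = x.
  have -> : x ^+ 2 * x ^+ 2 = x ^+ 3 * x by ring.
  by rewrite (prim_expr_order xprim) mul1r.
have lM f : linear (fun g => f * g) := qmul_is_lin f.
have spec0 : trunc_spec trunc_algebra (fun=> True) by move=> h; split=> [|[]].
have := trunc_weyl (X := fun g => za * g) (D := Da) xp1 spec0 (lM za) lDa.
case=> // [f sf _|f sf _|f sf _|B1 spec1 dim1].
- by split=> //; apply: subalgebraM.
- by rewrite DaM Da_za Ta_za mul1r -scalerAl.
- exact: (qder_cubed (x := x)).
have E2 f : Da f = 0 -> qder2 a b x f = E f.
  by move=> f0; rewrite /qder2 -/Da f0 qder0 scaler0 subr0.
have x0 : x != 0.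
  apply: contraNneq x1 => xz.
  by rewrite -[x]mulr1 -(prim_expr_order xprim) xz expr0n mulr0.
have DaE f : subalgebra f -> Da f = 0 -> Da (E f) = 0.
  move=> sf f0; have := qder2_a ab qaa qab qba qbb x3 sf.
  have -> : qder2 a b x (Da f) = 0 by rewrite f0 /qder2 !qder0 scaler0 subr0.
  by rewrite E2 // => /esym/eqP; rewrite scaler_eq0 (negPf x0) => /eqP.
have := trunc_weyl (X := fun g => z * g) (D := E) xp1 spec1 (lM z) lE.
case=> // [f sf [_ f0]|f sf [_ f0]|f sf [_ f0]|f sf [_ f0]|B2 spec2 dim2].
- by split; [apply: subalgebraM | rewrite Da_zM f0 mulr0 scaler0].
- by split=> //; apply: DaE.
- rewrite /E /= Db_zM lDa' Da_zM DaM Da_za mul1r Ta_za f0 mulr0 addr0.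
  by rewrite scalerA x4.
- have sEf := sE _ sf; have sEEf := sE _ sEf.
  rewrite -(E2 (E (E f))) ?DaE ?DaE // -(E2 (E f)) ?DaE // -(E2 f) //.
  exact: (qder2_cubed ab qaa qab qba qbb x3).
have := trunc_weyl (X := fun g => zb * g) (D := Db) xp1 spec2 (lM zb) lDb.
case=> // [f sf [[_ f0] Ef]|f sf [[_ f0] Ef]|f sf _|f sf _|B3 _ dim3].
- split; first exact: subalgebraM.
  have Da_zbM g : Da (zb * g) = x *: (zb * Da g).
    by rewrite DaM Da_zb mul0r add0r Ta_zb -scalerAl.
  split; first by split=> //; rewrite Da_zbM f0 mulr0 scaler0.
  rewrite /E /= DbM Db_zb mul1r Tb_zb -scalerAl lDa' f0 add0r Da_zbM.
  by move: Ef; rewrite /E /= => ->; rewrite mulr0 !scaler0.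
- have DaDb : Da (Db f) = 0 := Ef.
  split=> //; rewrite -E2 // (qder2_b ab qaa qab qba qbb x3 sf) E2 // Ef.
  by rewrite qder0 scaler0.
- by rewrite DbM Db_zb Tb_zb mul1r -scalerAl.
- exact: (qder_cubed (x := x)).
rewrite -dim_trunc_algebra dim1 dim2 dim3 !mulnA.
exact: dvdn_mulr.
Qed.

End Truncation.

(** * The theorem *)

Lemma card2_isC2 (A : finGroupType) : #|A| = 2%N -> isC2 A.
Proof.
move=> A2; have cA : cyclic [set: A] by rewrite prime_cyclic // cardsT A2.
by rewrite /isC2 isog_cyclic_card // prime_cyclic ?cardsT ?card_ord ?A2.
Qed.

Lemma card2_dvd27 (K : numFieldType) (X : finType) (A : finGroupType)
    (sigma : X -> A) (abA : abelian [set: A]) (q : X -> X -> K) (omega : A -> K)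
    (hq : forall i j, q i j != 0) (homega : is_character omega) i d :
  #|A| = 2%N -> 3.-primitive_root (q i i) ->
  nichols_dim (ext_space sigma abA hq homega) d -> (27 %| d)%N.
Proof.
move=> A2 q3 [N [dim0 ->]].
have inj : injective (fun x : X * bool => (x.1, x.2)) by move=> [j e] [k f] [-> ->].
have cardJ : #|{: X * bool}| = #|{: X * A}| by rewrite !card_prod card_bool A2.
have dimE n := c2_degree_dim sigma abA A2 hq homega inj n cardJ.
under eq_bigr => n _ do rewrite (dimE n).
have lamE e f : c2_braiding sigma q (fun x : X * bool => x.1) snd (i, e) (i, f) = q i i.
  by rewrite /c2_braiding /eig_braiding /c2_lam eqxx andbF mulr1.
apply: (@dvd27 _ _ _ _ N _ (i, false) (i, true) (q i i)).
- by move=> n Nn; rewrite -dimE dim0.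
- by rewrite xpair_eqE andbF.
1-4: exact: lamE.
exact: q3.
Qed.

Section SignCase.
Variables (K : numFieldType) (X : finType) (A : finGroupType) (sigma : X -> A).
Hypotheses (abA : abelian [set: A]) (A2 : #|A| = 2%N).
Variables (q : X -> X -> K) (omega : A -> K).
Hypotheses (hq : forall i j, q i j != 0) (homega : is_character omega).
Local Notation V := (ext_space sigma abA hq homega).
Hypothesis q_diag : forall i, q i i = -1.
Hypothesis q_sign : forall i j, i != j -> q i j * q j i = 1 \/ q i j * q j i = -1.

Lemma edgeF i j : (i != j -> q i j * q j i = 1) -> edge q i j = false.
Proof.
have n1 : (1 == -1 :> K) = false by rewrite -subr_eq0 opprK -mulr2n pnatr_eq0.
rewrite /edge; have [->|_ -> //] := eqVneq i j.
by rewrite q_diag mulrNN mulr1.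
Qed.

(** Two sets that cover X, on each of which sigma is constant. *)
Variables Y Z : {set X}.
Hypotheses (YZ : forall i, (i \in Z) = (i \notin Y))
  (sY : forall i j, i \in Y -> j \in Y -> sigma i = sigma j)
  (sZ : forall i j, i \in Z -> j \in Z -> sigma i = sigma j)
  (sYZ : forall i j, i \in Y -> j \in Z -> sigma i != sigma j).

Lemma one_side_finite : conjectureD K -> #|Y| = 1%N -> (#|Z| <= 3)%N ->
  (forall i j, i \in Z -> j \in Z -> i != j -> q i j * q j i = 1) ->
  nichols_finite V.
Proof.
move=> D /eqP/cards1P[i Ei] Z3 pZ.
have inZ j : j != i -> j \in Z by rewrite YZ Ei inE.
apply: (@star_finite _ _ _ sigma abA A2 q omega hq homega q_diag q_sign i D).
- have -> : #|X| = (#|Y| + #|Z|)%N.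
    rewrite -(cardsC Y); congr (_ + _)%N; apply: eq_card => j.
    by rewrite !inE YZ.
  by rewrite Ei cards1.
- by move=> j /inZ; apply: sYZ; rewrite Ei inE.
- by move=> j k /inZ jZ /inZ kZ; apply: edgeF => /(pZ j k jZ kZ).
- by move=> j k /inZ jZ /inZ kZ; apply: sZ.
Qed.

Lemma one_side_infinite : conjectureD K ->
  #|Y| = 1%N -> (forall i j, i \in Z -> j \in Z -> i != j -> q i j * q j i = 1) ->
  (3 < #|Z|)%N -> nichols_infinite V.
Proof.
move=> D /eqP/cards1P[i Ei] pZ Z4.
apply: (@star_infinite _ _ _ sigma abA A2 q omega hq homega q_diag q_sign i Z D Z4).
- by move=> j; apply: sYZ; rewrite Ei inE.
- by move=> j k jZ kZ; apply: edgeF => /(pZ j k jZ kZ).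
- by move=> j k; apply: sZ.
Qed.

Lemma both_sides_infinite : (1 < #|Y|)%N -> (1 < #|Z|)%N ->
  (forall i j, sigma i = sigma j -> i != j -> q i j * q j i = 1) ->
  nichols_infinite V.
Proof.
move=> /card_gt1P[i [i' [iY i'Y ii']]] /card_gt1P[j [j' [jZ j'Z jj']]] p1.
pose pt (x : bool * bool) :=
  if x.1 then (if x.2 then j' else j) else (if x.2 then i' else i).
have pts x y : (sigma (pt x) == sigma (pt y)) = (x.1 == y.1).
  have ptYZ z : if z.1 then pt z \in Z else pt z \in Y.
    by case: z => [[] []].
  move: (ptYZ x) (ptYZ y); case: x.1; case: y.1 => px py.
  - by rewrite (sZ px py) !eqxx.
  - by rewrite eq_sym (negPf (sYZ py px)).
  - by rewrite (negPf (sYZ px py)).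
  - by rewrite (sY px py) !eqxx.
apply: (@two_sides_infinite _ _ _ sigma abA A2 q omega hq homega
  q_diag q_sign pt) => //.
  move=> x y E; have := pts x y; rewrite E eqxx => /esym/eqP.
  move: E; rewrite /pt; case: x => [[] []]; case: y => [[] []] //= E _;
    by move: ii' jj'; rewrite ?E eqxx.
by move=> x y E; apply: edgeF; apply: p1; apply/eqP; rewrite pts E.
Qed.

End SignCase.

Lemma sign_isom_card (A : finGroupType) (e : A -> int) : sign_isom e -> #|A| = 2%N.
Proof.
move=> [_ e_inj eP]; have [a ea] := (eP 1).2 (or_introl erefl).
have [b eb] := (eP (-1)).2 (or_intror erefl).
have ab : a != b by apply: contra_eq_neq ea => ->; rewrite eb.
rewrite -cardsT (_ : [set: A] = [set a; b]) ?cards2 ?ab //.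
apply/setP => c; rewrite !inE; apply/esym.
have [ec|ec] := (eP (e c)).1 (ex_intro _ c erefl).
  by rewrite (e_inj c a) ?eqxx // ec.
by rewrite (e_inj c b) ?eqxx ?orbT // ec.
Qed.



Theorem proposition6p8 (R : realType) (X : finType) (A : finGroupType)
  (sigma : X -> A) (q : X -> X -> R[i]) (omega : A -> R[i])
  (X_nonempty : (0 < #|X|)%N)
  (A_abelian : abelian [set: A])
  (A_nontrivial : (1 < #|A|)%N)
  (sigma_nonconstant : exists i j, sigma i != sigma j)
  (q_neq0 : forall i j, q i j != 0)
  (omega_char : is_character omega) :
  let V := ext_space sigma A_abelian q_neq0 omega_char in
  (* (1) *)
  ((exists i, ord_gt (q i i) 3) -> nichols_infinite V) /\
  (* (2) *)
  ((exists i, 3.-primitive_root (q i i)) ->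
     (isC2 A /\ (forall d, nichols_dim V d -> (27 %| d)%N)) \/
     nichols_infinite V) /\
  (* (3) and (4) *)
  (forall M : X -> X -> int,
     (forall i, q i i = -1) ->
     sign_exponents q M ->
     (forall i j, (#[kappa sigma i j]%g <= 2)%N) ->
     (~ isC2 A -> nichols_infinite V) /\
     (forall e : A -> int, sign_isom e -> conjectureD R[i] ->
        let Xp := [set i | e (sigma i) == 1] in
        let Xm := [set i | e (sigma i) == -1] in
        let finite_case (Y Z : {set X}) :=
          #|Y| = 1%N /\ (#|Z| <= 3)%N /\
          (forall i j, i \in Z -> j \in Z -> i != j -> q i j * q j i = 1) in
        (finite_case Xp Xm -> nichols_finite V) /\
        (finite_case Xm Xp -> nichols_finite V) /\
        (~ finite_case Xp Xm -> ~ finite_case Xm Xp -> nichols_infinite V))).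
Proof.
move=> V; split; last split.
- by move=> [i qi]; apply: ord_gt3_infinite qi.
- move=> [i qi]; have [A2|A3] := eqVneq #|A| 2%N.
    left; split; first exact: card2_isC2.
    by move=> d; apply: card2_dvd27 qi.
  by right; apply: ord3_infinite qi; lia.
move=> M qd qM k2; have q_sign i j : i != j -> q i j * q j i = 1 \/ q i j * q j i = -1.
  move=> /qM[[] -> ->]; first by left; rewrite expr0z.
  by right; rewrite exprN1 invrN1.
split=> [nC2|e eP D Xp Xm finite_case].
  have [i [j sij]] := sigma_nonconstant.
  have ij : i != j by apply: contra_neq sij => ->.
  have A3 : (2 < #|A|)%N.
    have A2 : #|A| <> 2%N by move/card2_isC2.
    by move/eqP: A2; move: A_nontrivial; lia.
  apply: (@order2_infinite _ _ _ sigma A_abelian q omega q_neq0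
    omega_char i j A3 sij) => //.
    have := k2 i j; have := order_gt0 (kappa sigma i j).
    have := expg_order (kappa sigma i j).
    by case: #[_]%g => [|[|[|]]] //; rewrite ?expg1 => kk _ _; rewrite ?kk ?mulg1.
  by case: (q_sign i j ij) => ->; rewrite ?sqrrN expr1n.
have A2 := sign_isom_card eP; have [_ e_inj e_im] := eP.
have e_or i : e (sigma i) = 1 \/ e (sigma i) = -1 by apply/e_im; exists (sigma i).
have XmP i : (i \in Xm) = (i \notin Xp).
  by rewrite !inE; case: (e_or i) => ->.
have XpP i : (i \in Xp) = (i \notin Xm) by rewrite XmP negbK.
have sp i j : i \in Xp -> j \in Xp -> sigma i = sigma j.
  by rewrite !inE => /eqP ei /eqP ej; apply: e_inj; rewrite ei.
have sm i j : i \in Xm -> j \in Xm -> sigma i = sigma j.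
  by rewrite !inE => /eqP ei /eqP ej; apply: e_inj; rewrite ei.
have spm i j : i \in Xp -> j \in Xm -> sigma i != sigma j.
  by rewrite !inE => /eqP ei /eqP ej; apply: contra_eq_neq ei => ->; rewrite ej.
have smp i j : i \in Xm -> j \in Xp -> sigma i != sigma j.
  by move=> iX jX; rewrite eq_sym spm.
split.
  by case=> p1 [m3 pm];
    apply: (@one_side_finite _ _ _ sigma A_abelian A2 q omega q_neq0
      omega_char qd q_sign Xp Xm).
split.
  by case=> p1 [m3 pm];
    apply: (@one_side_finite _ _ _ sigma A_abelian A2 q omega q_neq0
      omega_char qd q_sign Xm Xp).
move=> npm nmp.
have [[i [j [ij sij eij]]]|no_edge] := pselect (exists i j,
    [/\ i != j, sigma i = sigma j & edge q i j]).
  exact: (@same_side_infinite _ _ _ sigma A_abelian A2 q omega q_neq0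
    omega_char qd q_sign i j ij sij eij).
have p1 i j : sigma i = sigma j -> i != j -> q i j * q j i = 1.
  move=> sij ij; case: (q_sign i j ij) => // pij; case: no_edge.
  by exists i, j; split=> //; rewrite /edge pij.
have pp i j : i \in Xp -> j \in Xp -> i != j -> q i j * q j i = 1.
  by move=> iX jX; apply: p1; apply: sp.
have pm i j : i \in Xm -> j \in Xm -> i != j -> q i j * q j i = 1.
  by move=> iX jX; apply: p1; apply: sm.
have [Xp0 Xm0] : (0 < #|Xp|)%N /\ (0 < #|Xm|)%N.
  have [i [j sij]] := sigma_nonconstant.
  split; rewrite card_gt0; apply/set0Pn.
    have [iX|] := boolP (i \in Xp); first by exists i.
    rewrite -XmP => iX; exists j; rewrite XpP; apply: contra_neqN sij.
    exact: sm.
  have [iX|] := boolP (i \in Xm); first by exists i.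
  rewrite -XpP => iX; exists j; rewrite XmP; apply: contra_neqN sij.
  exact: sp.
have [Xp1|Xp1] := eqVneq #|Xp| 1%N.
  apply: (@one_side_infinite _ _ _ sigma A_abelian A2 q omega q_neq0
      omega_char qd q_sign Xp Xm) => //.
  by rewrite ltnNge; apply/negP => m3; apply: npm.
have [Xm1|Xm1] := eqVneq #|Xm| 1%N.
  apply: (@one_side_infinite _ _ _ sigma A_abelian A2 q omega q_neq0
      omega_char qd q_sign Xm Xp) => //.
  by rewrite ltnNge; apply/negP => m3; apply: nmp.
by apply: (@both_sides_infinite _ _ _ sigma A_abelian A2 q omega q_neq0
      omega_char qd q_sign Xp Xm) => //; lia.
Qed.
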